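(* The Borodin–Olshanski series $$ {}_2\widehat F_1(a,b;c;x;\alpha)=\sum_{\lambda\in\mathcal P_n}\frac{(a;\alpha)_\lambda(b;\alpha)_\lambda}{(c)_{|\lambda|}}\,\alpha^{|\lambda|}\,\frac{J_\lambda(x)}{j_\lambda}$$ is the unique element $F(x)$ of $\mathscr F^{(x)}$ satisfying $$\bigl(\widehat{\mathcal N}(c)-\mathcal R(a,b)\bigr)(F(x))=0,\qquad F(\mathbf 0_n)=1 .$$
   Context: Fix $n\ge 1$, let $\alpha$ be an indeterminate over $\mathbb Q$ and $a,b,c$ further indeterminates; $x=(x_1,\dots,x_n)$, $\mathbf 0_n=(0,\dots,0)$. $\mathcal P_n$ is the set of partitions $\lambda=(\lambda_1\ge\dots\ge\lambda_n\ge0)$ of length at most $n$; $|\lambda|=\sum_i\lambda_i$; $\lambda$ is identified with its Young diagram $\{(i,j):1\le j\le\lambda_i\}$; $\lambda'$ is the conjugate partition. Jack polynomials: on the ring of symmetric functions over $\mathbb Q(\alpha)$ let $\langle p_\lambda,p_\mu\rangle_\alpha=\delta_{\lambda\mu}z_\lambda\alpha^{\ell(\lambda)}$, where $p_\lambda$ are power sums, $z_\lambda=\prod_r r^{m_r}m_r!$ and $m_r$ is the multiplicity of $r$ in $\lambda$. The integral form Jack functions $J_\lambda=J_\lambda(\cdot;\alpha)$ are the unique pairwise orthogonal family such that $J_\lambda$ is a linear combination of monomial symmetric functions $m_\mu$ with $\mu\le\lambda$ in dominance order and the coefficient of $m_{(1^{|\lambda|})}$ in $J_\lambda$ is $|\lambda|!$.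 $J_\lambda(x)$ denotes the restriction to $n$ variables. Put $j_\lambda=\prod_{(i,j)\in\lambda}\bigl((\lambda_i-j)\alpha+\lambda_j'-i+1\bigr)\bigl((\lambda_i-j+1)\alpha+\lambda_j'-i\bigr)$. $(a;\alpha)_\lambda=\prod_{(i,j)\in\lambda}\bigl(a+(j-1)-\tfrac{i-1}{\alpha}\bigr)$, and $(c)_k=c(c+1)\cdots(c+k-1)$ is the ordinary Pochhammer symbol. Let $K=\mathbb Q(\alpha)(a,b,c)$. $\mathscr F^{(x)}$ is the space of formal power series $F(x)=\sum_{\lambda\in\mathcal P_n}C_\lambda\,\alpha^{|\lambda|}J_\lambda(x)/j_\lambda$ with $C_\lambda\in K$. With $\partial_i=\partial/\partial x_i$ and acting term-wise on symmetric formal power series: $$\widehat{\mathcal N}(c)=\Bigl(c-1+\sum_{i=1}^n x_i\partial_i\Bigr)\sum_{i=1}^n x_i\partial_i,$$ $$\mathcal R(a,b)=\sum_{i=1}^n\bigl(x_i^3\partial_i^2+(a+b+1)x_i^2\partial_i+ab\,x_i\bigr)+\frac2\alpha\sum_{1\le i\ne j\le n}\frac{x_ix_j}{x_i-x_j}\,x_i\partial_i .$$ *)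

(* Defs.v *)
From HB Require Import structures.
From mathcomp Require Import all_boot all_order all_algebra.
From mathcomp.multinomials Require Export mpoly.

Set Implicit Arguments.
Unset Strict Implicit.
Unset Printing Implicit Defensive.

Import GRing.Theory.
Local Open Scope ring_scope.

Notation tofrac := (@FracField.tofrac _).

(* A partition is the weakly decreasing sequence of its nonzero parts, so that
   its length is [size] and its weight is [sumn]. *)
Definition is_partn (la : seq nat) : bool := sorted geq la && (0 \notin la)%N.

(* All partitions of d with at most n parts, listed once each (see mem_partns
   and partns_uniq): the weakly decreasing exponent vectors of degree d, without
   their trailing zeros. *)
Definition partns (n d : nat) : seq (seq nat) :=
  [seq [seq r <- val (bmnm m) | (0 < r)%N]
     | m : 'X_{1..n < d.+1} <- enum {: 'X_{1..n < d.+1}}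
     & (mdeg m == d) && sorted geq (val (bmnm m))].

Lemma mem_partns n d la :
  (la \in partns n d) = [&& is_partn la, size la <= n & sumn la == d]%N.
Proof.
have geq_trans : transitive geq by move=> a b c /= h1 h2; exact: leq_trans h2 h1.
have sumn_filter (s : seq nat) : sumn [seq r <- s | (0 < r)%N] = sumn s.
  by elim: s => //= -[|a] s /= ->.
apply/mapP/and3P => [[m]|[/andP[srt n0] sz /eqP sm]].
  rewrite mem_filter => /andP[/andP[/eqP dm srt] _] ->; split.
  - rewrite /is_partn mem_filter /= andbT; exact: sorted_filter.
  - by rewrite size_filter (leq_trans (count_size _ _)) // size_tuple.
  - by rewrite sumn_filter -[in X in _ == X]dm mdegE sumnE big_tuple.
pose t := la ++ nseq (n - size la) 0%N.
have tsz : size t == n by rewrite size_cat size_nseq subnKC.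
pose m := Multinom (Tuple tsz).
have dm : mdeg m = d.
  rewrite mdegE.
  have -> : (\sum_(i < n) m i)%N = sumn t by rewrite sumnE -[t]/(val (Tuple tsz)) big_tuple.
  by rewrite sumn_cat sumn_nseq mul0n addn0.
have lt : (mdeg m < d.+1)%N by rewrite dm.
exists (BMultinom lt).
  rewrite mem_filter mem_enum andbT /= dm eqxx /= /t.
  rewrite (sorted_pairwise geq_trans) pairwise_cat -!(sorted_pairwise geq_trans) srt /=.
  apply/andP; split.
    by apply/allrelP => x y _ /nseqP[-> _].
  by case: (n - size la)%N => //= k; elim: k.
rewrite /= /t filter_cat filter_nseq /= cats0; symmetry; apply/all_filterP/allP => r rla.
by rewrite lt0n; apply: contraNneq n0 => <-.
Qed.

Lemma partns_uniq n d : uniq (partns n d).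
Proof.
have key (k : nat) (s : seq nat) : sorted geq s -> size s = k ->
    s = [seq r <- s | (0 < r)%N] ++ nseq (k - size [seq r <- s | (0 < r)%N]) 0%N.
  elim: s k => [|[|a] s IH] k /= srt <- //=.
    have z : all (pred1 0%N) s.
      apply/allP => x xs; have := order_path_min _ srt.
      have tr : transitive geq by move=> u v w /= h1 h2; exact: leq_trans h2 h1.
      by move=> /(_ tr) /allP /(_ _ xs) /=; rewrite leqn0.
    have -> : [seq r <- s | (0 < r)%N] = [::].
      by apply/eqP; rewrite -size_eq0 size_filter -leqn0 leqNgt -has_count -all_predC;
        apply/allP => x /(allP z) /eqP ->.
    by rewrite /= -(all_pred1P _ _ z).
  by rewrite subSS -IH // (path_sorted srt).
rewrite map_inj_in_uniq ?filter_uniq -?enumT ?enum_uniq // => m1 m2.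
rewrite !mem_filter => /andP[/andP[_ s1] _] /andP[/andP[_ s2] _] eqf.
apply/val_inj/val_inj/val_inj => /=.
by rewrite (key n _ s1) ?size_tuple // [RHS](key n _ s2) ?size_tuple // eqf.
Qed.

Definition part (la : seq nat) (i : nat) : nat := nth 0%N la i.-1.

Definition conj_part (la : seq nat) (j : nat) : nat := count (fun r => j <= r)%N la.

Definition dominated (mu la : seq nat) : bool :=
  (sumn mu == sumn la) &&
  [forall k : 'I_(sumn la).+1, (sumn (take k mu) <= sumn (take k la))%N].

(* Product over the boxes (i, j) of the diagram of la; i and j start at 1. *)
Definition box_prod (F : fieldType) (la : seq nat) (w : nat -> nat -> F) : F :=
  \prod_(1 <= i < (size la).+1) \prod_(1 <= j < (part la i).+1) w i j.

Section Jack.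

Variables (F : fieldType) (al : F).

(* A symmetric function in infinitely many variables, given by its restrictions
   to N variables for all N.  Everything below that is claimed to be a symmetric
   function is a fixed linear combination of [monomial_sym]'s or [power_sum]'s,
   hence is symmetric, stable under N+1 -> N and of bounded degree. *)
Definition symfun : Type := forall N : nat, {mpoly F[N]}.

Definition monomial_sym (mu : seq nat) : symfun := fun N =>
  \sum_(m : 'X_{1..N < (sumn mu).+1} |
          perm_eq [seq r <- val (bmnm m) | (0 < r)%N] mu) 'X_[m].

Definition power_sum (la : seq nat) : symfun := fun N =>
  \prod_(r <- la) \sum_(i < N) 'X_i ^+ r.

Definition zpart (la : seq nat) : nat :=
  (\prod_(r <- undup la) (r ^ count_mem r la * (count_mem r la)`!))%N.

Definition power_sum_expansion (f : symfun) (D : nat) (u : seq nat -> F) : Prop :=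
  forall N, f N = \sum_(d < D) \sum_(nu <- partns d d) u nu *: power_sum nu N.

(* <f, g>_al = s, for the bilinear form with
   <p_la, p_mu>_al = [la = mu] z_la al^(length la); the power sums p_la form a
   basis of the symmetric functions (F has characteristic 0 in all uses). *)
Definition jack_pairing (f g : symfun) (s : F) : Prop :=
  exists (D : nat) (u v : seq nat -> F),
    [/\ power_sum_expansion f D u,
        power_sum_expansion g D v &
        s = \sum_(d < D) \sum_(nu <- partns d d)
              u nu * v nu * (zpart nu)%:R * al ^+ size nu].

Definition dominance_triangular (la : seq nat) (f : symfun) : Prop :=
  exists u : seq nat -> F,
    (forall N, f N = \sum_(mu <- partns (sumn la) (sumn la) | dominated mu la)
                       u mu *: monomial_sym mu N) /\
    u (nseq (sumn la) 1%N) = ((sumn la)`!)%:R.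

(* J is the family of integral form Jack functions with parameter al (its
   values outside partitions are irrelevant); J la N is the Jack polynomial in
   N variables. *)
Definition jack_family (J : seq nat -> symfun) : Prop :=
  (forall la, is_partn la -> dominance_triangular la (J la)) /\
  (forall la mu, is_partn la -> is_partn mu -> la != mu ->
     jack_pairing (J la) (J mu) 0).

Definition jack_j (la : seq nat) : F :=
  box_prod la (fun i j =>
    (((part la i)%:R - j%:R) * al + (conj_part la j)%:R - i%:R + 1) *
    (((part la i)%:R - j%:R + 1) * al + (conj_part la j)%:R - i%:R)).

Definition gen_poch (a : F) (la : seq nat) : F :=
  box_prod la (fun i j => a + (j%:R - 1) - (i%:R - 1) / al).

Definition poch (c : F) (k : nat) : F := \prod_(i < k) (c + i%:R).

End Jack.

Section PowerSeries.

Variables (n : nat) (K : fieldType).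

(* Formal power series in n variables, as the family of their coefficients. *)
Definition mseries : Type := 'X_{1..n} -> K.

Definition homog_comp (d : nat) (G : mseries) : {mpoly K[n]} :=
  \sum_(m : 'X_{1..n < d.+1} | mdeg m == d) G m *: 'X_[m].

(* G = \sum_d u d, for the coefficientwise (discrete) convergence *)
Definition series_sum (u : nat -> {mpoly K[n]}) (G : mseries) : Prop :=
  forall m : 'X_{1..n}, exists D0 : nat, forall D : nat, (D0 <= D)%N ->
    (\sum_(d < D) u d)@_m = G m.

(* T G = H, where the operator T acts term-wise on the homogeneous components
   of G.  T takes its values in rational functions because of denominators such
   as x_i - x_j; these are required to cancel in every term. *)
Definition termwise (T : {mpoly K[n]} -> {fraction {mpoly K[n]}})
    (G H : mseries) : Prop :=
  exists u : nat -> {mpoly K[n]},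
    (forall d, T (homog_comp d G) = tofrac (u d)) /\ series_sum u H.

Definition euler_op (f : {mpoly K[n]}) : {mpoly K[n]} :=
  \sum_(i < n) 'X_i * mderiv i f.

Definition Nhat (c : K) (f : {mpoly K[n]}) : {mpoly K[n]} :=
  (c - 1) *: euler_op f + euler_op (euler_op f).

Definition Rop (al a b : K) (f : {mpoly K[n]}) : {fraction {mpoly K[n]}} :=
  tofrac (\sum_(i < n) ('X_i ^+ 3 * mderiv i (mderiv i f)
                        + (a + b + 1) *: ('X_i ^+ 2 * mderiv i f)
                        + (a * b) *: ('X_i * f)))
  + tofrac (2%:R / al)%:MP *
    \sum_(i < n) \sum_(j < n | j != i)
       tofrac ('X_i * 'X_j) / tofrac ('X_i - 'X_j) * tofrac ('X_i * mderiv i f).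

End PowerSeries.

Section JackSeries.

Variables (n : nat) (F K : fieldType) (iota : {rmorphism F -> K}) (al : F).
Variable (J : seq nat -> symfun F).

(* \sum_(la in P_n) C_la al^|la| J_la(x) / j_la.  Since J_la(x) is homogeneous of
   degree |la|, only the la with |la| = deg m contribute to the coefficient of
   x^m. *)
Definition jack_series (C : seq nat -> K) : mseries n K := fun m =>
  (\sum_(la <- partns n (mdeg m))
     (C la * iota (al ^+ sumn la / jack_j al la)) *: map_mpoly iota (J la n))@_m.

Definition jack_series_space (G : mseries n K) : Prop :=
  exists C : seq nat -> K, G = jack_series C.

Definition hatF21 (a b c : K) : mseries n K :=
  jack_series (fun la =>
    gen_poch (iota al) a la * gen_poch (iota al) b la / poch c (sumn la)).

End JackSeries.

Arguments hatF21 n {F K} iota al J a b c.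

(* Q(alpha) and K = Q(alpha)(a, b, c) *)
Definition Qalpha : fieldType := {fraction {poly rat}}.
Definition alpha : Qalpha := tofrac 'X.
Definition Kabc : fieldType := {fraction {mpoly Qalpha[3]}}.
Definition Kconst : {rmorphism Qalpha -> Kabc} :=
  (@FracField.tofrac {mpoly Qalpha[3]} \o @mpolyC 3 Qalpha : {rmorphism _ -> _}).
Definition a_ : Kabc := tofrac 'X_(inord 0).
Definition b_ : Kabc := tofrac 'X_(inord 1).
Definition c_ : Kabc := tofrac 'X_(inord 2).

(* Main.v *)
Require Import Defs.
From HB Require Import structures.
From mathcomp Require Import all_boot all_order all_algebra.
From mathcomp.multinomials Require Import ssrcomplements mpoly.
From mathcomp Require Import perm.
From mathcomp Require Import zify ring.
From Stdlib Require FunctionalExtensionality.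

(* Let D be the Laplace-Beltrami operator; it is self-adjoint for the Jack scalar
   product and triangular on monomial symmetric functions, so the J_la are
   eigenfunctions.  Write p_1 J_la = sum_mu u(la, mu) J_mu, where mu runs over the
   partitions obtained from la by adding one box, and let s be (eigenvalue of mu)
   - (eigenvalue of la), which is the content (j - 1) - (i - 1)/alpha of the added
   box.  With A = [D, p_1] = sum_i x_i^2 d_i one has
     R(a, b) = ab p_1 + (a + b) A + [D, A],
   hence R(a, b) J_la = sum_mu u(la, mu) (a + s)(b + s) J_mu.
   The operators p_1 and alpha d/dp_1 are adjoint, and the coefficients of
   dJ_mu/dp_1 on the J_la add up to |mu|; with |J_la|^2 = j_la this shows that the
   components F_d of the series satisfy R F_d = (c + d)(d + 1) F_(d+1), which is
   what the differential equation says since N F_d = d (c + d - 1) F_d.  As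
   (c + d)(d + 1) is never 0, the recursion also gives uniqueness.

   The support of u and the value of |J_la|^2 come from column removal: in
   n = length(la) variables J_la is a multiple of x_1 ... x_n J_nu, where nu is la
   without its first column.  The multiple is found by specializing p_r to a
   constant, and comparing the coefficients of the lowering operators on J_la and
   J_nu gives |J_la|^2 / |J_nu|^2 by induction.

   Computations take place in {mpoly F[M]}, whose variables stand for the power
   sums p_1, ..., p_M; Phi N maps it to polynomials in x_1, ..., x_N. *)

Set Implicit Arguments.
Unset Strict Implicit.
Unset Printing Implicit Defensive.

Import GRing.Theory.

Local Open Scope ring_scope.

(** * Partitions and dominance *)

Section Partitions.

Local Open Scope nat_scope.

(** About the J_la only triangularity, orthogonality and normalization are given; that their leading
    coefficients and norms do not vanish has to come from definiteness of the form. Q(alpha) is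
    formally real with alpha positive, and [positive_param] isolates what is used of this: a sum of
    squares with weights k alpha^e, k > 0, vanishes only if all the squares do. A nonzero
    coefficient of J_mu in D J_la forces mu <= la by triangularity and la <= mu by self-adjointness,
    so the eigenfunction property does not rest on separated eigenvalues; incomparable partitions
    can indeed share one. The normalization at m_(1^d) says that p_1^d has coefficient 1 in J_la,
    which is the origin of the sum rules for the coefficients of p_1 and d/dp_1. With M power-sum
    variables the identities are available in degree at most M, so M is chosen at each use according
    to the degree at hand. Identities between Jack polynomials are tested in n variables, where J_la
    vanishes for length(la) > n and the remaining ones are independent. *)

Definition pt (s : seq nat) : seq nat := sort geq [seq r <- s | 0 < r].

(* The sums of the (r - k)^+ do not depend on the order of the entries; their
   comparison for all k is dominance (see dominatedP). *)
Definition excess (k : nat) (s : seq nat) : nat := sumn [seq r - k | r <- s].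

(** The classical statistic n(la) = sum (i - 1) la_i: the alpha-free part of the eigenvalue and,
    being strictly monotone along dominance ([dominated_nstat]), the rank for inductions over it. *)
Definition nstat (s : seq nat) : nat := \sum_(i < size s) i * nth 0 s i.

Lemma geq_trans_nat : transitive geq.
Proof. by move=> a b c /= h1 h2; exact: leq_trans h2 h1. Qed.

Lemma geq_anti_nat : antisymmetric geq.
Proof. by move=> a b /= /andP[h1 h2]; apply/eqP; rewrite eqn_leq h1 h2. Qed.

Lemma geq_total_nat : total geq.
Proof. by move=> a b /=; rewrite leq_total. Qed.

Lemma is_partn_pt s : is_partn (pt s).
Proof.
rewrite /is_partn sort_sorted; last exact: geq_total_nat.
by rewrite mem_sort mem_filter ltnn.
Qed.

Lemma perm_pt s : perm_eq (pt s) [seq r <- s | 0 < r].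
Proof. by rewrite perm_sort. Qed.

Lemma pt_partn la : is_partn la -> pt la = la.
Proof.
case/andP => srt n0; rewrite /pt.
have -> : [seq r <- la | 0 < r] = la.
  by apply/all_filterP/allP => r rla; rewrite lt0n; apply: contraNneq n0 => <-.
apply: (sorted_eq geq_trans_nat geq_anti_nat) => //.
  exact/sort_sorted/geq_total_nat.
by rewrite perm_sort.
Qed.

Lemma eq_pt s t : perm_eq s t -> pt s = pt t.
Proof.
move=> st; apply: (sorted_eq geq_trans_nat geq_anti_nat);
  rewrite ?sort_sorted //; try exact: geq_total_nat.
by rewrite perm_sort perm_sym perm_sort perm_sym perm_filter.
Qed.

Lemma pt_eq s mu : is_partn mu -> perm_eq [seq r <- s | 0 < r] mu = (pt s == mu).
Proof.
move=> pmu; apply/idP/eqP => [h|<-]; last by rewrite perm_sym perm_pt.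
rewrite -(pt_partn pmu) -(eq_pt h) /pt.
by rewrite filter_id.
Qed.

Lemma sumn_perm s t : perm_eq s t -> sumn s = sumn t.
Proof. by move=> st; rewrite !sumnE (perm_big _ st). Qed.

Lemma excess_pt k s : excess k (pt s) = excess k s.
Proof.
rewrite /excess (sumn_perm (perm_map _ (perm_pt s))).
by elim: s => //= -[|a] s IH /=; rewrite ?IH.
Qed.

Lemma excess0 s : excess 0 s = sumn s.
Proof. by rewrite /excess; elim: s => //= a s ->; rewrite subn0. Qed.

Lemma sumn_pt s : sumn (pt s) = sumn s.
Proof. by rewrite -!excess0 excess_pt. Qed.

Lemma size_pt s : size (pt s) <= size s.
Proof. by rewrite size_sort size_filter count_size. Qed.

(** Partial sums and excesses are conjugate to each other. Each entry satisfies r <= (r - k)^+ + k,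
    and for a partition equality is attained at k = the l-th part ([sumn_take_nth]), or at l = the
    number of parts larger than k ([excess_take]). Each direction of [dominatedP] goes through one
    of these equality cases. *)
Lemma sumn_take_le k l s : sumn (take l s) <= excess k s + k * l.
Proof.
elim: s l => [|a s IH] [|l] //=.
have := IH l; rewrite /excess /= mulnS; lia.
Qed.

Lemma sumn_take_nth l la : is_partn la ->
  sumn (take l la) = excess (nth 0 la l.-1) la + nth 0 la l.-1 * l \/ size la < l.
Proof.
case/andP => srt _; case: (leqP l (size la)) => hl; [left|by right].
case: l hl => [|l] hl.
  rewrite take0 muln0 addn0 /=; case: la srt {hl} => //= a s.
  move=> p; have /allP h := order_path_min geq_trans_nat p.
  rewrite /excess /= subnn add0n.
  suff : all (fun r => r - a == 0) s.
    by elim: s {p h} => //= b s IH /andP[/eqP -> /IH].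
  by apply/allP => r /h /=; rewrite -subn_eq0.
elim: la l srt hl => //= a s IH [|l] p hl; rewrite /= ?take0 /=.
  have /allP h := order_path_min geq_trans_nat p.
  rewrite /excess /= subnn muln1 add0n addn0.
  suff -> : sumn [seq r - a | r <- s] = 0 by [].
  have : all (fun r => r - a == 0) s by apply/allP => r /h /=; rewrite -subn_eq0.
  by elim: s {p h IH hl} => //= b s IH /andP[/eqP -> /IH].
rewrite (IH l) ?(path_sorted p) //=.
have /allP h := order_path_min geq_trans_nat p.
have /h /= : nth 0 s l \in s by rewrite mem_nth.
rewrite /excess /= mulnS; lia.
Qed.

Lemma sumn_take_all (s : seq nat) l : sumn (take l s) <= sumn s.
Proof. by rewrite -{2}(cat_take_drop l s) sumn_cat leq_addr. Qed.

Lemma excess_take k la : is_partn la ->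
  exists2 l, l <= size la & excess k la + k * l = sumn (take l la).
Proof.
case/andP => srt _; elim: la srt => [|a s IH] srt; first by exists 0; rewrite ?muln0.
have [l hl e] := IH (path_sorted srt).
case: (leqP a k) => ak.
  exists 0 => //; rewrite take0 muln0 addn0.
  have /allP h := order_path_min geq_trans_nat srt.
  rewrite /excess /=.
  have -> : a - k = 0 by lia.
  have : all (fun r => r - k == 0) s by apply/allP => r /h /=; lia.
  by elim: s {srt h IH e hl} => //= b s IH /andP[/eqP -> /IH].
exists l.+1 => //=; rewrite -e /excess /= mulnS; lia.
Qed.

Lemma size_partn la : is_partn la -> size la <= sumn la.
Proof.
case/andP => _; elim: la => //= a s IH; rewrite in_cons negb_or => /andP[a0 /IH]; lia.
Qed.

Lemma dominatedP mu la : is_partn mu -> is_partn la ->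
  reflect (sumn mu = sumn la /\ forall k, excess k mu <= excess k la) (dominated mu la).
Proof.
move=> pmu pla; apply: (iffP andP) => [[/eqP sz /forallP h]|[sz h]]; split=> //; last 2 first.
- exact/eqP.
- apply/forallP => -[l hl] /=; case: (sumn_take_nth l pla) => [->|hs]; last first.
    by rewrite (take_oversize (ltnW hs)) -sz sumn_take_all.
  by rewrite (leq_trans (sumn_take_le (nth 0 la l.-1) _ _)) // leq_add2r h.
move=> k; have [l hl e] := excess_take k pmu.
have hl' : l < (sumn la).+1 by rewrite ltnS -sz (leq_trans hl) ?size_partn.
have := h (Ordinal hl'); rewrite /= -e => /leq_trans/(_ (sumn_take_le k _ _)).
by rewrite leq_add2r.
Qed.

Lemma dominated_refl la : dominated la la.
Proof. by rewrite /dominated eqxx; apply/forallP => k /=. Qed.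

Lemma dominated_trans la mu nu : dominated mu la -> dominated nu mu -> dominated nu la.
Proof.
case/andP => /eqP s1 /forallP h1 /andP[/eqP s2 /forallP h2]; apply/andP; split.
  by rewrite s2 s1.
apply/forallP => k; rewrite -s1 in h1 k *; exact: leq_trans (h2 k) (h1 k).
Qed.

Lemma dominated_sumn mu la : dominated mu la -> sumn mu = sumn la.
Proof. by case/andP => /eqP. Qed.

Lemma nstat_cons a s : nstat (a :: s) = nstat s + sumn s.
Proof.
rewrite /nstat /= big_ord_recl mul0n add0n /=.
under eq_bigr => i _ do rewrite /bump /= add1n mulSn.
rewrite big_split /= addnC sumnE (big_nth 0) big_mkord.
by congr addn; apply: eq_bigr => i _; rewrite add0n.
Qed.

Lemma nstat_drop L s : size s <= L -> nstat s = \sum_(l < L) sumn (drop l.+1 s).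
Proof.
elim: s L => [|a s IH] L hs; first by rewrite /nstat big_ord0 big1.
case: L hs => // L hs; rewrite nstat_cons (IH L) // [RHS]big_ord_recl /= drop0 addnC.
by congr addn.
Qed.

(** n(la) is the sum of the tails of la ([nstat_drop]), and each tail is |la| minus a partial sum,
    so dominance compares the tails one by one. Equality of the totals forces equality of all
    partial sums, hence of all parts. *)
Lemma dominated_nstat mu la : is_partn mu -> is_partn la -> dominated mu la ->
  nstat la <= nstat mu ?= iff (mu == la).
Proof.
move=> pmu pla dm; have sz := dominated_sumn dm.
rewrite (@nstat_drop (sumn la) la) ?size_partn // (@nstat_drop (sumn la) mu); last first.
  by rewrite -sz size_partn.
have E l s : sumn (drop l s) = sumn s - sumn (take l s).
  by rewrite -{2}(cat_take_drop l s) sumn_cat addKn.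
have H (l : nat) : l <= sumn la -> sumn (take l mu) <= sumn (take l la).
  by case/andP: dm => _ /forallP h hl; have := h (Ordinal (hl : l < (sumn la).+1)).
have le (l : 'I_(sumn la)) : sumn (drop l.+1 la) <= sumn (drop l.+1 mu)
    ?= iff (sumn (drop l.+1 la) == sumn (drop l.+1 mu)).
  by split=> //; rewrite !E sz leq_sub2l // H.
have [le1 le2] := @leqif_sum _ predT _ _ _ (fun i _ => le i).
split=> //; rewrite le2; apply/forallP/eqP => [h|-> l]; last by rewrite eqxx.
have T l : sumn (take l mu) = sumn (take l la).
  case: l => [|l]; first by rewrite !take0.
  case: (ltnP l (sumn la)) => hl.
    have /eqP := h (Ordinal hl); rewrite !E /= sz.
    have := sumn_take_all mu l.+1; have := sumn_take_all la l.+1; lia.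
  rewrite !take_oversize //; first by rewrite (leq_trans (size_partn pla)) ?leqW.
  by rewrite (leq_trans (size_partn pmu)) // sz leqW.
have N i : nth 0 mu i = nth 0 la i.
  have S s : sumn (take i.+1 s) = sumn (take i s) + nth 0 s i.
    elim: s (i) => [|a s IH] [|j] //=; rewrite ?take0 ?addn0 //= ?IH; lia.
  by have := T i.+1; rewrite !S T => /addnI.
have S0 (s t : seq nat) : (forall i, nth 0 s i = nth 0 t i) -> 0 \notin s -> size s <= size t.
  move=> e n0; rewrite leqNgt; apply/negP => lt; case/negP: n0.
  by rewrite -(nth_default 0 (leqnn (size t))) -e mem_nth.
case/andP: pmu pla => _ n1 /andP[_ n2]; apply: (@eq_from_nth _ 0) => [|i _]; last exact: N.
by apply/eqP; rewrite eqn_leq !S0.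
Qed.

Lemma dominated_anti mu la : is_partn mu -> is_partn la ->
  dominated mu la -> dominated la mu -> mu = la.
Proof.
move=> pm pl h1 h2; apply/eqP.
have [a b] := dominated_nstat pm pl h1; have [c d] := dominated_nstat pl pm h2.
by rewrite -b eqn_leq a c.
Qed.

(** At l = [size mu] the partial sum of mu is already |mu|, so nothing may remain of la beyond that
    point. *)
Lemma dominated_size mu la : is_partn mu -> is_partn la -> dominated mu la -> size la <= size mu.
Proof.
move=> pm pl dm; rewrite leqNgt; apply/negP => lt.
have sz := dominated_sumn dm.
have hl : size mu < (sumn la).+1 by rewrite ltnS (leq_trans (ltnW lt)) ?size_partn.
case/andP: dm => _ /forallP /(_ (Ordinal hl)) /=; rewrite take_size sz.
rewrite -{1}(cat_take_drop (size mu) la) sumn_cat -[X in _ <= X]addn0 leq_add2l leqn0.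
have : 0 < size (drop (size mu) la) by rewrite size_drop subn_gt0.
have : 0 \notin drop (size mu) la.
  by case/andP: pl => _; apply: contra => /mem_drop.
case: (drop _ _) => //= a s; rewrite in_cons negb_or => /andP[]; lia.
Qed.

Lemma is_partn_nseq1 d : is_partn (nseq d 1).
Proof. by rewrite /is_partn; apply/andP; split; [elim: d => [|[|d]] //=| elim: d]. Qed.

Lemma sumn_nseq1 d : sumn (nseq d 1) = d.
Proof. by rewrite sumn_nseq mul1n. Qed.

Lemma dominated_ones la : is_partn la -> dominated (nseq (sumn la) 1) la.
Proof.
move=> pl; apply/dominatedP; rewrite ?is_partn_nseq1 // sumn_nseq1; split=> // k.
rewrite /excess map_nseq sumn_nseq; case: k => [|k].
  by rewrite subn0 mul1n -/(excess 0 la) excess0.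
by rewrite subSS sub0n.
Qed.

Lemma dominated_ones_eq mu d : is_partn mu -> dominated mu (nseq d 1) -> mu = nseq d 1.
Proof.
move=> pm dm; apply: (dominated_anti pm (is_partn_nseq1 d) dm).
by move: (dominated_ones pm); rewrite (dominated_sumn dm) sumn_nseq1.
Qed.

Definition mnm_of n (la : seq nat) : 'X_{1..n} := [multinom nth 0 la i | i < n].

Lemma sumn_mnm n (m : 'X_{1..n}) : sumn m = mdeg m.
Proof. by rewrite mdegE sumnE big_tuple; apply: eq_bigr => i _; rewrite mnm_tnth. Qed.

Lemma mnm_of_val n la : size la <= n -> val (mnm_of n la) = la ++ nseq (n - size la) 0 :> seq nat.
Proof.
move=> h; apply: (@eq_from_nth _ 0); first by rewrite size_tuple size_cat size_nseq subnKC.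
move=> i; rewrite size_tuple => hi.
rewrite -[X in nth _ _ X]/(val (Ordinal hi)) -mnm_nth mnmE /= nth_cat nth_nseq if_same.
by case: ltnP => // hh; rewrite nth_default.
Qed.

Lemma pt_mnm_of n la : is_partn la -> size la <= n -> pt (mnm_of n la) = la.
Proof.
move=> pl h; rewrite -[RHS](pt_partn pl) /pt mnm_of_val // filter_cat.
by rewrite filter_nseq cats0.
Qed.

Lemma mdeg_mnm_of n la : size la <= n -> mdeg (mnm_of n la) = sumn la.
Proof. by move=> h; rewrite -sumn_mnm mnm_of_val // sumn_cat sumn_nseq mul0n addn0. Qed.

Lemma excessE k n (m : 'X_{1..n}) : excess k m = \sum_(i < n) (m i - k).
Proof.
rewrite /excess sumnE big_map big_tuple; by apply: eq_bigr => i _; rewrite mnm_tnth.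
Qed.

Lemma mem_partnsP n d la :
  reflect [/\ is_partn la, size la <= n & sumn la = d] (la \in partns n d).
Proof. by rewrite mem_partns; apply: (iffP and3P) => -[a b /eqP c]; split=> //; apply/eqP. Qed.

End Partitions.

(** Derivations and substitutions are compared on 1, under multiplication by a generator, where the
    Leibniz rule applies, and under linear combinations. *)
Lemma mpoly_gen_ind (R : comNzRingType) (k : nat) (P : {mpoly R[k]} -> Prop) :
  P 1 -> (forall i g, P g -> P ('X_i * g)) ->
  (forall c f g, P f -> P g -> P (c *: f + g)) -> forall g, P g.
Proof.
move=> P1 PX PD.
have PM m : P 'X_[m].
  move: {2}(mdeg m) (leqnn (mdeg m)) => e; elim: e m => [|e IH] m.
    by rewrite leqn0 mdeg_eq0 => /eqP ->; rewrite mpolyX0.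
  move=> me; case: (altP (m =P 0%MM)) => [->|m0]; first by rewrite mpolyX0.
  have [i mi] : exists i, m i != 0%N.
    apply/existsP; rewrite -negb_forall; apply: contra m0 => /forallP h.
    by apply/eqP/mnmP => i; rewrite mnm0E; apply/eqP.
  have e1 : m = (U_(i) + (m - U_(i)))%MM by rewrite addmC submK // lep1mP.
  rewrite e1 mpolyXD; apply/PX/IH; move: me.
  by rewrite {1}e1 mdegD mdeg1 add1n ltnS.
have P0 : P 0 by have := PD (-1) 1 1 P1 P1; rewrite scaleN1r addNr.
elim/mpolyind => // c m p _ _ Pp; exact: PD.
Qed.

(** Regroups the pairs (i, j) by k = i + j + 1: with power sums numbered from 0, derivatives of
    index i and j in the second-order part of the Laplacian come with the power sum of index i + j +
    1. *)
Lemma triangle_sum (V : nmodType) (M : nat) (G : nat -> nat -> V) :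
  (forall i j, (M <= (i + j).+1)%N -> G i j = 0) ->
  \sum_(i < M) \sum_(j < M) G i j = \sum_(k < M) \sum_(t < k) G t (k.-1 - t)%N.
Proof.
elim: M G => [|M IH] G H; first by rewrite !big_ord0.
rewrite big_ord_recl [RHS]big_ord_recl big_ord0 add0r /=.
transitivity (\sum_(j < M) (G 0 j + \sum_(t < j) G t.+1 (j.-1 - t)%N)); last first.
  apply: eq_bigr => j _; rewrite /bump add1n big_ord_recl /= subn0; congr (_ + _).
  apply: eq_bigr => t _; rewrite /bump /= add1n; congr G; have := ltn_ord t; lia.
rewrite big_split /= -(IH (fun i j => G i.+1 j)) => [|i j ij]; last by apply: H; lia.
congr (_ + _); first by rewrite big_ord_recr /= H ?addr0 // add0n.
apply: eq_bigr => i _; rewrite big_ord_recr /= H ?addr0 //=; rewrite /bump; lia.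
Qed.

(** * Polynomials in the power sums *)

Section PowerSumModel.

Variables (F : fieldType) (al : F) (M : nat).

(* Pv k is the power sum p_(k+1) and Dv k the derivation d/dp_(k+1), both 0 for k >= M. *)
Definition Pv (k : nat) : {mpoly F[M]} := if insub k is Some i then 'X_i else 0.

Definition Dv (k : nat) (g : {mpoly F[M]}) : {mpoly F[M]} :=
  if insub k is Some i then g^`M(i) else 0.

Lemma Pv_ord (i : 'I_M) : Pv i = 'X_i.
Proof. by rewrite /Pv valK. Qed.

Lemma Dv_ord (i : 'I_M) g : Dv i g = g^`M(i).
Proof. by rewrite /Dv valK. Qed.

Lemma Pv_ge k : (M <= k)%N -> Pv k = 0.
Proof. by move=> h; rewrite /Pv insubN // -leqNgt. Qed.

Lemma Dv_ge k g : (M <= k)%N -> Dv k g = 0.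
Proof. by move=> h; rewrite /Dv insubN // -leqNgt. Qed.

Fact Dv_is_linear k : linear (Dv k).
Proof. by move=> c f g; rewrite /Dv; case: insub => [i|]; rewrite ?linearP // scaler0 addr0. Qed.

HB.instance Definition _ k :=
  GRing.isLinear.Build F {mpoly F[M]} {mpoly F[M]} _ (Dv k) (Dv_is_linear k).

Lemma DvM k f g : Dv k (f * g) = Dv k f * g + f * Dv k g.
Proof.
rewrite /Dv; case: insub => [i|]; first exact: mderivM.
by rewrite mul0r mulr0 addr0.
Qed.

Lemma DvC j k g : Dv j (Dv k g) = Dv k (Dv j g).
Proof.
case: (ltnP j M) => [hj|hj]; last by rewrite !(Dv_ge _ hj) linear0.
case: (ltnP k M) => [hk|hk]; last by rewrite !(Dv_ge _ hk) linear0.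
by rewrite -[j]/(val (Ordinal hj)) -[k]/(val (Ordinal hk)) !Dv_ord mderiv_comm.
Qed.

Lemma DvP j k : Dv j (Pv k) = ((j == k) && (k < M)%N)%:R.
Proof.
case: (ltnP j M) => [hj|hj]; last first.
  by rewrite Dv_ge //; case: eqP => // <-; rewrite ltnNge hj.
case: (ltnP k M) => [hk|hk]; last by rewrite Pv_ge // linear0 andbF.
rewrite -[j]/(val (Ordinal hj)) -[k]/(val (Ordinal hk)) Dv_ord Pv_ord mderivX.
rewrite mnm1E andbT eq_sym val_eqE; case: eqP => [->|_]; last by rewrite scale0r.
have -> : (U_(Ordinal hk) - U_(Ordinal hk) = 0)%MM by apply/mnmP => i; rewrite mnmBE subnn mnm0E.
by rewrite scale1r mpolyX0.
Qed.

Lemma DvPM j k g : Dv j (Pv k * g) = ((j == k) && (k < M)%N)%:R * g + Pv k * Dv j g.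
Proof. by rewrite DvM DvP. Qed.

(* z_la al^(length la), for the partition la with m i parts equal to i.+1 *)
Definition zw (m : 'X_{1..M}) : F :=
  \prod_(i < M) (((i.+1)%:R * al) ^+ m i * (m i)`!%:R).

(** The Jack scalar product, carried over to polynomials in p_1, ..., p_M. *)
Definition bp (f g : {mpoly F[M]}) : F := \sum_(m <- msupp f) f@_m * g@_m * zw m.

Lemma bpwE k f g : (msize f <= k)%N ->
  bp f g = \sum_(m : 'X_{1..M < k}) f@_m * g@_m * zw m.
Proof.
move=> lt; pose P (m : 'X_{1..M < k}) := (val m) \in msupp f.
rewrite (bigID P) {}/P /= addrC big1 ?add0r; last first.
  by move=> m' /memN_msupp_eq0=> ->; rewrite !mul0r.
rewrite /bp (big_mksub 'X_{1..M < k}) //=; first exact/msupp_uniq.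
by move=> m' /msize_mdeg_lt /leq_trans; apply.
Qed.

Lemma bpC f g : bp f g = bp g f.
Proof.
rewrite (@bpwE (maxn (msize f) (msize g))) ?leq_maxl //.
rewrite (@bpwE (maxn (msize f) (msize g)) g) ?leq_maxr //.
by apply: eq_bigr => m _; rewrite (mulrC f@_m).
Qed.

Fact bp_is_linear f : scalar (bp f).
Proof.
move=> c g h; rewrite /bp mulr_sumr -big_split /=; apply: eq_bigr => m _.
by rewrite mcoeffD mcoeffZ; ring.
Qed.

HB.instance Definition _ f :=
  GRing.isLinear.Build F {mpoly F[M]} F _ (bp f) (bp_is_linear f).

Lemma bpDl f g h : bp (f + g) h = bp f h + bp g h.
Proof. by rewrite !(bpC _ h) linearD. Qed.

Lemma bpBl f g h : bp (f - g) h = bp f h - bp g h.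
Proof. by rewrite !(bpC _ h) linearB. Qed.

Lemma bpZl c f h : bp (c *: f) h = c * bp f h.
Proof. by rewrite !(bpC _ h) linearZ. Qed.

Lemma bpZr c f h : bp h (c *: f) = c * bp h f.
Proof. by rewrite linearZ. Qed.

Lemma bp_suml (I : Type) (r : seq I) (P : pred I) (f : I -> {mpoly F[M]}) h :
  bp (\sum_(i <- r | P i) f i) h = \sum_(i <- r | P i) bp (f i) h.
Proof. by rewrite bpC linear_sum; apply: eq_bigr => i _; rewrite bpC. Qed.

Lemma bp_sumr (I : Type) (r : seq I) (P : pred I) (f : I -> {mpoly F[M]}) h :
  bp h (\sum_(i <- r | P i) f i) = \sum_(i <- r | P i) bp h (f i).
Proof. exact: linear_sum. Qed.

Lemma bpX m g : bp 'X_[m] g = g@_m * zw m.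
Proof. by rewrite /bp msuppX big_seq1 mcoeffX eqxx mul1r. Qed.

Lemma zwD m i : zw (m + U_(i)) = (i.+1)%:R * al * (m i).+1%:R * zw m.
Proof.
rewrite /zw (bigD1 i) //= [in RHS](bigD1 i) //= mnmDE mnm1E eqxx addn1.
have -> : \prod_(j < M | j != i)
    (((j.+1)%:R * al) ^+ (m + U_(i))%MM j * ((m + U_(i))%MM j)`!%:R) =
  \prod_(j < M | j != i) (((j.+1)%:R * al) ^+ m j * (m j)`!%:R) :> F.
  by apply: eq_bigr => j ji; rewrite mnmDE mnm1E eq_sym (negbTE ji) addn0.
rewrite factS natrM exprS !mulrA; congr (_ * _ * _).
by rewrite -!mulrA; congr (_ * (_ * _)); rewrite mulrC.
Qed.

(** One more factor p_(k+1) multiplies the weight of a monomial by alpha (k+1) times the new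
    multiplicity ([zwD]), and this multiplicity is what d/dp_(k+1) produces. *)
Lemma bp_adj k f g : bp (Pv k * f) g = al * k.+1%:R * bp f (Dv k g).
Proof.
case: (ltnP k M) => [hk|hk]; last by rewrite Pv_ge // Dv_ge // mul0r linear0 bpC linear0 mulr0.
rewrite -[k]/(val (Ordinal hk)) Pv_ord Dv_ord /=; set i := Ordinal hk.
rewrite [f]mpolyE mulr_sumr !bp_suml mulr_sumr; apply: eq_bigr => m _.
rewrite -scalerAr !bpZl -mpolyXD !bpX addmC zwD mcoeff_mderiv -[in RHS]mulr_natr /=.
ring.
Qed.

(* Twice the Laplace-Beltrami operator in the power sums, up to a multiple of the
   degree (see lap_Phi). *)
Definition D2 (g : {mpoly F[M]}) : {mpoly F[M]} :=
  al *: (\sum_(k < M) \sum_(t < k)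
          ((t.+1)%:R * (k - t)%:R) *: (Pv k * Dv t (Dv (k.-1 - t) g))) +
  (\sum_(k < M) \sum_(t < k) (k.+1)%:R *: (Pv t * Pv (k.-1 - t) * Dv k g)) +
  (al - 1) *: (\sum_(k < M) ((k.+1)%:R * k%:R) *: (Pv k * Dv k g)).

Fact D2_is_linear : linear D2.
Proof.
move=> c f g; rewrite /D2.
have E (h : {mpoly F[M]}) (L : {linear {mpoly F[M]} -> {mpoly F[M]}}) (a : F) :
  a *: (h * L (c *: f + g)) = c *: (a *: (h * L f)) + a *: (h * L g).
  by rewrite linearP mulrDr scalerDr -scalerAr !scalerA [a * c]mulrC.
have -> : \sum_(k < M) \sum_(t < k)
    ((t.+1)%:R * (k - t)%:R) *: (Pv k * Dv t (Dv (k.-1 - t) (c *: f + g))) =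
  c *: (\sum_(k < M) \sum_(t < k)
    ((t.+1)%:R * (k - t)%:R) *: (Pv k * Dv t (Dv (k.-1 - t) f))) +
  \sum_(k < M) \sum_(t < k)
    ((t.+1)%:R * (k - t)%:R) *: (Pv k * Dv t (Dv (k.-1 - t) g)).
  rewrite scaler_sumr -big_split; apply: eq_bigr => k _.
  rewrite scaler_sumr -big_split; apply: eq_bigr => t _.
  exact: (E _ (Dv t \o Dv (k.-1 - t))).
have -> : \sum_(k < M) \sum_(t < k) (k.+1)%:R *: (Pv t * Pv (k.-1 - t) * Dv k (c *: f + g)) =
  c *: (\sum_(k < M) \sum_(t < k) (k.+1)%:R *: (Pv t * Pv (k.-1 - t) * Dv k f)) +
  \sum_(k < M) \sum_(t < k) (k.+1)%:R *: (Pv t * Pv (k.-1 - t) * Dv k g).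
  rewrite scaler_sumr -big_split; apply: eq_bigr => k _.
  rewrite scaler_sumr -big_split; apply: eq_bigr => t _.
  exact: E.
have -> : \sum_(k < M) ((k.+1)%:R * k%:R) *: (Pv k * Dv k (c *: f + g)) =
  c *: (\sum_(k < M) ((k.+1)%:R * k%:R) *: (Pv k * Dv k f)) +
  \sum_(k < M) ((k.+1)%:R * k%:R) *: (Pv k * Dv k g).
  rewrite scaler_sumr -big_split; apply: eq_bigr => k _; exact: E.
rewrite !scalerDr !scalerA (mulrC al) (mulrC (al - 1)) -!scalerA.
by rewrite (addrACA (c *: _)) (addrACA (c *: _ + _)).
Qed.

HB.instance Definition _ :=
  GRing.isLinear.Build F {mpoly F[M]} {mpoly F[M]} _ D2 D2_is_linear.

(** The adjunction exchanges the part of [D2] with one power sum and two derivatives with the part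
    with two power sums and one derivative; the factor alpha on the former balances the numbers of
    derivatives. The diagonal part is self-adjoint by itself. *)
Lemma D2_self_adjoint f g : bp (D2 f) g = bp f (D2 g).
Proof.
have E (f1 f2 : {mpoly F[M]}) :
    bp (al *: (\sum_(k < M) \sum_(t < k)
          ((t.+1)%:R * (k - t)%:R) *: (Pv k * Dv t (Dv (k.-1 - t) f1)))) f2 =
    bp f1 (\sum_(k < M) \sum_(t < k) (k.+1)%:R *: (Pv t * Pv (k.-1 - t) * Dv k f2)).
  rewrite bpZl bp_suml bp_sumr mulr_sumr; apply: eq_bigr => k _.
  rewrite bp_suml bp_sumr mulr_sumr; apply: eq_bigr => t _.
  rewrite bpZl bpZr bp_adj (bpC f1) -[X in bp X f1]mulrA !bp_adj.
  have -> : ((k.-1 - t).+1 = k - t)%N by have := ltn_ord t; lia.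
  rewrite (bpC (Dv k f2)) DvC; ring.
rewrite /D2 !bpDl !linearD /=; congr (_ + _).
  by rewrite E addrC; congr (_ + _); rewrite bpC -E bpC.
rewrite bpZl bpZr; congr (_ * _); rewrite bp_suml bp_sumr; apply: eq_bigr => k _.
by rewrite bpZl bpZr bp_adj (bpC f) bp_adj bpC.
Qed.

(** The derivation p_k -> k p_(k+1), that is sum_i x_i^2 d_i in the variables x ([Phi_raise2]). The
    summand at index 0 has coefficient 0, so the default [0.-1 = 0] is harmless. *)
Definition raise2 (g : {mpoly F[M]}) : {mpoly F[M]} :=
  \sum_(k < M) k%:R *: (Pv k * Dv k.-1 g).

(** Only the second-order part of [D2] fails to commute with p_1: d/dp_1 occurs there as t = 0 and
    as t = k - 1, whence the factor 2. In the two first-order parts d/dp_1 comes with an empty sum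
    or with the factor 0. *)
Lemma D2_comm_p1 g : D2 (Pv 0 * g) = Pv 0 * D2 g + (al *+ 2) *: raise2 g.
Proof.
case: (ltnP 0 M) => hM; last first.
  rewrite Pv_ge // !mul0r linear0 add0r /raise2 big1 ?scaler0 // => k _.
  by have := ltn_ord k; lia.
rewrite /D2 !mulrDr -!scalerAr !mulr_sumr.
have E1 : \sum_(k < M) \sum_(t < k) ((t.+1)%:R * (k - t)%:R) *:
      (Pv k * Dv t (Dv (k.-1 - t) (Pv 0 * g))) =
    \sum_(k < M) Pv 0 * (\sum_(t < k) ((t.+1)%:R * (k - t)%:R) *:
      (Pv k * Dv t (Dv (k.-1 - t) g))) + raise2 g *+ 2.
  rewrite /raise2 -sumrMnl -big_split /=; apply: eq_bigr => k _.
  case: (val k) => [|k']; first by rewrite !big_ord0 scale0r mul0rn mulr0 addr0.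
  rewrite /= mulr_sumr.
  transitivity (\sum_(t < k'.+1) (Pv 0 * (((t.+1)%:R * (k'.+1 - t)%:R) *: (Pv k'.+1 * Dv t (Dv (k' - t) g)))
     + ((t == 0 :> nat)%:R * k'.+1%:R) *: (Pv k'.+1 * Dv k' g)
     + ((t == k' :> nat)%:R * k'.+1%:R) *: (Pv k'.+1 * Dv k' g))).
    apply: eq_bigr => -[t ht] _ /=.
    rewrite DvPM hM andbT raddfD /= DvPM hM andbT.
    have -> : Dv t ((k' - t == 0)%N%:R * g) = (k' - t == 0)%N%:R * Dv t g.
      by case: (_ == 0)%N; [rewrite !mul1r | rewrite !mul0r raddf0].
    have -> : (k' - t == 0)%N = (t == k') by apply/eqP/eqP; lia.
    rewrite !mulrDr !scalerDr [LHS]addrC [X in X + _ = _]addrC; congr (_ + _ + _).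
    - by rewrite [Pv k'.+1 * (Pv 0 * _)]mulrCA scalerAr.
    - case: eqP => [->|_]; last by rewrite !mul0r mulr0 scaler0 scale0r.
      by rewrite !mul1r !subn0.
    - case: eqP => [->|_]; last by rewrite !mul0r mulr0 scaler0 scale0r.
      by rewrite !mul1r (_ : k'.+1 - k' = 1)%N ?mulr1 //; lia.
  rewrite !big_split /= -addrA; congr (_ + _).
  rewrite mulr2n; congr (_ + _).
    by rewrite (bigD1 ord0) //= mul1r big1 ?addr0 // => t /negbTE h;
       rewrite -val_eqE /= in h; rewrite h mul0r scale0r.
  by rewrite (bigD1 ord_max) //= eqxx mul1r big1 ?addr0 // => t /negbTE h;
       rewrite -val_eqE /= in h; rewrite h mul0r scale0r.
rewrite E1 scalerDr -scalerMnr -scalerMnl.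
have E2 : \sum_(k < M) \sum_(t < k) (k.+1)%:R *: (Pv t * Pv (k.-1 - t) * Dv k (Pv 0 * g)) =
    \sum_(k < M) Pv 0 * (\sum_(t < k) (k.+1)%:R *: (Pv t * Pv (k.-1 - t) * Dv k g)).
  apply: eq_bigr => k _; rewrite mulr_sumr; apply: eq_bigr => t _.
  rewrite DvPM; have -> : (k == 0 :> nat) = false by have := ltn_ord t; lia.
  by rewrite /= mul0r add0r mulrCA scalerAr.
have E3 : \sum_(k < M) ((k.+1)%:R * k%:R) *: (Pv k * Dv k (Pv 0 * g)) =
    \sum_(k < M) Pv 0 * (((k.+1)%:R * k%:R) *: (Pv k * Dv k g)).
  apply: eq_bigr => k _; rewrite DvPM; case: eqP => [->|_].
    by rewrite mulr0 !scale0r mulr0.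
  by rewrite /= mul0r add0r mulrCA scalerAr.
by rewrite E2 E3 [X in X + _ = _]addrAC [LHS]addrAC.
Qed.

(** The adjoint of [raise2]. The guard drops d/dp_1, whose coefficient in sum_i d_i is p_0 = N; this
    term reappears in [Phi_lower2], where the number of variables is fixed. *)
Definition lower2 (g : {mpoly F[M]}) : {mpoly F[M]} :=
  \sum_(k < M) ((0 < k)%N * k.+1)%:R *: (Pv k.-1 * Dv k g).

Lemma raise2_adjoint f g : bp (raise2 f) g = bp f (lower2 g).
Proof.
rewrite bp_suml bp_sumr; apply: eq_bigr => k _.
rewrite bpZl bpZr bp_adj (bpC f) bp_adj (bpC (Dv k g)).
by case: (val k) => [|k'] /=; rewrite ?mul0n ?mul0r ?mul1n //; ring.
Qed.

Hypothesis al_neq0 : al != 0.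
Hypothesis nat_neq0 : forall k, k.+1%:R != 0 :> F.

Lemma zw_neq0 m : zw m != 0.
Proof.
apply/prodf_neq0 => i _; rewrite mulf_neq0 ?expf_neq0 ?mulf_neq0 //.
by have := fact_gt0 (m i); case: (_`!).
Qed.

Lemma bp_eq0 f : (forall g, bp f g = 0) -> f = 0.
Proof.
move=> h; apply/mpolyP => m; rewrite mcoeff0; have /eqP := h 'X_[m].
by rewrite bpC bpX mulf_eq0 (negbTE (zw_neq0 m)) orbF => /eqP.
Qed.

(** The adjoint of [D2_comm_p1], obtained by pairing with an arbitrary h; the factor alpha in the
    adjoint of p_1 cancels. *)
Lemma p1_comm_D2 g : Dv 0 (D2 g) = D2 (Dv 0 g) + 2%:R *: lower2 g.
Proof.
apply/eqP; rewrite -subr_eq0; apply/eqP/bp_eq0 => h; apply: (mulfI al_neq0).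
rewrite bpBl bpDl D2_self_adjoint bpZl mulr0 !(bpC _ h).
rewrite -raise2_adjoint mulrBr mulrDr.
have E u v : al * bp u (Dv 0 v) = bp (Pv 0 * u) v by rewrite bp_adj mulr1.
rewrite E -D2_self_adjoint (bpC _ (D2 h)) E D2_comm_p1 bpDl bpZl -mulr_natr; ring.
Qed.

End PowerSumModel.

(** * Substituting the power sums of x_1, ..., x_N *)

Section Substitution.

Variables (F : fieldType) (M : nat).

Local Notation Pv := (@Pv F M).
Local Notation Dv := (@Dv F M).

Definition psum N r : {mpoly F[N]} := \sum_(i < N) 'X_i ^+ r.

Definition Phi N (g : {mpoly F[M]}) : {mpoly F[N]} :=
  g \mPo [tuple psum N i.+1 | i < M].

HB.instance Definition _ N := GRing.RMorphism.copy (Phi N)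
  (comp_mpoly [tuple psum N i.+1 | i < M]).
HB.instance Definition _ N := GRing.Linear.copy (Phi N)
  (comp_mpoly [tuple psum N i.+1 | i < M]).

Lemma PhiM N f g : Phi N (f * g) = Phi N f * Phi N g.
Proof. exact: rmorphM. Qed.

Lemma PhiD N f g : Phi N (f + g) = Phi N f + Phi N g.
Proof. exact: rmorphD. Qed.

Lemma PhiB N f g : Phi N (f - g) = Phi N f - Phi N g.
Proof. exact: rmorphB. Qed.

Lemma Phi0 N : Phi N 0 = 0.
Proof. exact: rmorph0. Qed.

Lemma PhiZ N c f : Phi N (c *: f) = c *: Phi N f.
Proof. exact: linearZ. Qed.

Lemma Phi_sum N (I : Type) (r : seq I) (P : pred I) (f : I -> {mpoly F[M]}) :
  Phi N (\sum_(i <- r | P i) f i) = \sum_(i <- r | P i) Phi N (f i).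
Proof. exact: raddf_sum. Qed.

Lemma Phi1 N : Phi N 1 = 1.
Proof. exact: rmorph1. Qed.

Lemma Phi_nat N k : Phi N k%:R = k%:R.
Proof. exact: rmorph_nat. Qed.

Lemma Phi_Pv N k : (k < M)%N -> Phi N (Pv k) = psum N k.+1.
Proof.
move=> hk; rewrite -[k]/(val (Ordinal hk)) Pv_ord /Phi comp_mpolyXU.
by rewrite -tnth_nth tnth_mktuple.
Qed.

Lemma Phi_X N (m : 'X_{1..M}) : Phi N 'X_[m] = \prod_(i < M) psum N i.+1 ^+ m i.
Proof. by rewrite /Phi comp_mpolyX; apply: eq_bigr => i _; rewrite tnth_mktuple. Qed.

#[global] Opaque Phi.

Lemma mderivXn N i k : ('X_i ^+ k.+1)^`M(i) = (k.+1)%:R *: 'X_i ^+ k :> {mpoly F[N]}.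
Proof.
rewrite mpolyXn mderivX mulmnE mnm1E eqxx mul1n mpolyXn; congr (_ *: 'X_[_]).
by apply/mnmP => j; rewrite mnmBE !mulmnE mnm1E; case: eqP => /= _; lia.
Qed.

Lemma mderivXn_neq N i j k : j != i -> ('X_j ^+ k)^`M(i) = 0 :> {mpoly F[N]}.
Proof.
move=> ji; rewrite mpolyXn mderivX mulmnE mnm1E (negbTE ji) mul0n.
by rewrite scale0r.
Qed.

Lemma mderiv_psum N i k : (psum N k.+1)^`M(i) = (k.+1)%:R *: 'X_i ^+ k.
Proof.
rewrite /psum raddf_sum (bigD1 i) //= mderivXn big1 ?addr0 // => j ji.
exact: mderivXn_neq.
Qed.

Lemma mderiv_Phi N i g :
  (Phi N g)^`M(i) = \sum_(k < M) Phi N (Dv k g) * ((k.+1)%:R *: 'X_i ^+ k).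
Proof.
elim/mpoly_gen_ind: g => [|j g IH|c f g IHf IHg].
- rewrite Phi1 -mpolyC1 mderivC big1 // => k _.
  by rewrite Dv_ord -mpolyC1 mderivC raddf0 mul0r.
- rewrite -(@Pv_ord F M) PhiM mderivM IH Phi_Pv // mderiv_psum.
  under [RHS]eq_bigr => k _ do
    rewrite DvPM PhiD !PhiM ltn_ord andbT Phi_Pv // Phi_nat mulrDl.
  rewrite big_split /=; congr (_ + _); last first.
    by rewrite mulr_sumr; apply: eq_bigr => k _; rewrite mulrA.
  rewrite (bigD1 j) //= eqxx [(nat_of_bool true)%:R]mulr1n mul1r.
  rewrite big1 => [|k /negbTE kj]; first by rewrite addr0 mulrC.
  by rewrite val_eqE kj [(nat_of_bool false)%:R]mulr0n !mul0r.
- rewrite PhiD PhiZ mderivD mderivZ IHf IHg scaler_sumr -big_split /=.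
  apply: eq_bigr => k _; rewrite linearP PhiD PhiZ mulrDl; congr (_ + _).
  by rewrite scalerAl.
Qed.

Lemma Phi_sym N g : Phi N g \is symmetric.
Proof.
apply: mcomp_sym => i; rewrite -tnth_nth tnth_mktuple.
apply/issymP => s; rewrite /psum raddf_sum /= [RHS](reindex_inj (@perm_inj _ s)) /=.
apply: eq_bigr => j _; rewrite -[msym s _]/(msym s _) !mpolyXn msymX.
congr 'X_[_]; apply/mnmP => l; rewrite mnmE !mulmnE !mnm1E; congr (nat_of_bool _ * _)%N.
by apply/eqP/eqP => [->|<-]; rewrite ?permKV ?permK.
Qed.

Lemma sym_coeff N (f : {mpoly F[N]}) (m m' : 'X_{1..N}) :
  f \is symmetric -> pt m = pt m' -> f@_m = f@_m'.
Proof.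
move=> sf e.
have : perm_eq (val m) (val m').
  have h : perm_eq [seq r <- m | (0 < r)%N] [seq r <- m' | (0 < r)%N].
    by rewrite -(permPl (perm_pt m)) e perm_pt.
  apply/seq.permP => a.
  have D (t : 'X_{1..N}) : count a t = (count a [seq r <- t | (0 < r)%N] +
      a 0%N * (N - size [seq r <- t | (0 < r)%N]))%N.
    have : perm_eq (val t) ([seq r <- t | (0 < r)%N] ++ [seq r <- t | ~~ (0 < r)%N]).
      by rewrite perm_sym; apply/permPl/perm_filterC.
    move/seq.permP => ->; rewrite count_cat; congr addn.
    rewrite (_ : [seq r <- t | ~~ (0 < r)%N] = nseq (count (fun r => ~~ (0 < r)%N) t) 0%N).
      rewrite count_nseq; congr (_ * _)%N.
      have eN : (count (fun r => 0 < r)%N t + count (predC (fun r => 0 < r)%N) t = N)%N.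
        by rewrite count_predC size_tuple.
      by rewrite size_filter -[in X in (X - _)%N]eN addKn.
    by elim: (val t : seq nat) => //= -[|r] s ->.
  by rewrite !D (seq.permP h) (perm_size h).
case/tuple_permP => s es; rewrite -(msym_coeff m' s sf); congr (_@_ _).
apply/mnmP => i; rewrite mnmE (mnm_nth 0%N) es -tnth_nth tnth_mktuple.
by rewrite mnm_tnth.
Qed.

Lemma psum_homog N k : psum N k \is k.-homog.
Proof.
rewrite rpred_sum // => i _; rewrite mpolyXn dhomogX; apply/eqP.
by rewrite [LHS]mdegMn mdeg1 mul1n.
Qed.

Lemma Phi_homog N d g : g \is d.-homog for mnmwgt -> Phi N g \is d.-homog.
Proof.
move/dhomogP => h; rewrite [g]mpolyE raddf_sum /= big_seq rpred_sum // => m /h <-.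
rewrite PhiZ dhomogZ // Phi_X /mnmwgt.
suff H s : \prod_(i <- s) psum N (i : 'I_M).+1 ^+ m i \is (\sum_(i <- s) m i * i.+1)%N.-homog.
  exact: H.
elim: s => [|i s IH]; first by rewrite !big_nil dhomog1.
by rewrite !big_cons dhomogM // mulnC dhomogMn // psum_homog.
Qed.

Lemma Dv_homog k d g : g \is (k.+1 + d).-homog for mnmwgt -> Dv k g \is d.-homog for mnmwgt.
Proof.
move=> h; case: (ltnP k M) => [hk|hk]; last by rewrite Dv_ge // dhomog0.
rewrite -[k]/(val (Ordinal hk)) Dv_ord; apply/dhomogP => m.
rewrite mcoeff_msupp mcoeff_mderiv => nz.
have : (m + U_(Ordinal hk))%MM \in msupp g.
  by rewrite mcoeff_msupp; apply: contraNneq nz => ->; rewrite mul0rn.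
by move/(dhomog_mf h); rewrite /= mnmwgtD mnmwgt1 /= addnC => /addnI.
Qed.

Lemma Dv_small k d g : g \is d.-homog for mnmwgt -> (d < k.+1)%N -> Dv k g = 0.
Proof.
move=> h lt; case: (ltnP k M) => [hk|hk]; last by rewrite Dv_ge.
rewrite -[k]/(val (Ordinal hk)) Dv_ord; apply/mpolyP => m.
rewrite mcoeff0 mcoeff_mderiv (dhomog_nemf_coeff h) ?mul0rn //.
by rewrite /= mnmwgtD mnmwgt1 /=; apply/eqP; lia.
Qed.

Lemma Pv_homog k d g : g \is d.-homog for mnmwgt -> Pv k * g \is (k.+1 + d).-homog for mnmwgt.
Proof.
move=> h; case: (ltnP k M) => [hk|hk]; last by rewrite Pv_ge // mul0r dhomog0.
by rewrite -[k]/(val (Ordinal hk)) Pv_ord dhomogM // dhomogX; apply/eqP/mnmwgt1.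
Qed.

(** Algebraic independence of p_1, ..., p_M in M variables, by induction on the degree. The
    x_i-derivatives of the image of g are the values at X = x_1, ..., x_M of one polynomial of
    degree less than M with coefficients (k+1) times the image of dg/dp_(k+1). M distinct roots make
    it 0, so all derivatives of g vanish and g is constant. *)
Lemma Phi_inj (natF : forall k, k.+1%:R != 0 :> F) g : Phi M g = 0 -> g = 0.
Proof.
move: {2}(msize g) (leqnn (msize g)) => e; elim: e g => [|e IH] g.
  by rewrite leqn0 msize_poly_eq0 => /eqP.
move=> ge g0.
have D (k : 'I_M) : g^`M(k) = 0.
  apply: IH.
    rewrite msizeE big_seq; apply: (big_ind (fun x => x <= e)%N) => // [x y hx hy|m].
      by rewrite geq_max hx hy.
    rewrite mcoeff_msupp mcoeff_mderiv => nz.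
    have : (m + U_(k))%MM \in msupp g.
      by rewrite mcoeff_msupp; apply: contraNneq nz => ->; rewrite mul0rn.
    by move/msize_mdeg_lt; rewrite mdegD mdeg1 addn1; lia.
  pose c (k : nat) : {mpoly F[M]} := (k.+1)%:R *: Phi M (Dv k g).
  pose q : {poly {mpoly F[M]}} := \poly_(k < M) c k.
  have q0 : q = 0.
    apply/eqP; apply: contraT => qn0.
    have := @max_poly_roots _ q [seq ('X_i : {mpoly F[M]}) | i <- enum 'I_M] qn0.
    rewrite size_map size_enum_ord ltnNge size_poly; apply.
      apply/allP => _ /mapP[i _ ->]; apply/eqP; rewrite horner_poly.
      transitivity ((Phi M g)^`M(i)); last by rewrite g0 mderiv0.
      by rewrite mderiv_Phi; apply: eq_bigr => l _; rewrite /c -scalerAl -scalerAr.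
    rewrite map_inj_uniq ?enum_uniq // => i j /eqP; rewrite -subr_eq0 => /eqP h.
    have := mcoeffXU F i j; rewrite (subr0_eq h) mcoeffXU eqxx.
    by case: (i =P j) => // _ /eqP; rewrite oner_eq0.
  have := coef_poly M c k; rewrite -/q q0 coef0 ltn_ord /c Dv_ord => /esym/eqP.
  by rewrite scaler_eq0 (negbTE (natF k)) => /eqP.
have gc : g = (g@_0%MM)%:MP.
  apply/mpolyP => m; rewrite mcoeffC; case: (altP (m =P 0%MM)) => [->|m0].
    by rewrite mulr1.
  have [i mi] : exists i, m i != 0%N.
    apply/existsP; rewrite -negb_forall; apply: contra m0 => /forallP h.
    by apply/eqP/mnmP => i; rewrite mnm0E; apply/eqP.
  have := mcoeff_mderiv i g (m - U_(i)).
  rewrite D mcoeff0 submK ?lep1mP // => /esym/eqP.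
  by rewrite -[X in X == 0]mulr_natr mulf_eq0 (negbTE (natF _)) orbF mulr0 => /eqP.
have := g0; rewrite gc -alg_mpolyC PhiZ Phi1 alg_mpolyC => /eqP.
by rewrite mpolyC_eq0 => /eqP ->; rewrite mpolyC0.
Qed.

End Substitution.

(** * The Laplace-Beltrami operator *)

Section DividedDifference.

Variables (F : fieldType) (al : F) (N : nat).

(** A relation instead of a division by x_i - x_j. Off the diagonal it determines q, so [lap]
    depends on f alone ([lap_uniq]). *)
Definition lap_quot (f : {mpoly F[N]}) (q : 'I_N -> 'I_N -> {mpoly F[N]}) : Prop :=
  forall i j, ('X_i - 'X_j) * q i j = 'X_i ^+ 2 * f^`M(i) - 'X_j ^+ 2 * f^`M(j).

(* Twice the Laplace-Beltrami operator. *)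
Definition lap (f : {mpoly F[N]}) (q : 'I_N -> 'I_N -> {mpoly F[N]}) : {mpoly F[N]} :=
  al *: (\sum_i 'X_i ^+ 2 * f^`M(i)^`M(i)) + \sum_i \sum_(j | j != i) q i j.

Definition euler (f : {mpoly F[N]}) : {mpoly F[N]} := \sum_i 'X_i * f^`M(i).

Lemma X_sub_neq0 (i j : 'I_N) : j != i -> 'X_i - 'X_j != 0 :> {mpoly F[N]}.
Proof.
move=> ji; rewrite subr_eq0; apply: contra ji => /eqP e.
have := mcoeffXU F i j; rewrite e mcoeffXU eqxx eq_sym.
by case: (j =P i) => // _ /eqP; rewrite oner_eq0.
Qed.

Lemma lap_uniq f q q' : lap_quot f q -> lap_quot f q' -> lap f q = lap f q'.
Proof.
move=> h h'; congr (_ + _); apply: eq_bigr => i _; apply: eq_bigr => j ji.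
by apply: (mulfI (X_sub_neq0 ji)); rewrite h h'.
Qed.

Lemma X_mderiv i (m : 'X_{1..N}) : 'X_i * ('X_[m])^`M(i) = (m i)%:R *: 'X_[m] :> {mpoly F[N]}.
Proof.
rewrite mderivX; case: (posnP (m i)) => [->|mi]; first by rewrite !scale0r mulr0.
by rewrite -scalerAr -mpolyXD addmC submK // lep1mP -lt0n.
Qed.

Lemma euler_homog d f : f \is d.-homog -> euler f = d%:R *: f.
Proof.
move=> h; rewrite {2}[f]mpolyE scaler_sumr /euler.
under eq_bigr => i _ do rewrite {1}[f]mpolyE raddf_sum mulr_sumr.
rewrite exchange_big /= big_seq [RHS]big_seq; apply: eq_bigr => m hm.
under eq_bigr => i _ do rewrite mderivZ -scalerAr X_mderiv scalerA mulrC.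
rewrite -scaler_suml -mulr_suml -scalerA; congr (_ *: _).
by rewrite -natr_sum -mdegE (dhomog_mf h hm).
Qed.

End DividedDifference.

Lemma big_ord_shift (V : nmodType) (K : nat) (f g : nat -> V) :
  (0 < K)%N -> f 0 = 0 -> g K.-1 = 0 -> (forall k, (k.+1 < K)%N -> f k.+1 = g k) ->
  \sum_(k < K) f k = \sum_(k < K) g k.
Proof.
case: K => // K _ f0 gK fg; rewrite big_ord_recl [RHS]big_ord_recr /= f0 gK add0r addr0.
by apply: eq_bigr => k _; apply: fg; rewrite ltnS.
Qed.

Section PowerSumLaplacian.

Variables (F : fieldType) (al : F) (M N : nat).

Local Notation Pv := (@Pv F M).
Local Notation Dv := (@Dv F M).
Local Notation Phi := (@Phi F M).
Local Notation psum := (@psum F).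

(** The complete homogeneous polynomial h_r(x_i, x_j), that is (x_i^(r+1) - x_j^(r+1)) / (x_i -
    x_j). *)
Definition hsum r (i j : 'I_N) : {mpoly F[N]} := \sum_(t < r.+1) 'X_i ^+ (r - t) * 'X_j ^+ t.

Definition ps_quot (g : {mpoly F[M]}) (i j : 'I_N) : {mpoly F[N]} :=
  \sum_(k < M) Phi N (Dv k g) * ((k.+1)%:R *: hsum k.+1 i j).

Lemma ps_quotP g : lap_quot (Phi N g) (ps_quot g).
Proof.
move=> i j; rewrite !mderiv_Phi !mulr_sumr -sumrB; apply: eq_bigr => k _.
have -> : ('X_i - 'X_j) * (Phi N (Dv k g) * (k.+1%:R *: hsum k.+1 i j)) =
   Phi N (Dv k g) * (k.+1%:R *: (('X_i - 'X_j) * hsum k.+1 i j)).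
  by rewrite -!scalerAr mulrCA.
have -> : ('X_i - 'X_j) * hsum k.+1 i j = 'X_i ^+ k.+2 - 'X_j ^+ k.+2 by rewrite subrXX.
have E (x : {mpoly F[N]}) : 'X_i ^+ 2 * (Phi N (Dv k g) * (k.+1%:R *: x)) =
    Phi N (Dv k g) * (k.+1%:R *: ('X_i ^+ 2 * x)) by rewrite -!scalerAr mulrCA.
have E' (x : {mpoly F[N]}) : 'X_j ^+ 2 * (Phi N (Dv k g) * (k.+1%:R *: x)) =
    Phi N (Dv k g) * (k.+1%:R *: ('X_j ^+ 2 * x)) by rewrite -!scalerAr mulrCA.
by rewrite E E' -!exprD !add2n scalerBr mulrBr.
Qed.

Lemma psum0 : psum N 0 = N%:R.
Proof. by rewrite /psum; under eq_bigr => i _ do rewrite expr0; rewrite sumr_const card_ord. Qed.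

(** Over all pairs the sum is sum_t p_(k+1-t) p_t, whose two end terms give 2N p_(k+1) because p_0 =
    N; the diagonal i = j takes away (k+2) p_(k+1). *)
Lemma hsum_sum k : \sum_i \sum_(j | j != i) hsum k.+1 i j =
  (N.*2%:R - k.+2%:R) *: psum N k.+1 + \sum_(t < k) psum N t.+1 * psum N (k.-1 - t).+1.
Proof.
have E i : \sum_(j | j != i) hsum k.+1 i j = \sum_j hsum k.+1 i j - k.+2%:R *: 'X_i ^+ k.+1.
  rewrite [X in _ = X - _](bigD1 i) //= addrAC -[LHS]add0r; congr (_ + _).
  apply/esym/eqP; rewrite subr_eq0 /hsum; apply/eqP.
  transitivity (\sum_(t < k.+2) 'X_i ^+ k.+1 : {mpoly F[N]}); last first.
    by rewrite sumr_const card_ord scaler_nat.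
  by apply: eq_bigr => t _; rewrite -exprD subnK //; have := ltn_ord t; rewrite ltnS.
under eq_bigr => i _ do rewrite E.
rewrite sumrB -scaler_sumr -/(psum N k.+1).
have -> : \sum_i \sum_j hsum k.+1 i j = \sum_(t < k.+2) psum N (k.+1 - t) * psum N t.
  rewrite /hsum; under eq_bigr => i _ do rewrite exchange_big /=.
  rewrite exchange_big /=; apply: eq_bigr => t _.
  by rewrite /psum mulr_suml; apply: eq_bigr => i _; rewrite mulr_sumr.
rewrite big_ord_recl big_ord_recr /= subn0 /bump /= add1n subnn psum0.
have -> : \sum_(i < k) psum N (k.+1 - (1 + i)) * psum N (1 + i) =
    \sum_(t < k) psum N t.+1 * psum N (k.-1 - t).+1.
  apply: eq_bigr => t _; rewrite mulrC add1n; congr (psum N _ * psum N _).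
  by have := ltn_ord t; lia.
set P := psum N k.+1; set S := \sum_(t < k) _; move: (k.+2%:R : F) => a.
have eN : N%:R * P = N%:R *: P by rewrite scaler_nat mulr_natl.
by rewrite (mulrC P) eN -addnn natrD scalerBl (scalerDl P N%:R); ring.
Qed.

Lemma euler_psum d g : g \is d.-homog for mnmwgt ->
  \sum_(k < M) (k.+1)%:R *: (Pv k * Dv k g) = d%:R *: g.
Proof.
move=> h; rewrite {2}[g]mpolyE scaler_sumr.
under eq_bigr => k _ do rewrite Pv_ord Dv_ord {1}[g]mpolyE raddf_sum mulr_sumr scaler_sumr.
rewrite exchange_big /= big_seq [RHS]big_seq; apply: eq_bigr => m hm.
have E (k : 'I_M) : k.+1%:R *: ('X_k * (g@_m *: 'X_[m])^`M(k)) =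
    (m k * k.+1)%:R *: (g@_m *: 'X_[m]).
  by rewrite mderivZ -scalerAr X_mderiv !scalerA natrM; congr (_ *: _); ring.
under eq_bigr => k _ do rewrite E.
by rewrite -scaler_suml -natr_sum -(dhomog_mf h hm).
Qed.

(** In degree d <= M a product of two derivatives of index l and k vanishes unless l + k + 2 <= d,
    so the power sum p_(l+k+2) that accompanies it is one of the M variables. *)
Lemma sum_sq_mderiv2 d g : g \is d.-homog for mnmwgt -> (d <= M)%N ->
  \sum_i 'X_i ^+ 2 * (Phi N g)^`M(i)^`M(i) =
  Phi N (\sum_(k < M) \sum_(t < k)
          ((t.+1)%:R * (k - t)%:R) *: (Pv k * Dv t (Dv (k.-1 - t) g)) +
         \sum_(k < M) ((k.+1)%:R * k%:R) *: (Pv k * Dv k g)).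
Proof.
move=> h dM.
have E i : 'X_i ^+ 2 * (Phi N g)^`M(i)^`M(i) =
    \sum_(k < M) \sum_(l < M) (l.+1%:R * k.+1%:R) *: (Phi N (Dv l (Dv k g)) * 'X_i ^+ (l + k).+2)
  + \sum_(k < M) (k.+1%:R * k%:R) *: (Phi N (Dv k g) * 'X_i ^+ k.+1).
  rewrite mderiv_Phi raddf_sum mulr_sumr -big_split; apply: eq_bigr => k _.
  rewrite /= mderivM mulrDr mderiv_Phi mulr_suml mulr_sumr; congr (_ + _).
    apply: eq_bigr => l _; rewrite -!scalerAr -!scalerAl -!scalerAr scalerA [k.+1%:R * _]mulrC.
    by congr (_ *: _); rewrite -(mulrA (Phi N _)) mulrCA -!exprD !add2n.
  rewrite mderivZ; case: (val k) => [|k'].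
    by rewrite expr0 -mpolyC1 mderivC scaler0 !mulr0 scale0r.
  rewrite mderivXn scalerA -!scalerAr; congr (_ *: _).
  by rewrite mulrCA -exprD add2n.
under eq_bigr => i _ do rewrite E.
rewrite big_split /= PhiD; congr (_ + _).
  rewrite exchange_big /=; under eq_bigr => k _ do rewrite exchange_big /=.
  rewrite exchange_big /=.
  pose G l k := (l.+1%:R * k.+1%:R) *: (Phi N (Dv l (Dv k g)) * psum N (l + k).+2).
  transitivity (\sum_(l < M) \sum_(k < M) G l k).
    apply: eq_bigr => l _; apply: eq_bigr => k _.
    by rewrite /G /psum mulr_sumr scaler_sumr.
  rewrite triangle_sum => [|l k lk]; last first.
    rewrite /G (_ : Dv l (Dv k g) = 0) ?raddf0 ?mul0r ?scaler0 //.
    case: (ltnP d k.+1) => hk; first by rewrite (Dv_small h hk) linear0.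
    apply: (@Dv_small _ _ _ (d - k.+1)); last by lia.
    by apply: Dv_homog; rewrite subnKC.
  rewrite raddf_sum /=; apply: eq_bigr => k _; rewrite raddf_sum /=; apply: eq_bigr => t _.
  have tk := ltn_ord t.
  rewrite PhiZ PhiM Phi_Pv // /G (mulrC (psum N k.+1)).
  by congr ((_ * _%:R) *: (_ * psum N _)); lia.
rewrite exchange_big raddf_sum /=; apply: eq_bigr => k _.
rewrite PhiZ PhiM Phi_Pv // -scaler_sumr -mulr_sumr; congr (_ *: _).
by rewrite mulrC.
Qed.

(** The terms with N come from p_0 = N and amount to a multiple of the degree: (k+1)(2N - k - 2) +
    alpha (k+1) k = (alpha - 1)(k+1) k + 2 (N - 1)(k+1). Hence [D2] does not involve N. *)
Lemma lap_Phi d g : g \is d.-homog for mnmwgt -> (d <= M)%N ->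
  lap al (Phi N g) (ps_quot g) = Phi N (D2 al g) + (2%:R * (N%:R - 1) * d%:R) *: Phi N g.
Proof.
move=> h dM; rewrite /lap (sum_sq_mderiv2 h dM) -scalerA -[d%:R *: _]PhiZ -(euler_psum h).
have -> : \sum_i \sum_(j | j != i) ps_quot g i j =
    \sum_(k < M) Phi N (Dv k g) * (k.+1%:R *: \sum_i \sum_(j | j != i) hsum k.+1 i j).
  rewrite /ps_quot; under eq_bigr => i _ do rewrite exchange_big /=.
  rewrite exchange_big /=; apply: eq_bigr => k _.
  rewrite scaler_sumr mulr_sumr; apply: eq_bigr => i _.
  by rewrite scaler_sumr mulr_sumr.
have -> : \sum_(k < M) Phi N (Dv k g) * (k.+1%:R *: \sum_i \sum_(j | j != i) hsum k.+1 i j) =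
    Phi N (\sum_(k < M) \sum_(t < k) (k.+1)%:R *: (Pv t * Pv (k.-1 - t) * Dv k g)) +
    \sum_(k < M) (k.+1%:R * (N.*2%:R - k.+2%:R)) *: Phi N (Pv k * Dv k g).
  rewrite raddf_sum -big_split; apply: eq_bigr => k _ /=.
  rewrite hsum_sum addrC scalerDr mulrDr; congr (_ + _).
    by rewrite scalerA PhiM Phi_Pv // -scalerAr (mulrC (psum N _)).
  rewrite [RHS]raddf_sum scaler_sumr mulr_sumr; apply: eq_bigr => t _ /=.
  have tk := ltn_ord t.
  rewrite PhiZ !PhiM !Phi_Pv ?(ltn_trans tk) //; last by have := ltn_ord k; lia.
  by rewrite -scalerAr (mulrC (Phi N _)).
rewrite /D2 !PhiD !PhiZ scalerDr -!addrA; congr (_ + _).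
rewrite [LHS]addrCA; congr (_ + _).
rewrite !Phi_sum !scaler_sumr -!big_split; apply: eq_bigr => k _ /=.
rewrite !PhiZ !scalerA -!scalerDl; congr (_ *: _).
rewrite -addnn natrD -!natr1; ring.
Qed.

Lemma D2_homog d (g : {mpoly F[M]}) : g \is d.-homog for mnmwgt -> D2 al g \is d.-homog for mnmwgt.
Proof.
move=> h.
have D k e f : f \is e.-homog for mnmwgt -> Dv k f \is (e - k.+1).-homog for mnmwgt.
  move=> hf; case: (ltnP e k.+1) => ek; first by rewrite (Dv_small hf) ?dhomog0.
  by apply: Dv_homog; rewrite subnKC.
have PD k f : f \is (d - k.+1).-homog for mnmwgt -> ((d < k.+1)%N -> f = 0) ->
    Pv k * f \is d.-homog for mnmwgt.
  move=> hf f0; case: (ltnP d k.+1) => dk; first by rewrite f0 // mulr0 dhomog0.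
  by rewrite -(subnKC dk) Pv_homog.
rewrite /D2; apply: rpredD; first apply: rpredD.
- apply/rpredZ/rpred_sum => k _; apply: rpred_sum => t _; have tk := ltn_ord t; rewrite rpredZ // PD //.
    have := D t _ _ (D (k.-1 - t)%N _ _ h).
    by rewrite -subnDA; have -> : ((k.-1 - t).+1 + t.+1 = k.+1)%N by lia.
  move=> dk; case: (ltnP d (k.-1 - t).+1) => dk'; first by rewrite (Dv_small h) // linear0.
  by rewrite (Dv_small (D _ _ _ h)) //; lia.
- apply: rpred_sum => k _; apply: rpred_sum => t _; have tk := ltn_ord t; rewrite rpredZ //.
  case: (ltnP d k.+1) => dk; first by rewrite (Dv_small h) // mulr0 dhomog0.
  have -> : d = (t.+1 + ((k.-1 - t).+1 + (d - k.+1)))%N by lia.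
  by rewrite -mulrA !Pv_homog // D.
- apply/rpredZ/rpred_sum => k _.
  by rewrite rpredZ // PD ?D // => dk; rewrite (Dv_small h).
Qed.

(** Since x_i^2 d_i raises p_k to p_(k+1), the bound d < M keeps p_(M+1) from occurring. *)
Lemma Phi_raise2 d g : g \is d.-homog for mnmwgt -> (d < M)%N ->
  Phi N (raise2 g) = \sum_i 'X_i ^+ 2 * (Phi N g)^`M(i).
Proof.
move=> h dM; under [RHS]eq_bigr => i _ do rewrite mderiv_Phi mulr_sumr.
rewrite exchange_big /= /raise2 Phi_sum.
have T (k : nat) : (k < M)%N -> \sum_(i < N) 'X_i ^+ 2 * (Phi N (Dv k g) * (k.+1%:R *: 'X_i ^+ k))
   = (k.+1)%:R *: (psum N k.+2 * Phi N (Dv k g)).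
  move=> _; rewrite /psum mulr_suml scaler_sumr; apply: eq_bigr => i _.
  by rewrite -!scalerAr mulrCA -exprD add2n mulrC.
under [RHS]eq_bigr => k _ do rewrite (T k (ltn_ord k)).
apply: (big_ord_shift (f := fun k => Phi N (k%:R *: (Pv k * Dv k.-1 g)))
                     (g := fun k => k.+1%:R *: (psum N k.+2 * Phi N (Dv k g)))).
- exact: leq_ltn_trans dM.
- by rewrite scale0r raddf0.
- by rewrite (Dv_small h) ?raddf0 ?mulr0 ?scaler0 //; lia.
- by move=> k hk; rewrite PhiZ PhiM Phi_Pv.
Qed.

Lemma Phi_lower2 g : \sum_i (Phi N g)^`M(i) = Phi N (N%:R *: Dv 0 g + lower2 g).
Proof.
under eq_bigr => i _ do rewrite mderiv_Phi.
rewrite exchange_big /= PhiD /lower2 Phi_sum PhiZ.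
have T (k : 'I_M) : \sum_(i < N) Phi N (Dv k g) * (k.+1%:R *: 'X_i ^+ k)
   = Phi N (((k == 0 :> nat)%:R * N%:R) *: Dv k g) + Phi N (((0 < k)%N * k.+1)%:R *: (Pv k.-1 * Dv k g)).
  rewrite -mulr_sumr -scaler_sumr -/(psum N k) !PhiZ; case: k => -[|k] hk /=.
    by rewrite mul1r mul0n scale0r addr0 scale1r psum0 mulrC mulr_natl scaler_nat.
  rewrite mul0r scale0r add0r mul1n PhiM Phi_Pv; last exact: ltnW.
  by rewrite -scalerAr mulrC.
rewrite (eq_bigr _ (fun k _ => T k)) big_split /=; congr (_ + _).
case: (posnP M) => M0.
  rewrite Dv_ge ?M0 // raddf0 scaler0 big1 // => k; by have := ltn_ord k; rewrite {2}M0.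
rewrite (bigD1 (Ordinal M0)) //= mul1r PhiZ big1 ?addr0 // => k.
by rewrite -val_eqE /= => /negbTE ->; rewrite mul0r scale0r raddf0.
Qed.

Definition ev (z : F) (g : {mpoly F[M]}) : F := meval (fun _ => z) g.

(** At p_r = z the operators p_(k-1) d/dp_k and p_k d/dp_k take the same value, and z d/dp_1
    supplies the missing term k = 1, so the Euler identity applies. *)
Lemma ev_lower d z g : g \is d.-homog for mnmwgt ->
  ev z (z *: Dv 0 g + lower2 g) = d%:R * ev z g.
Proof.
move=> h; rewrite -mevalZ -(euler_psum h) /lower2 [LHS]mevalD mevalZ !raddf_sum /=.
have T (k : 'I_M) : ev z (k.+1%:R *: (Pv k * Dv k g)) =
   ((k == 0 :> nat)%:R * z) * ev z (Dv k g) + ev z (((0 < k)%N * k.+1)%:R *: (Pv k.-1 * Dv k g)).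
  rewrite /ev !mevalZ !mevalM Pv_ord mevalXU; case: k => -[|k] hk /=.
    by rewrite !mul1r mul0n mul0r addr0.
  by rewrite -[k]/(val (Ordinal (ltnW hk))) Pv_ord mevalXU !mul0r add0r mul1n.
rewrite [RHS](eq_bigr _ (fun k _ => T k)) big_split /=; congr (_ + _).
case: (posnP M) => M0.
  rewrite Dv_ge ?M0 // meval0 mulr0 big1 // => k; by have := ltn_ord k; rewrite {2}M0.
rewrite (bigD1 (Ordinal M0)) //= mul1r big1 ?addr0 // => k.
by rewrite -val_eqE /= => /negbTE ->; rewrite !mul0r.
Qed.

Lemma meval_Phi g : meval (fun _ => 1) (Phi N g) = ev N%:R g.
Proof.
elim/mpoly_gen_ind: g => [|j g IH|c f g IHf IHg].
- by rewrite Phi1 /ev !meval1.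
- rewrite PhiM -(@Pv_ord F M) Phi_Pv // /ev !mevalM -/(ev _ _) IH; congr (_ * _).
  rewrite /ev Pv_ord mevalXU /psum raddf_sum /= (eq_bigr (fun _ => 1)) ?sumr_const ?card_ord //.
  by move=> i _; rewrite mpolyXn mevalX big1 // => k _; rewrite expr1n.
- by rewrite PhiD PhiZ mevalD mevalZ IHf IHg /ev mevalD mevalZ.
Qed.

End PowerSumLaplacian.

(** * Multiplication by e_N and e_(N-1) *)

Section ElementaryMultiplication.

Variables (F : fieldType) (al : F) (N : nat).
Implicit Types (f g : {mpoly F[N]}) (m : 'X_{1..N}).

Definition mone : 'X_{1..N} := [multinom 1%N | i < N].

Definition en : {mpoly F[N]} := 'X_[mone].

Definition en_drop (i : 'I_N) : {mpoly F[N]} := 'X_[mone - U_(i)].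

(** The elementary symmetric polynomial e_(N-1), equal to sum_i d_i e_N. *)
Definition en1 : {mpoly F[N]} := \sum_i en_drop i.

Lemma mderiv_en i : en^`M(i) = en_drop i.
Proof. by rewrite mderivX mnmE scale1r. Qed.

Lemma X_en_drop i : 'X_i * en_drop i = en.
Proof. by rewrite -mpolyXD addmC submK // lep1mP mnmE. Qed.

Lemma mderiv_en_drop i : (en_drop i)^`M(i) = 0.
Proof. by rewrite mderivX mnmBE mnmE mnm1E eqxx scale0r. Qed.

Lemma X_mderiv_en_drop i j : 'X_i * (en_drop j)^`M(i) = (j != i)%:R *: en_drop j.
Proof. by rewrite X_mderiv mnmBE mnmE mnm1E; case: (j == i). Qed.

Lemma X2_mderiv2_en_drop i j : 'X_i ^+ 2 * (en_drop j)^`M(i)^`M(i) = 0.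
Proof.
case: (altP (j =P i)) => [->|ji]; first by rewrite mderiv_en_drop mderiv0 mulr0.
rewrite mderivX mnmBE mnmE mnm1E (negbTE ji) scale1r mderivX.
by rewrite !mnmBE mnmE !mnm1E (negbTE ji) eqxx scale0r mulr0.
Qed.

Lemma mderiv_sum_en f : \sum_i (en * f)^`M(i) = en1 * f + en * \sum_i f^`M(i).
Proof.
rewrite /en1 mulr_suml mulr_sumr -big_split; apply: eq_bigr => i _.
by rewrite mderivM mderiv_en.
Qed.

Lemma lap_quot_en f q : lap_quot f q -> lap_quot (en * f) (fun i j => en * (q i j + f)).
Proof.
move=> h i j; rewrite !mderivM !mderiv_en.
have -> : ('X_i - 'X_j) * (en * (q i j + f)) =
  en * (('X_i - 'X_j) * q i j) + ('X_i - 'X_j) * en * f by ring.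
have E k : 'X_k ^+ 2 * (en_drop k * f + en * f^`M(k)) =
    'X_k * en * f + 'X_k ^+ 2 * (en * f^`M(k)) by rewrite -(X_en_drop k); ring.
by rewrite h !E; ring.
Qed.

Lemma sum_pairs_const (a : {mpoly F[N]}) (q : 'I_N -> 'I_N -> {mpoly F[N]}) f :
  \sum_i \sum_(j | j != i) a * (q i j + f) =
  a * (\sum_i \sum_(j | j != i) q i j + (N * N.-1)%:R *: f).
Proof.
rewrite mulrDr mulr_sumr.
transitivity (\sum_(i < N) (a * (\sum_(j | j != i) q i j) + a * f *+ N.-1)).
  apply: eq_bigr => i _; rewrite -mulr_sumr big_split mulrDr; congr (_ + _).
  by rewrite sumr_const cardC1 card_ord mulrnAr.
rewrite big_split /= sumr_const card_ord -mulrnA mulnC; congr (_ + _).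
by rewrite scaler_nat mulrnAr.
Qed.

(** Beyond a scalar, conjugation by e_N adds only a multiple of the Euler operator, so e_N times a
    homogeneous eigenfunction is again an eigenfunction. *)
Lemma lap_en f q : lap al (en * f) (fun i j => en * (q i j + f)) =
  en * (lap al f q + (al *+ 2) *: euler f + (N * N.-1)%:R *: f).
Proof.
rewrite /lap sum_pairs_const.
have -> : \sum_i 'X_i ^+ 2 * (en * f)^`M(i)^`M(i) =
    en * (\sum_i 'X_i ^+ 2 * f^`M(i)^`M(i) + euler f *+ 2).
  rewrite mulrDr mulr_sumr mulrnAr mulr_sumr -sumrMnl -big_split; apply: eq_bigr => i _ /=.
  by rewrite mderivM mderiv_en mderivD !mderivM mderiv_en_drop mderiv_en -(X_en_drop i); ring.
by rewrite -!mul_mpolyC mpolyCMn; ring.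
Qed.

Lemma X_mderiv_en1 k : 'X_k * en1^`M(k) = en1 - en_drop k.
Proof.
rewrite /en1 raddf_sum mulr_sumr.
under eq_bigr => l _ do rewrite X_mderiv_en_drop.
rewrite (bigD1 k) //= eqxx scale0r add0r [in RHS](bigD1 k) //= addrAC subrr add0r.
by apply: eq_bigr => l lk; rewrite lk scale1r.
Qed.

Lemma X2_mderiv2_en1 k : 'X_k ^+ 2 * en1^`M(k)^`M(k) = 0.
Proof.
have -> : en1^`M(k)^`M(k) = \sum_l (en_drop l)^`M(k)^`M(k).
  have -> : en1^`M(k) = \sum_l (en_drop l)^`M(k) by rewrite /en1 raddf_sum.
  exact: raddf_sum.
by rewrite mulr_sumr big1 // => l _; exact: X2_mderiv2_en_drop.
Qed.

(** e_(N-1) behaves like e_N except for the term -e_N / x_k in [X_mderiv_en1], which produces the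
    correction with e_N sum_i d_i f. This correction is what relates lowering coefficients in
    [pieri_down_addcol]. *)
Lemma lap_en1 f q : lap al (en1 * f) (fun i j => en1 * (q i j + f)) =
  en1 * (lap al f q + (al *+ 2) *: euler f + (N * N.-1)%:R *: f)
  - (al *+ 2) *: (en * \sum_i f^`M(i)).
Proof.
rewrite /lap sum_pairs_const.
have -> : \sum_i 'X_i ^+ 2 * (en1 * f)^`M(i)^`M(i) =
    en1 * (\sum_i 'X_i ^+ 2 * f^`M(i)^`M(i) + euler f *+ 2) - (en * \sum_i f^`M(i)) *+ 2.
  rewrite mulrDr mulr_sumr mulrnAr !mulr_sumr -!sumrMnl -big_split -sumrB; apply: eq_bigr => i _ /=.
  rewrite mderivM mderivD !mderivM -(X_en_drop i).
  have -> : 'X_i ^+ 2 * (en1^`M(i)^`M(i) * f + en1^`M(i) * f^`M(i) +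
      (en1^`M(i) * f^`M(i) + en1 * f^`M(i)^`M(i))) =
    ('X_i ^+ 2 * en1^`M(i)^`M(i)) * f + ('X_i * en1^`M(i)) * ('X_i * f^`M(i)) *+ 2
    + en1 * ('X_i ^+ 2 * f^`M(i)^`M(i)) by ring.
  by rewrite X2_mderiv2_en1 X_mderiv_en1; ring.
by rewrite -!mul_mpolyC mpolyCMn; ring.
Qed.

Lemma lap_quot_en1 f q : lap_quot f q -> lap_quot (en1 * f) (fun i j => en1 * (q i j + f)).
Proof.
move=> h i j; rewrite !mderivM.
have E k : 'X_k ^+ 2 * (en1^`M(k) * f + en1 * f^`M(k)) =
    'X_k * en1 * f - en * f + 'X_k ^+ 2 * (en1 * f^`M(k)).
  have -> : 'X_k ^+ 2 * (en1^`M(k) * f + en1 * f^`M(k)) =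
    'X_k * ('X_k * en1^`M(k)) * f + 'X_k ^+ 2 * (en1 * f^`M(k)) by ring.
  by rewrite X_mderiv_en1 -(X_en_drop k); ring.
rewrite !E.
have -> : ('X_i - 'X_j) * (en1 * (q i j + f)) =
  en1 * (('X_i - 'X_j) * q i j) + ('X_i - 'X_j) * en1 * f by ring.
by rewrite h; ring.
Qed.

End ElementaryMultiplication.

(** * Triangularity of the Laplace-Beltrami operator on monomials *)

Section Triangularity.

Variables (F : fieldType) (al : F) (N : nat).
Implicit Types (f g : {mpoly F[N]}) (m : 'X_{1..N}).

Lemma mcoeff_Xl i g m : ('X_i * g)@_(m + U_(i)) = g@_m.
Proof. by rewrite mulrC addmC mcoeffMX. Qed.

Lemma mcoeff_Xl0 i g (m : 'X_{1..N}) : m i = 0%N -> ('X_i * g)@_m = 0.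
Proof.
move=> mi; apply: memN_msupp_eq0; apply/negP; rewrite mulrC.
by rewrite (perm_mem (msuppMX _ _)) => /mapP[m' _ e]; move: mi; rewrite e mnmDE mnm1E eqxx.
Qed.

Lemma mcoeff_X_mderiv i g (m : 'X_{1..N}) : ('X_i * g^`M(i))@_m = (m i)%:R * g@_m.
Proof.
case: (posnP (m i)) => mi; first by rewrite mcoeff_Xl0 // mi mul0r.
have e : m = (m - U_(i) + U_(i))%MM by rewrite submK // lep1mP -lt0n.
rewrite {1}e mcoeff_Xl mcoeff_mderiv -e mnmBE mnm1E eqxx subn1 prednK //.
by rewrite mulr_natl.
Qed.

Lemma mderivXi i : ('X_i)^`M(i) = 1 :> {mpoly F[N]}.
Proof.
rewrite mderivX mnm1E eqxx scale1r (_ : (U_(i) - U_(i) = 0)%MM) ?mpolyX0 //.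
by apply/mnmP => j; rewrite mnmBE subnn mnm0E.
Qed.

Lemma mcoeff_X2_mderiv2 i g (m : 'X_{1..N}) :
  ('X_i ^+ 2 * g^`M(i)^`M(i))@_m = (m i * (m i).-1)%:R * g@_m.
Proof.
have -> : 'X_i ^+ 2 * g^`M(i)^`M(i) = 'X_i * ('X_i * g^`M(i))^`M(i) - 'X_i * g^`M(i).
  by rewrite mderivM mderivXi; ring.
rewrite mcoeffB !mcoeff_X_mderiv; case: (m i) => [|k]; first by rewrite mul0n !mul0r subr0.
by rewrite natrM /= -natr1; ring.
Qed.

Definition raise_mnm (i j : 'I_N) (m : 'X_{1..N}) : 'X_{1..N} := (m + U_(i) - U_(j))%MM.

(** Convexity of r -> (r - k)^+: a unit moves from the smaller exponent to the larger one. *)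
Lemma excess_raise (i j : 'I_N) m k : i != j -> (m j <= m i)%N -> (0 < m j)%N ->
  (excess k m <= excess k (raise_mnm i j m))%N.
Proof.
move=> ij ji mj; rewrite !excessE (bigD1 i) //= (bigD1 j) 1?eq_sym //=.
rewrite [X in (_ <= X)%N](bigD1 i) //= [X in (_ <= _ + X)%N](bigD1 j) 1?eq_sym //=.
rewrite /raise_mnm !mnmBE !mnmDE !mnm1E !eqxx (negbTE ij) eq_sym (negbTE ij).
rewrite (eq_bigr (fun l : 'I_N => (m + U_(i) - U_(j))%MM l - k)%N); first by lia.
by move=> l /andP[li lj]; rewrite mnmBE mnmDE !mnm1E eq_sym (negbTE li) eq_sym (negbTE lj) addn0 subn0.
Qed.

Lemma mdeg_raise (i j : 'I_N) m : (0 < m j)%N -> mdeg (raise_mnm i j m) = mdeg m.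
Proof.
move=> mj; have := mdegD (raise_mnm i j m) U_(j); rewrite /raise_mnm submK; last first.
  by rewrite lep1mP mnmDE; lia.
by rewrite mdegD !mdeg1; lia.
Qed.

(** Coefficients at x^m x_i in the relation for q express the coefficient of q at m by m_i f_m and
    by coefficients at m with one unit moved from j to i. Iterating brings m_j down to 0, so any
    correction comes from a support monomial reached by such moves. *)
Lemma lap_quot_coeff f q (i j : 'I_N) m : lap_quot f q -> i != j -> (m j <= m i)%N ->
  (q i j)@_m = (m i)%:R * f@_m \/
  exists m', [/\ f@_m' != 0, (0 < m j)%N, mdeg m' = mdeg m &
    forall k, (excess k (raise_mnm i j m) <= excess k m')%N].
Proof.
move=> h ij; have [e] := ubnP (m j); elim: e m => // e IH m; rewrite ltnS => me ji.
have R : (('X_i - 'X_j) * q i j)@_(m + U_(i)) =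
    ('X_i * ('X_i * f^`M(i)) - 'X_j * ('X_j * f^`M(j)))@_(m + U_(i)).
  by rewrite h; congr (_@_ _); ring.
move: R; rewrite mulrBl !mcoeffB !mcoeff_Xl mcoeff_X_mderiv.
case: (posnP (m j)) => mj.
  rewrite !(@mcoeff_Xl0 j) ?subr0; first by left.
  - by rewrite mnmDE mnm1E (negbTE ij) mj.
  - by rewrite mnmDE mnm1E (negbTE ij) mj.
set m1 := raise_mnm i j m.
have e1 : (m + U_(i) = m1 + U_(j))%MM.
  by rewrite /m1 /raise_mnm submK // lep1mP mnmDE; lia.
have m1i : m1 i = (m i).+1 by rewrite /m1 /raise_mnm mnmBE mnmDE !mnm1E eqxx eq_sym (negbTE ij) addn1 subn0.
have m1j : m1 j = (m j).-1 by rewrite /m1 /raise_mnm mnmBE mnmDE !mnm1E eqxx (negbTE ij) addn0 subn1.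
rewrite e1 !mcoeff_Xl mcoeff_X_mderiv => R.
case: (eqVneq f@_m1 0) => [f0|fn0]; last first.
  by right; exists m1; split=> //; rewrite /m1 mdeg_raise.
have [||q1|[m' [fm' m1j0 dm' ex]]] := IH m1; rewrite ?m1i ?m1j; try lia.
  by left; move: R; rewrite q1 f0 !mulr0 !subr0.
right; exists m'; split=> //; first by rewrite dm' /m1 mdeg_raise.
move=> k; apply: leq_trans (ex k); apply: excess_raise => //; rewrite ?m1i ?m1j; lia.
Qed.

Lemma lap_quot_sym f q i j : lap_quot f q -> i != j -> q i j = q j i.
Proof.
move=> h ij; apply: (mulfI (X_sub_neq0 F (i := i) (j := j) _)); first by rewrite eq_sym.
by rewrite h -(opprB 'X_j 'X_i) mulNr h opprB.
Qed.

(** If x^m is missing from f, some q_ij must contain it; by symmetry the larger exponent may be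
    taken at i, and [lap_quot_coeff] then yields a support monomial above a raising of m. *)
Lemma lap_triangular f q m : lap_quot f q -> (lap al f q)@_m != 0 ->
  exists m', [/\ f@_m' != 0, mdeg m' = mdeg m & forall k, (excess k m <= excess k m')%N].
Proof.
move=> h; case: (eqVneq f@_m 0) => [f0|fn0]; last by move=> _; exists m.
have [[i j] /andP[/= ij qn0]|none] := pickP (fun p : 'I_N * 'I_N => (p.2 != p.1) && ((q p.1 p.2)@_m != 0)).
  wlog ji : i j ij qn0 / (m j <= m i)%N.
    move=> H; case: (leqP (m j) (m i)) => ji; first exact: (H i j).
    by apply: (H j i _ _ (ltnW ji)); [rewrite eq_sym | rewrite (lap_quot_sym h ij)].
  have ij' : i != j by rewrite eq_sym.
  have [qf|[m' [fm' mj dm ex]] _] := lap_quot_coeff h ij' ji.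
    by move: qn0; rewrite qf f0 mulr0 eqxx.
  by exists m'; split=> // k; apply: leq_trans (ex k); apply: excess_raise.
rewrite /lap mcoeffD mcoeffZ !raddf_sum /= big1; last first.
  by move=> i _; rewrite mcoeff_X2_mderiv2 f0 mulr0.
rewrite mulr0 add0r big1 ?eqxx // => i _; rewrite raddf_sum big1 //= => j ji.
by have := none (i, j); rewrite /= ji /= => /negbFE/eqP.
Qed.

(* No support monomial exceeds la, so only the raising-free part of
   lap_quot_coeff contributes to the coefficient of x^la. *)
Lemma lap_lead f q (la : seq nat) : is_partn la -> (size la <= N)%N -> lap_quot f q ->
  (forall m', f@_m' != 0 -> mdeg m' = sumn la -> forall k, (excess k m' <= excess k la)%N) ->
  (lap al f q)@_(mnm_of N la) =
  (al * (\sum_(i < N) nth 0 la i * (nth 0 la i).-1)%N%:R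
    + 2%:R * (\sum_(i < N) (N.-1 - i) * nth 0 la i)%N%:R) * f@_(mnm_of N la).
Proof.
move=> pla sla h sup.
have mi (i : 'I_N) : mnm_of N la i = nth 0%N la i by rewrite mnmE.
have Q (i j : 'I_N) : (i < j)%N -> (q i j)@_(mnm_of N la) = (nth 0%N la i)%:R * f@_(mnm_of N la).
  move=> ij; have ij' : i != j by rewrite -val_eqE neq_ltn ij.
  have ji : (mnm_of N la j <= mnm_of N la i)%N.
    rewrite !mi; case: (ltnP j (size la)) => hj; last by rewrite nth_default.
    case/andP: pla => srt _.
    by have := sorted_ltn_nth geq_trans_nat 0%N srt _ _ (ltn_trans ij hj) hj ij.
  have [->|[m' [fm' mj dm ex]]] := lap_quot_coeff h ij' ji; first by rewrite mi.
  have := sup m' fm'; rewrite dm mdeg_mnm_of // => /(_ erefl (nth 0 la i)%N).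
  have -> k : excess k la = excess k (mnm_of N la) by rewrite -{1}(pt_mnm_of pla sla) excess_pt.
  move=> le2; have := leq_trans (ex _) le2; rewrite !excessE.
  rewrite (bigD1 i) //= (bigD1 j) 1?eq_sym //=.
  rewrite [X in (_ <= X)%N](bigD1 i) //= [X in (_ <= _ + X)%N](bigD1 j) 1?eq_sym //=.
  rewrite /raise_mnm !mnmBE !mnmDE !mnm1E !eqxx (negbTE ij') eq_sym (negbTE ij') !mi.
  rewrite (eq_bigr (fun l : 'I_N => mnm_of N la l - nth 0 la i)%N).
    move: (\sum_(l < N | _) _)%N => S le3; exfalso; move: mj ji le3; rewrite !mi; lia.
  by move=> l /andP[li lj]; rewrite mnmBE mnmDE !mnm1E eq_sym (negbTE li) eq_sym (negbTE lj) addn0 subn0.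
rewrite /lap mcoeffD mcoeffZ raddf_sum /= raddf_sum /= mulrDl; congr (_ + _).
  rewrite -mulrA natr_sum mulr_suml; congr (_ * _); apply: eq_bigr => i _.
  by rewrite mcoeff_X2_mderiv2 mi.
(* The pair (i, j) contributes the part of smaller index. The i-th part is thus counted for each of
   the N - 1 - i later indices, in both orders. *)
transitivity (\sum_(i < N) \sum_(j < N | j != i) (nth 0%N la (minn i j))%:R * f@_(mnm_of N la)).
  apply: eq_bigr => i _; rewrite raddf_sum; apply: eq_bigr => j ji /=.
  move: (ji); rewrite -val_eqE neq_ltn => /orP[lt|lt].
    by rewrite (lap_quot_sym h) 1?eq_sym // Q // (minn_idPr (ltnW lt)).
  by rewrite Q // (minn_idPl (ltnW lt)).
transitivity ((\sum_(i < N) \sum_(j < N | j != i) nth 0 la (minn i j))%N%:R * f@_(mnm_of N la)).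
  rewrite natr_sum mulr_suml; apply: eq_bigr => i _.
  by rewrite natr_sum mulr_suml.
rewrite -natrM; congr (_%:R * _).
transitivity (\sum_(i < N) (\sum_(j < N | (j < i)%N) nth 0 la j + \sum_(j < N | (i < j)%N) nth 0 la i))%N.
  apply: eq_bigr => i _; rewrite (bigID (fun j : 'I_N => (j < i)%N)) /=; congr addn.
    apply: eq_big => [j|j /andP[_ lt]]; last by rewrite (minn_idPr (ltnW lt)).
    by rewrite -val_eqE neq_ltn; case: ltngtP.
  apply: eq_big => [j|j /andP[_]]; last by rewrite -leqNgt => le; rewrite (minn_idPl le).
  by rewrite -val_eqE neq_ltn; case: ltngtP.
rewrite big_split /= (exchange_big_dep predT) //= mul2n -addnn.
have E (i : 'I_N) : (\sum_(j < N | (i < j)%N) nth 0 la i = (N.-1 - i) * nth 0 la i)%N.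
  rewrite sum_nat_const; congr muln.
  have := cardC (fun j : 'I_N => (j <= i)%N); rewrite card_ord => e.
  have -> : #|[pred j : 'I_N | (i < j)%N]| = #|predC (fun j : 'I_N => (j <= i)%N)|.
    by apply: eq_card => j; rewrite !inE /= -ltnNge.
  have : #|(fun j : 'I_N => (j <= i)%N)| = i.+1.
    rewrite -sum1_card; transitivity (\sum_(j < i.+1) 1)%N.
      by rewrite (big_ord_widen N (fun _ => 1%N)) ?ltn_ord //; apply: eq_bigl.
    by rewrite sum_nat_const card_ord muln1.
  by move=> ci; rewrite ci in e; rewrite -[X in (X.-1 - _)%N]e addSn /= addKn.
by congr addn; apply: eq_bigr => i _; rewrite E.
Qed.

End Triangularity.

Lemma finite_choice (T : eqType) (U : Type) (u0 : U) (s : seq T) (P : T -> U -> Prop) :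
  (forall x, x \in s -> exists u, P x u) -> exists f, forall x, x \in s -> P x (f x).
Proof.
elim: s => [|a s IH] h; first by exists (fun _ => u0).
have [f hf] : exists f, forall x, x \in s -> P x (f x).
  by apply: IH => x xs; apply: h; rewrite in_cons xs orbT.
have [u hu] := h a (mem_head _ _).
exists (fun x => if x == a then u else f x) => x; rewrite in_cons.
by case: eqP => [->|_] //= /hf.
Qed.

Lemma sum_delta_seq (R : pzSemiRingType) (T : eqType) (s : seq T) (f : T -> R) (p : T) :
  uniq s -> \sum_(k <- s) f k * (p == k)%:R = if p \in s then f p else 0.
Proof.
move=> us; case: ifP => ps.
  rewrite (bigD1_seq p) //= eqxx mulr1 big1 ?addr0 // => k /negbTE kp.
  by rewrite eq_sym kp mulr0.
by rewrite big_seq big1 // => k ks; case: eqP => [e|_]; [rewrite e ks in ps | rewrite mulr0].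
Qed.

Lemma mcoeff_bigsum (n : nat) (R : nzRingType) (I : Type) (r : seq I) (P : pred I)
    (f : I -> {mpoly R[n]}) (m : 'X_{1..n}) :
  (\sum_(i <- r | P i) f i)@_m = \sum_(i <- r | P i) (f i)@_m.
Proof. exact: raddf_sum. Qed.

Lemma nstat_le la : is_partn la -> (nstat la <= sumn la * sumn la)%N.
Proof.
move=> pla; rewrite -[X in (_ <= X * _)%N]/(sumn la) {2}(_ : sumn la = \sum_(i < size la) nth 0 la i)%N.
  rewrite big_distrr /=; apply: leq_sum => i _; rewrite leq_mul2r.
  by rewrite (leq_trans (ltnW (ltn_ord i)) (size_partn pla)) orbT.
by rewrite sumnE (big_nth 0%N) big_mkord.
Qed.

(** Going down in dominance, n grows strictly while staying at most |la|^2 ([nstat_le]). *)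
Lemma dom_ind (P : seq nat -> Prop) :
  (forall la, is_partn la ->
    (forall mu, is_partn mu -> dominated mu la -> mu != la -> P mu) -> P la) ->
  forall la, is_partn la -> P la.
Proof.
move=> H la; have [e] := ubnP (sumn la * sumn la - nstat la)%N.
elim: e la => // e IH la; rewrite ltnS => le pla; apply: H => // mu pmu dm nml.
apply: IH => //; have [h1 h2] := dominated_nstat pmu pla dm.
move: h1; rewrite leq_eqVlt h2 (negbTE nml) /= (dominated_sumn dm) => h1.
by have := nstat_le pmu; rewrite (dominated_sumn dm); lia.
Qed.

Lemma dom_ind_up (P : seq nat -> Prop) :
  (forall la, is_partn la ->
    (forall mu, is_partn mu -> dominated la mu -> mu != la -> P mu) -> P la) ->
  forall la, is_partn la -> P la.
Proof.
move=> H la; have [e] := ubnP (nstat la).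
elim: e la => // e IH la; rewrite ltnS => le pla; apply: H => // mu pmu dm nml.
apply: IH => //; have [h1 h2] := dominated_nstat pla pmu dm.
by move: h1; rewrite leq_eqVlt h2 eq_sym (negbTE nml) /=; lia.
Qed.

Lemma partns_diag d la : (la \in partns d d) = is_partn la && (sumn la == d).
Proof.
rewrite mem_partns; case pla: (is_partn la) => //=.
by apply/andP/eqP => [[_ /eqP]|<-] //; rewrite size_partn.
Qed.

(** * Jack functions as eigenfunctions *)

Section Genericity.

Variables (F : fieldType) (al : F).

(* Any ordering of F in which al is positive provides this. *)
Definition positive_param : Prop := forall (T : finType) (z e : T -> nat) (w : T -> F),
  (forall t, 0 < z t)%N -> \sum_t (z t)%:R * al ^+ e t * w t ^+ 2 = 0 -> forall t, w t = 0.

Hypothesis Hpos : positive_param.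

Lemma pos_nat_neq0 k : k.+1%:R != 0 :> F.
Proof.
apply/eqP => h; suff /eqP : (1 : F) = 0 by rewrite oner_eq0.
apply: (@Hpos unit (fun _ => k.+1) (fun _ => 0%N) (fun _ => 1) _ _ tt) => //.
by rewrite big1 // => i _; rewrite h !mul0r.
Qed.

(** Hook factors, column factors and eigenvalue differences along dominance all have this form. *)
Lemma pos_lin_neq0 k l : (0 < k + l)%N -> al * k%:R + l%:R != 0.
Proof.
move=> kl; apply/eqP => h; suff /eqP : (1 : F) = 0 by rewrite oner_eq0.
case: (posnP k) => [k0|kn].
  move: h kl; rewrite k0 mulr0 add0r; case: l => // l /eqP.
  by rewrite (negbTE (pos_nat_neq0 l)).
case: (posnP l) => [l0|ln].
  apply: (@Hpos unit (fun _ => k) (fun _ => 1%N) (fun _ => 1) _ _ tt) => //.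
  by rewrite big1 // => i _; rewrite expr1 expr1n mulr1 mulrC -[RHS]h l0 addr0.
apply: (@Hpos bool (fun b => if b then k else l) (fun b => b : nat) (fun _ => 1) _ _ true).
  by case.
by rewrite big_bool /= !expr1n -[RHS]h; ring.
Qed.

Lemma pos_al_neq0 : al != 0.
Proof. by have := @pos_lin_neq0 1 0 isT; rewrite mulr1 addr0. Qed.

(** The weight [zw] is a positive integer times a power of alpha, so <g, g> has exactly the form
    treated by [positive_param]. *)
Lemma bp_definite M (g : {mpoly F[M]}) : bp al g g = 0 -> g = 0.
Proof.
move=> h; apply/mpolyP => m; rewrite mcoeff0; apply/eqP; apply: contraT => nz.
have lt : (mdeg m < msize g)%N by apply: msize_mdeg_lt; rewrite mcoeff_msupp.
have zE (m' : 'X_{1..M}) : zw al m' = (\prod_(i < M) (i.+1 ^ m' i * (m' i)`!))%N%:R * al ^+ mdeg m'.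
  rewrite /zw mdegE -prodrXr natr_prod -big_split; apply: eq_bigr => i _ /=.
  by rewrite exprMn natrM natrX mulrAC.
suff /eqP : g@_m = 0 by rewrite (negbTE nz).
apply: (Hpos (z := fun m' : 'X_{1..M < msize g} => (\prod_(i < M) (i.+1 ^ m' i * (m' i)`!))%N)
  (e := fun m' : 'X_{1..M < msize g} => mdeg m') (w := fun m' : 'X_{1..M < msize g} => g@_m')
  _ _ (BMultinom lt)).
  by move=> m'; apply: prodn_gt0 => i; rewrite muln_gt0 expn_gt0 fact_gt0.
rewrite -[RHS]h (bpwE _ _ (leqnn _)); apply: eq_bigr => m' _.
by rewrite zE expr2 mulrC.
Qed.

End Genericity.

Lemma mcoeff_monomial_sym (F : fieldType) mu N (m : 'X_{1..N}) : is_partn mu ->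
  (monomial_sym F mu N)@_m = (pt m == mu)%:R.
Proof.
move=> pmu; rewrite /monomial_sym.
rewrite (eq_bigl (fun m' : 'X_{1..N < (sumn mu).+1} => pt m' == mu)); last first.
  by move=> m'; rewrite pt_eq.
case: (ltnP (mdeg m) (sumn mu).+1) => lt.
  rewrite big_mkcond /= -(@mcoeff_mpoly _ _ (fun m' => (pt m' == mu)%:R) _ _ lt); congr (_@__).
  by apply: eq_bigr => m' _; case: ifP => _; rewrite ?scale1r ?scale0r.
rewrite raddf_sum big1 /= => [|m' _]; last first.
  by rewrite mcoeffX; case: eqP => // e; have := bmdeg m'; rewrite e ltnNge lt.
case: eqP => // e; move: lt; rewrite -sumn_mnm -(sumn_pt m) e; lia.
Qed.

(** * Monomial coefficients of the Jack functions *)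

Section JackCoefficients.

Variables (F : fieldType) (al : F) (J : seq nat -> symfun F).
Hypothesis J_jack : jack_family al J.

(** The coefficient of m_mu in J_la, read off in |mu| variables, which are enough for x^mu. *)
Definition jc (la mu : seq nat) : F := (J la (sumn mu))@_(mnm_of (sumn mu) mu).

Lemma jack_expansion la : is_partn la -> exists u : seq nat -> F,
  (forall N m, (J la N)@_m = if (sumn (pt m) == sumn la) && dominated (pt m) la then u (pt m) else 0)
  /\ u (nseq (sumn la) 1%N) = ((sumn la)`!)%:R.
Proof.
move=> pla; have [/(_ la pla) [u [hu u1]] _] := J_jack.
exists u; split=> // N m; rewrite hu raddf_sum /= -big_filter.
rewrite (eq_big_seq (fun mu => u mu * (pt m == mu)%:R)); last first.
  move=> mu; rewrite mem_filter partns_diag => /andP[_ /andP[pmu _]].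
  by rewrite mcoeffZ mcoeff_monomial_sym.
rewrite sum_delta_seq ?filter_uniq ?partns_uniq // mem_filter partns_diag is_partn_pt /=.
by rewrite andbC.
Qed.

Lemma jack_coefE la N m : is_partn la -> (J la N)@_m = jc la (pt m).
Proof.
move=> pla; have [u [hu _]] := jack_expansion pla.
by rewrite /jc !hu pt_mnm_of ?is_partn_pt // size_partn ?is_partn_pt.
Qed.

Lemma jc_dominated la mu : is_partn la -> is_partn mu -> jc la mu != 0 -> dominated mu la.
Proof.
move=> pla pmu; have [u [hu _]] := jack_expansion pla.
rewrite /jc hu pt_mnm_of ?size_partn //; case: ifP => [/andP[]//|].
by rewrite eqxx.
Qed.

Lemma jc_ones la : is_partn la -> jc la (nseq (sumn la) 1%N) = ((sumn la)`!)%:R.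
Proof.
move=> pla; have [u [hu u1]] := jack_expansion pla.
rewrite /jc hu pt_mnm_of ?size_partn ?is_partn_nseq1 //.
by rewrite sumn_nseq1 eqxx dominated_ones //= u1.
Qed.

Lemma jack_homog la N : is_partn la -> J la N \is (sumn la).-homog.
Proof.
move=> pla; apply/dhomogP => m; rewrite mcoeff_msupp jack_coefE // => nz.
by rewrite -(dominated_sumn (jc_dominated pla (is_partn_pt _) nz)) sumn_pt sumn_mnm.
Qed.

Lemma jack_eq0 la N : is_partn la -> (N < size la)%N -> J la N = 0.
Proof.
move=> pla lt; apply/mpolyP => m; rewrite mcoeff0 jack_coefE //; apply/eqP.
apply: contraT => /(jc_dominated pla (is_partn_pt _)) /(dominated_size (is_partn_pt _) pla).
by move=> h; have := leq_trans h (size_pt _); rewrite size_tuple leqNgt lt.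
Qed.

End JackCoefficients.

(* Lifts of the Jack functions of degree at most M to polynomials in the power sums. *)
Record jack_lift (F : fieldType) (al : F) (J : seq nat -> symfun F) (M : nat) := JackLift {
  lift_of :> seq nat -> {mpoly F[M]};
  lift_family : jack_family al J;
  lift_positive : positive_param al;
  lift_homog : forall la, is_partn la -> (sumn la <= M)%N ->
    lift_of la \is (sumn la).-homog for mnmwgt;
  lift_Phi : forall la N, is_partn la -> (sumn la <= M)%N -> Phi N (lift_of la) = J la N;
  lift_orth : forall la mu, is_partn la -> is_partn mu -> (sumn la <= M)%N ->
    (sumn mu <= M)%N -> la != mu -> bp al (lift_of la) (lift_of mu) = 0 }.

(** * Completeness of the Jack functions and their eigenvalues *)

Section JackModel.

Variables (F : fieldType) (al : F) (J : seq nat -> symfun F) (M : nat).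
Variable Jh : jack_lift al J M.

Local Notation jc := (jc J).
Local Notation bp := (bp al).

Let J_jack := lift_family Jh.
Let Hpos := lift_positive Jh.
Let Jh_homog := lift_homog Jh.
Let Jh_Phi := lift_Phi Jh.
Let Jh_orth := lift_orth Jh.
Let natF := pos_nat_neq0 Hpos.

(** A power-sum lift of m_la. The last clause says, by duality, that it lies in the span of the J_ka
    with ka <= la. *)
Definition is_monomial_lift la (g : {mpoly F[M]}) : Prop :=
  [/\ g \is (sumn la).-homog for mnmwgt,
      forall N m, (Phi N g)@_m = (pt m == la)%:R &
      forall h, (forall ka, is_partn ka -> dominated ka la -> bp (Jh ka) h = 0) -> bp g h = 0].

(** Subtracting the lifts of the lower monomials from J_la leaves [jc la la] times m_la. If this
    coefficient were 0, J_la would lie in the span of lower Jack functions, hence be orthogonal to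
    itself and 0 by definiteness, against the coefficient |la|! of m_(1^|la|). *)
Lemma monomial_lift la : is_partn la -> (sumn la <= M)%N ->
  jc la la != 0 /\ exists g, is_monomial_lift la g.
Proof.
move: la; apply: dom_ind => la pla IH lM.
pose L := [seq ka <- partns (sumn la) (sumn la) | dominated ka la && (ka != la)].
have [G hG] : exists G : seq nat -> {mpoly F[M]}, forall ka, ka \in L -> is_monomial_lift ka (G ka).
  apply: (finite_choice 0 (P := is_monomial_lift)) => ka; rewrite mem_filter partns_diag => /andP[/andP[dk nk] /andP[pk /eqP sk]].
  by have [|_ //] := IH ka pk dk nk; rewrite sk.
have hL ka : ka \in L -> sumn ka = sumn la.
  by rewrite mem_filter partns_diag => /andP[_ /andP[_ /eqP]].
pose w := Jh la - \sum_(ka <- L) jc la ka *: G ka.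
have w_homog : w \is (sumn la).-homog for mnmwgt.
  rewrite rpredB ?Jh_homog // big_seq rpred_sum // => ka kL; have [h _ _] := hG ka kL.
  by rewrite rpredZ // -(hL ka kL).
have w_coef N m : (Phi N w)@_m = jc la la * (pt m == la)%:R.
  rewrite PhiB mcoeffB Jh_Phi // (jack_coefE J_jack) // Phi_sum mcoeff_bigsum.
  rewrite (eq_big_seq (fun ka => jc la ka * (pt m == ka)%:R)); last first.
    by move=> ka /hG[_ h _]; rewrite PhiZ mcoeffZ h.
  rewrite sum_delta_seq ?filter_uniq ?partns_uniq // mem_filter partns_diag is_partn_pt /=.
  case: (eqVneq (pt m) la) => [->|ne]; first by rewrite andbF subr0 mulr1.
  rewrite mulr0 andbT; case: ifP => h; first by rewrite subrr.
  rewrite subr0; apply/eqP; apply: contraFT h => nz.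
  have dm := jc_dominated J_jack pla (is_partn_pt _) nz.
  by rewrite dm (dominated_sumn dm) eqxx.
have vn0 : jc la la != 0.
  apply/eqP => v0; have w0 : w = 0.
    apply: (Phi_inj natF); apply/mpolyP => m; rewrite mcoeff0 w_coef v0 mul0r //.
  have eJ : Jh la = \sum_(ka <- L) jc la ka *: G ka by apply/eqP; rewrite -subr_eq0 -/w w0.
  have : bp (Jh la) (Jh la) = 0.
    rewrite {1}eJ bp_suml big_seq big1 // => ka kL; rewrite bpZl.
    have [_ _ ->] := hG ka kL; first by rewrite mulr0.
    move: kL; rewrite mem_filter partns_diag => /andP[/andP[dk nk] /andP[pk /eqP sk]] nu pn dn.
    have dl := dominated_trans dk dn.
    apply: Jh_orth => //; first by rewrite (dominated_sumn dl).
    apply: contra nk => /eqP e; rewrite e in dn.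
    by rewrite (dominated_anti pk pla dk dn).
  move/(bp_definite Hpos) => J0; have := jc_ones J_jack pla.
  have := jack_coefE J_jack (mnm_of (sumn la) (nseq (sumn la) 1%N)) pla.
  rewrite -(Jh_Phi _ pla lM) J0 Phi0 mcoeff0 pt_mnm_of ?is_partn_nseq1 ?size_nseq //.
  move=> <- /esym/eqP; have := fact_gt0 (sumn la); case: (_`!) => // k _.
  by rewrite (negbTE (natF k)).
split=> //; exists ((jc la la)^-1 *: w); split.
- by rewrite rpredZ.
- by move=> N m; rewrite PhiZ mcoeffZ w_coef mulKf.
- move=> h hh; rewrite bpZl /w bpBl hh ?dominated_refl // bp_suml big_seq big1 ?subr0 ?mulr0 //.
  move=> ka kL; rewrite bpZl; have [_ _ ->] := hG ka kL; first by rewrite mulr0.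
  move: kL; rewrite mem_filter => /andP[/andP[dk _] _] nu pn dn.
  exact: hh (dominated_trans dk dn).
Qed.

Lemma jc_diag_neq0 la : is_partn la -> (sumn la <= M)%N -> jc la la != 0.
Proof. by move=> pla lM; have [] := monomial_lift pla lM. Qed.

(** A symmetric polynomial in M variables is determined by its coefficients at partitions, so g is a
    combination of lifts of the m_ka. These lie in the span of the Jack functions, hence g is
    orthogonal to itself. *)
Lemma Jh_complete d g : (d <= M)%N -> g \is d.-homog for mnmwgt ->
  (forall ka, ka \in partns d d -> bp (Jh ka) g = 0) -> g = 0.
Proof.
move=> dM hg orth; apply: (bp_definite Hpos).
have [G hG] : exists G : seq nat -> {mpoly F[M]}, forall ka, ka \in partns d d -> is_monomial_lift ka (G ka).
  apply: (finite_choice 0 (P := is_monomial_lift)) => ka; rewrite partns_diag => /andP[pk /eqP sk].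
  by have [|_ //] := monomial_lift pk; rewrite sk.
have eg : g = \sum_(ka <- partns d d) (Phi M g)@_(mnm_of M ka) *: G ka.
  apply/eqP; rewrite -subr_eq0; apply/eqP/(Phi_inj natF)/mpolyP => m.
  rewrite mcoeff0 PhiB mcoeffB Phi_sum mcoeff_bigsum.
  rewrite (eq_big_seq (fun ka => (Phi M g)@_(mnm_of M ka) * (pt m == ka)%:R)); last first.
    by move=> ka /hG[_ h _]; rewrite PhiZ mcoeffZ h.
  rewrite sum_delta_seq ?partns_uniq // partns_diag is_partn_pt /= sumn_pt sumn_mnm.
  case: eqP => [dm|/eqP dm]; last by rewrite subr0 (dhomog_nemf_coeff (Phi_homog M hg)).
  rewrite (sym_coeff (Phi_sym M g) (m' := m)) ?subrr //.
  by rewrite pt_mnm_of ?is_partn_pt // (leq_trans (size_pt _)) // size_tuple.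
rewrite {1}eg bp_suml big_seq big1 // => ka kL; rewrite bpZl; have [_ _ ->] := hG ka kL.
  by rewrite mulr0.
move=> nu pn dn; apply: orth; rewrite partns_diag pn (dominated_sumn dn).
by move: kL; rewrite partns_diag => /andP[].
Qed.

Definition nrm (la : seq nat) : F := bp (Jh la) (Jh la).

Lemma nrm_neq0 la : is_partn la -> (sumn la <= M)%N -> nrm la != 0.
Proof.
move=> pla lM; apply/eqP => /(bp_definite Hpos) J0; have := jc_diag_neq0 pla lM.
have := jack_coefE J_jack (mnm_of (size la) la) pla.
by rewrite -Jh_Phi // J0 Phi0 mcoeff0 pt_mnm_of // => <-; rewrite eqxx.
Qed.

Definition jcoord (g : {mpoly F[M]}) (la : seq nat) : F := bp g (Jh la) / nrm la.

Lemma sum_nth_size (f : nat -> nat -> nat) (s : seq nat) (N : nat) :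
  (forall i, f i 0 = 0)%N -> (size s <= N)%N ->
  (\sum_(i < N) f i (nth 0 s i) = \sum_(i < size s) f i (nth 0 s i))%N.
Proof.
move=> f0 sN; rewrite [RHS](big_ord_widen N (fun i => f i (nth 0%N s i))) // [RHS]big_mkcond.
by apply: eq_bigr => i _; case: ltnP => // h; rewrite nth_default.
Qed.

Lemma jcoord_expand d g : (d <= M)%N -> g \is d.-homog for mnmwgt ->
  g = \sum_(ka <- partns d d) jcoord g ka *: Jh ka.
Proof.
move=> dM hg; apply/eqP; rewrite -subr_eq0; apply/eqP/(@Jh_complete d) => //.
  rewrite rpredB // big_seq rpred_sum // => ka; rewrite partns_diag => /andP[pk /eqP sk].
  by rewrite rpredZ // -sk Jh_homog // sk.
move=> ka; rewrite partns_diag => /andP[pk /eqP sk].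
rewrite bpC bpBl bp_suml (bigD1_seq ka) ?partns_uniq ?partns_diag ?pk ?sk //=.
rewrite bpZl -/(nrm ka) /jcoord divfK ?nrm_neq0 ?sk // big_seq_cond big1 ?addr0 ?subrr //.
move=> mu /andP[]; rewrite partns_diag => /andP[pm /eqP sm] ne.
by rewrite bpZl Jh_orth ?mulr0 ?sm ?sk.
Qed.

(** A maximal index with nonzero coefficient is found above ka; any other J_la containing its
    monomial has a larger index and so coefficient 0. Going up in dominance does not increase the
    length, so the bound n persists. *)
Lemma jack_top_coef d n (x : seq nat -> F) ka : (d <= M)%N ->
  ka \in partns d d -> (size ka <= n)%N -> x ka != 0 ->
  exists mu, [/\ is_partn mu, (size mu <= n)%N, dominated ka mu &
    (\sum_(la <- partns d d) x la *: J la n)@_(mnm_of n mu) != 0].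
Proof.
move=> dM kL; have pk : is_partn ka by move: kL; rewrite partns_diag => /andP[].
move: ka pk kL; apply: dom_ind_up => ka pk IH kL sn xn0.
have sk : sumn ka = d by move: kL; rewrite partns_diag pk => /eqP.
case: (boolP (has (fun mu => [&& dominated ka mu, mu != ka, (size mu <= n)%N & x mu != 0]) (partns d d))).
  case/hasP => mu mL /and4P[dm ne sm xm]; have pm : is_partn mu by move: mL; rewrite partns_diag => /andP[].
  have [nu [pn sz dn h]] := IH mu pm dm ne mL sm xm.
  by exists nu; split=> //; exact: dominated_trans dn dm.
move/hasPn => none; exists ka; split=> //; first exact: dominated_refl.
rewrite mcoeff_bigsum (bigD1_seq ka) ?partns_uniq //= mcoeffZ (jack_coefE J_jack) // pt_mnm_of //.
rewrite big_seq_cond big1 ?addr0; first by rewrite mulf_neq0 // jc_diag_neq0 // sk.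
move=> mu /andP[mL ne]; have pm : is_partn mu by move: mL; rewrite partns_diag => /andP[].
rewrite mcoeffZ (jack_coefE J_jack) // pt_mnm_of //; apply/eqP; rewrite mulf_eq0; apply: contraT.
rewrite negb_or => /andP[xm jm]; have := none mu mL.
have dm := jc_dominated J_jack pm pk jm.
by rewrite dm ne xm (leq_trans (dominated_size pk pm dm) sn).
Qed.

Lemma jack_indep d n (x : seq nat -> F) ka : (d <= M)%N ->
  \sum_(la <- partns d d) x la *: J la n = 0 ->
  ka \in partns d d -> (size ka <= n)%N -> x ka = 0.
Proof.
move=> dM h kL sk; apply/eqP; apply: contraT => nz.
have [mu [_ _ _]] := jack_top_coef dM kL sk nz.
by rewrite h mcoeff0 eqxx.
Qed.

(** This is 2 (alpha n(la') - n(la)), because sum la_i (la_i - 1) = 2 n(la'). *)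
Definition eigen2 (la : seq nat) : F :=
  al * (\sum_(i < size la) nth 0 la i * (nth 0 la i).-1)%N%:R - 2%:R * (nstat la)%:R.

Lemma D2_Jh la : is_partn la -> (sumn la <= M)%N -> D2 al (Jh la) = eigen2 la *: Jh la.
Proof.
move=> pla lM; set d := sumn la.
(* Triangularity, known for monomials, is moved to Jack coordinates: above a nonzero coordinate mu
   lies some nu whose monomial is visible in D2 J_ka. *)
have dom ka mu : is_partn ka -> is_partn mu -> sumn ka = d -> sumn mu = d ->
    bp (D2 al (Jh ka)) (Jh mu) != 0 -> dominated mu ka.
  move=> pk pm sk sm nz; have kM : (sumn ka <= M)%N by rewrite sk.
  have hom : D2 al (Jh ka) \is d.-homog for mnmwgt by rewrite D2_homog // -sk Jh_homog.
  have e := jcoord_expand lM hom.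
  have cn0 : jcoord (D2 al (Jh ka)) mu != 0 by rewrite mulf_neq0 ?invr_neq0 ?nrm_neq0 ?sm.
  have mL : mu \in partns d d by rewrite partns_diag pm sm eqxx.
  have smM : (size mu <= M)%N by rewrite (leq_trans (size_partn pm)) ?sm.
  have [nu [pn sn dn h]] := jack_top_coef lM mL smM cn0.
  apply: (dominated_trans _ dn).
  have hq := @ps_quotP F M M (Jh ka); have hJ := Jh_homog pk kM.
  have : (lap al (Phi M (Jh ka)) (ps_quot (Jh ka)))@_(mnm_of M nu) != 0 \/
         (Phi M (Jh ka))@_(mnm_of M nu) != 0.
    rewrite (lap_Phi _ _ hJ kM) mcoeffD mcoeffZ.
    case: (eqVneq (Phi M (Jh ka))@_(mnm_of M nu) 0) => [->|]; last by right.
    left; rewrite mulr0 addr0 e Phi_sum; apply: contra h => /eqP <-; apply/eqP.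
    congr (_@__); apply: eq_big_seq => xi; rewrite partns_diag => /andP[px /eqP sx].
    by rewrite PhiZ Jh_Phi ?sx.
  rewrite Jh_Phi //; case=> [|nz']; last first.
    apply: (jc_dominated J_jack) => //; move: nz'.
    by rewrite (jack_coefE J_jack) // pt_mnm_of.
  rewrite Jh_Phi // in hq *; case/(lap_triangular hq) => m' [nz' dm' ex].
  have dk : dominated (pt m') ka.
    by apply: (jc_dominated J_jack) => //; rewrite ?is_partn_pt // -(jack_coefE J_jack).
  apply: (dominated_trans dk); apply/dominatedP; rewrite ?is_partn_pt //; split.
    by rewrite sumn_pt sumn_mnm dm' mdeg_mnm_of.
  by move=> k; rewrite excess_pt -(pt_mnm_of pn sn) excess_pt.
have hom : D2 al (Jh la) \is d.-homog for mnmwgt by rewrite D2_homog // Jh_homog.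
have laL : la \in partns d d by rewrite partns_diag pla eqxx.
have eE : D2 al (Jh la) = jcoord (D2 al (Jh la)) la *: Jh la.
  rewrite {1}(jcoord_expand lM hom) (bigD1_seq la) ?partns_uniq //= big_seq_cond big1 ?addr0 //.
  move=> ka /andP[]; rewrite partns_diag => /andP[pk /eqP sk] ne.
  rewrite /jcoord; case: (eqVneq (bp (D2 al (Jh la)) (Jh ka)) 0) => [->|nz].
    by rewrite mul0r scale0r.
  have d1 := dom _ _ pla pk erefl sk nz.
  rewrite D2_self_adjoint bpC in nz; have d2 := dom _ _ pk pla sk erefl nz.
  by rewrite (dominated_anti pk pla d1 d2) eqxx in ne.
move: eE; set x := jcoord _ _ => eE; rewrite eE; congr (_ *: _).
have sM : (size la <= M)%N by rewrite (leq_trans (size_partn pla)).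
have := @lap_lead F al M (Phi M (Jh la)) _ la pla sM (ps_quotP (Jh la)) _.
rewrite (lap_Phi _ _ (Jh_homog pla lM) lM) eE PhiZ mcoeffD !mcoeffZ Jh_Phi // => H.
have {H} : _ := H _; rewrite !(jack_coefE J_jack) // pt_mnm_of // -mulrDl => H.
have sup m' : (J la M)@_m' != 0 -> mdeg m' = sumn la ->
    forall k, (excess k m' <= excess k la)%N.
  rewrite (jack_coefE J_jack) // => nz _ k.
  have /(dominatedP (is_partn_pt _) pla)[_ /(_ k)] := jc_dominated J_jack pla (is_partn_pt _) nz.
  by rewrite excess_pt.
move: (mulIf (jc_diag_neq0 pla lM) (H sup)) => {H sup}.
have -> : (\sum_(i < M) nth 0 la i * (nth 0 la i).-1 =
           \sum_(i < size la) nth 0 la i * (nth 0 la i).-1)%N.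
  by apply: (sum_nth_size (f := fun _ a => a * a.-1)%N).
(* The contributions depending on M in [lap_lead] and in [lap_Phi] differ by 2 n(la), which is how
   the second term of [eigen2] arises. *)
have eB : ((\sum_(i < M) (M.-1 - i) * nth 0 la i) + nstat la = M.-1 * d)%N.
  rewrite /nstat -(@sum_nth_size (fun i a => i * a)%N la M) // => [|i]; last by rewrite muln0.
  have -> : d = (\sum_(i < M) nth 0 la i)%N.
    by rewrite (@sum_nth_size (fun _ a => a) la M) // /d sumnE (big_nth 0%N) big_mkord.
  rewrite big_distrr -big_split /=; apply: eq_bigr => i _.
  by rewrite -mulnDl; congr muln; have := ltn_ord i; lia.
have -> : 2%:R * (M%:R - 1) * (sumn la)%:R = 2%:R * (M.-1 * d)%N%:R :> F.
  rewrite -mulrA natrM; congr (_ * _); case: (posnP M) => M0.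
    have -> : d = 0%N by apply/eqP; rewrite -leqn0 -M0.
    have -> : sumn la = 0%N by apply/eqP; rewrite -leqn0 -M0.
    by rewrite !mulr0.
  by rewrite -{1}(prednK M0) -natr1 addrK.
rewrite -eB natrD /eigen2 => /eqP; rewrite -subr_eq0 => /eqP H.
apply/eqP; rewrite -subr_eq0; apply/eqP; rewrite -[RHS]H; ring.
Qed.

End JackModel.

(** * Column removal and Pieri coefficients *)

Definition addcol (n : nat) (nu : seq nat) : seq nat := mkseq (fun i => (nth 0 nu i).+1)%N n.

Definition rmcol (la : seq nat) : seq nat := [seq r <- map predn la | (0 < r)%N].

Lemma nth_filter_pos s i : sorted geq s -> nth 0%N [seq r <- s | (0 < r)%N] i = nth 0%N s i.
Proof.
elim: s i => //= a s IH i srt; case: (posnP a) => a0; last first.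
  by case: i => //= i; rewrite IH // (path_sorted srt).
have z : all (pred1 0%N) s.
  apply/allP => x xs; have /allP /(_ _ xs) /= := order_path_min geq_trans_nat srt.
  by rewrite a0 leqn0.
have -> : [seq r <- s | (0 < r)%N] = [::].
  apply/eqP; rewrite -size_eq0 size_filter -leqn0 leqNgt -has_count -all_predC.
  by apply/allP => x /(allP z) /eqP ->.
rewrite nth_nil a0 (all_pred1P _ _ z); case: i => //= i.
by rewrite nth_nseq if_same.
Qed.

Lemma partn_nth_eq la mu : is_partn la -> is_partn mu ->
  (forall i, nth 0%N la i = nth 0%N mu i) -> la = mu.
Proof.
have S0 (s t : seq nat) : (forall i, nth 0%N s i = nth 0%N t i) -> 0%N \notin s ->
    (size s <= size t)%N.
  move=> e n0; rewrite leqNgt; apply/negP => lt; case/negP: n0.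
  by rewrite -(nth_default 0%N (leqnn (size t))) -e mem_nth.
case/andP=> _ n1 /andP[_ n2] e; apply: (@eq_from_nth _ 0%N) => [|i _]; last exact: e.
by apply/eqP; rewrite eqn_leq !S0.
Qed.

Lemma partn_nth_gt0 la i : is_partn la -> (0 < nth 0%N la i)%N = (i < size la)%N.
Proof.
case/andP=> _ n0; case: (ltnP i (size la)) => h; last by rewrite nth_default.
by rewrite lt0n; apply: contra n0 => /eqP <-; exact: mem_nth.
Qed.

Lemma partn_nth_anti la i j : is_partn la -> (i <= j)%N -> (nth 0%N la j <= nth 0%N la i)%N.
Proof.
case/andP=> srt _ ij; case: (ltnP j (size la)) => hj; last by rewrite nth_default.
by have := sorted_leq_nth geq_trans_nat leqnn 0%N srt i j (leq_ltn_trans ij hj) hj ij.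
Qed.

Lemma nth_addcol n nu i : nth 0%N (addcol n nu) i = if (i < n)%N then (nth 0 nu i).+1%N else 0%N.
Proof. by case: ltnP => h; [rewrite nth_mkseq | rewrite nth_default ?size_mkseq]. Qed.

Lemma size_addcol n nu : size (addcol n nu) = n.
Proof. exact: size_mkseq. Qed.

Lemma is_partn_addcol n nu : is_partn nu -> is_partn (addcol n nu).
Proof.
move=> pn; apply/andP; split; last by apply/negP => /mapP[].
apply: (@path_sorted _ _ (nth 0%N nu 0).+1); apply/(pathP 0%N) => i; rewrite size_addcol => hi.
case: i hi => [|i] hi /=; first by rewrite nth_addcol hi ltnS partn_nth_anti.
by rewrite !nth_addcol hi (ltnW hi) ltnS partn_nth_anti.
Qed.

Lemma sumn_nth n (s : seq nat) : (size s <= n)%N -> sumn s = (\sum_(i < n) nth 0 s i)%N.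
Proof.
move=> h; rewrite sumnE (big_nth 0%N) big_mkord (big_ord_widen n (fun i => nth 0%N s i)) //.
by rewrite big_mkcond; apply: eq_bigr => i _; case: ltnP => // hi; rewrite nth_default.
Qed.

Lemma sumn_addcol n nu : (size nu <= n)%N -> sumn (addcol n nu) = (sumn nu + n)%N.
Proof.
move=> h; rewrite (@sumn_nth n) ?size_addcol // (sumn_nth h).
under eq_bigr => i _ do rewrite nth_addcol ltn_ord -addn1.
by rewrite big_split /= sum_nat_const card_ord muln1.
Qed.

Lemma sorted_predn la : sorted geq la -> sorted geq (map predn la).
Proof.
case: la => //= a s; elim: s a => //= b s IH a /andP[h /IH ->]; rewrite andbT.
by rewrite -!subn1 leq_sub2r.
Qed.

Lemma rmcol_nth la i : is_partn la -> nth 0%N (rmcol la) i = (nth 0%N la i).-1.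
Proof.
case/andP=> srt _; rewrite nth_filter_pos.
  by case: (ltnP i (size la)) => h; [rewrite (nth_map 0%N) | rewrite !nth_default ?size_map].
exact: sorted_predn.
Qed.

Lemma is_partn_rmcol la : is_partn la -> is_partn (rmcol la).
Proof.
case/andP=> srt _; apply/andP; split; last by rewrite mem_filter.
exact/(sorted_filter geq_trans_nat)/sorted_predn.
Qed.

Lemma size_rmcol la : (size (rmcol la) <= size la)%N.
Proof. by rewrite size_filter (leq_trans (count_size _ _)) // size_map. Qed.

Lemma rmcolK la : is_partn la -> addcol (size la) (rmcol la) = la.
Proof.
move=> pl; apply: partn_nth_eq => // [|i]; first exact/is_partn_addcol/is_partn_rmcol.
rewrite nth_addcol rmcol_nth //; case: ltnP => h; last by rewrite nth_default.
by rewrite prednK // partn_nth_gt0.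
Qed.

Lemma addcolK n nu : is_partn nu -> (size nu <= n)%N -> rmcol (addcol n nu) = nu.
Proof.
move=> pn sn; apply: partn_nth_eq => // [|i]; first exact/is_partn_rmcol/is_partn_addcol.
rewrite rmcol_nth ?is_partn_addcol // nth_addcol; case: ltnP => //= h.
by rewrite nth_default // (leq_trans sn).
Qed.

(** Rows are numbered from 0. Parts are read with default 0, so that a box opening a new row is no
    special case. *)
Definition boxadd (i : nat) (ka mu : seq nat) : Prop :=
  forall j, nth 0%N mu j = (nth 0%N ka j + (j == i))%N.

Lemma boxadd_addcol n i ka mu : is_partn ka -> is_partn mu -> (size mu <= n)%N ->
  boxadd i ka mu -> boxadd i (addcol n ka) (addcol n mu).
Proof.
move=> pk pm sm h j; rewrite !nth_addcol; case: ltnP => hj; first by rewrite h addSn.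
have := h i; rewrite eqxx addn1; case: eqP => // <-.
by rewrite nth_default // (leq_trans sm hj).
Qed.

Lemma boxadd_lastrow k nu : is_partn nu -> (size nu <= k)%N ->
  boxadd k (addcol k nu) (addcol k.+1 nu).
Proof.
move=> pn sn j; rewrite !nth_addcol ltnS leq_eqVlt; case: eqP => [->|_] /=.
  by rewrite ltnn nth_default.
by case: ifP; rewrite addn0.
Qed.

Lemma map_addcol_partns n d :
  perm_eq [seq addcol n nu | nu <- partns d d & (size nu <= n)%N]
          [seq mu <- partns (d + n) (d + n) | size mu == n].
Proof.
apply: uniq_perm; first rewrite map_inj_in_uniq ?filter_uniq ?partns_uniq //.
- move=> nu nu'; rewrite !mem_filter !partns_diag => /and3P[s1 p1 _] /and3P[s2 p2 _] e.
  by rewrite -(addcolK p1 s1) e addcolK.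
- by rewrite filter_uniq ?partns_uniq.
move=> mu; rewrite mem_filter partns_diag; apply/mapP/and3P => [[nu]|[/eqP sz pm /eqP sm]].
  rewrite mem_filter partns_diag => /and3P[sn pn /eqP dn] ->.
  by rewrite size_addcol eqxx is_partn_addcol // sumn_addcol // dn.
exists (rmcol mu); last by rewrite -[in addcol _]sz rmcolK.
have sr : (size (rmcol mu) <= n)%N by rewrite -sz size_rmcol.
rewrite mem_filter sr partns_diag is_partn_rmcol //=; apply/eqP/(@addIn n).
by rewrite -sm -sumn_addcol // -[in addcol _]sz rmcolK.
Qed.

(** * Removing the first column in n = length(la) variables *)

Section ColumnRemoval.

Variables (F : fieldType) (al : F) (J : seq nat -> symfun F) (M : nat).
Variable Jh : jack_lift al J M.

Local Notation jc := (jc J).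
Local Notation eigen2 := (eigen2 al).

Let J_jack := lift_family Jh.
Let Hpos := lift_positive Jh.
Let natF := pos_nat_neq0 Hpos.

(** Writes the alpha-part of the eigenvalue by excesses, so that dominance makes it monotone; the
    source is a (a - 1) = 2 sum_(k >= 1) (a - k)^+. *)
Lemma excess_sq (s : seq nat) D : (forall r, r \in s -> r <= D)%N ->
  (sumn [seq r * r.-1 | r <- s] = (\sum_(k < D) excess k.+1 s).*2)%N.
Proof.
have T a : (a * a.-1 = (\sum_(k < a) (a - k.+1)).*2)%N.
  elim: a => [|a IH]; first by rewrite big_ord0.
  rewrite big_ord_recl subn1 doubleD /=.
  rewrite (eq_bigr (fun k : 'I_a => a - k.+1)%N) => [|k _]; last by rewrite /bump /= add1n subSS.
  by rewrite -IH; case: a {IH} => // a; rewrite /=; lia.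
elim: s => [|a s IH] h /=; first by rewrite big1.
rewrite IH; last by move=> r rs; apply: h; rewrite in_cons rs orbT.
rewrite /excess /= big_split /= doubleD T; congr (_.*2 + _)%N.
rewrite (big_ord_widen D (fun k => a - k.+1)%N); last by apply: h; rewrite mem_head.
rewrite big_mkcond; apply: eq_bigr => k _; case: ltnP => //; lia.
Qed.

(** Along dominance both terms of the eigenvalue move in the same direction, so the difference is
    alpha k + 2 l with k, l >= 0, and l > 0 for distinct partitions. Comparability matters: (4,1,1)
    and (3,3) have the same eigenvalue. *)
Lemma eigen2_inj ka la : is_partn ka -> is_partn la -> dominated ka la ->
  eigen2 ka = eigen2 la -> ka = la.
Proof.
move=> pk pl dm; have [n1 n2] := dominated_nstat pk pl dm.
have sq (s : seq nat) : (\sum_(i < size s) nth 0 s i * (nth 0 s i).-1 = sumn [seq r * r.-1 | r <- s])%N.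
  by rewrite sumnE big_map (big_nth 0%N) big_mkord.
rewrite /eigen2 !sq !(@excess_sq _ (sumn la)).
- set A := (\sum_(k < _) excess _ ka).*2; set B := (\sum_(k < _) excess _ la).*2.
  have AB : (A <= B)%N.
    rewrite leq_double; apply: leq_sum => k _.
    by have /(dominatedP pk pl)[_ ] := dm; apply.
  move=> e; apply/eqP; rewrite -n2 eqn_leq n1 /=.
  rewrite leqNgt; apply/negP => lt.
  have kl : (0 < (B - A) + 2 * (nstat ka - nstat la))%N by lia.
  case/eqP: (pos_lin_neq0 Hpos kl).
  rewrite natrB // natrM natrB ?(ltnW lt) //.
  move/eqP: e; rewrite eq_sym -subr_eq0 => /eqP e; rewrite -[RHS]e; ring.
- by move=> r rl; rewrite sumnE (big_rem r) //= leq_addr.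
- by move=> r rl; rewrite -(dominated_sumn dm) sumnE (big_rem r) //= leq_addr.
Qed.

Lemma jack_ones n : J (nseq n 1%N) n = (n`!)%:R *: en F n.
Proof.
apply/mpolyP => m; rewrite (jack_coefE J_jack) ?is_partn_nseq1 // mcoeffZ mcoeffX.
have e1 : pt (mone n) = nseq n 1%N.
  have -> : mone n = mnm_of n (nseq n 1%N).
    by apply/mnmP => i; rewrite !mnmE nth_nseq ltn_ord.
  by rewrite pt_mnm_of ?is_partn_nseq1 // size_nseq.
have jo : jc (nseq n 1%N) (nseq n 1%N) = (n`!)%:R.
  by have := jc_ones J_jack (is_partn_nseq1 n); rewrite sumn_nseq1.
case: eqP => [<-|ne]; first by rewrite e1 jo mulr1.
rewrite mulr0; apply/eqP; apply: contraT => nz; exfalso; apply: ne.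
have := dominated_ones_eq (is_partn_pt _) (jc_dominated J_jack (is_partn_nseq1 n) (is_partn_pt _) nz).
move=> em; apply/mnmP => i; rewrite mnmE.
have : all (fun r => 0 < r)%N m.
  by rewrite all_count -size_filter -(perm_size (perm_pt m)) em size_nseq size_tuple.
move=> al1; have : m i \in pt m.
  by rewrite (perm_mem (perm_pt m)) (all_filterP al1) mnm_tnth mem_tnth.
by rewrite em mem_nseq => /andP[_ /eqP].
Qed.

Lemma mnm_of_addcol n nu : mnm_of n (addcol n nu) = (mone n + mnm_of n nu)%MM.
Proof. by apply/mnmP => i; rewrite mnmDE !mnmE nth_addcol ltn_ord. Qed.

Lemma dominated_addcol n nu (m : 'X_{1..n}) : is_partn nu -> (size nu <= n)%N ->
  dominated (pt m) nu -> dominated (pt (mone n + m)%MM) (addcol n nu).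
Proof.
move=> pn sn /(dominatedP (is_partn_pt _) pn)[sz ex].
apply/dominatedP; rewrite ?is_partn_pt ?is_partn_addcol //.
have eE k : excess k (addcol n nu) = excess k (mone n + mnm_of n nu)%MM.
  by rewrite -mnm_of_addcol -{1}(@pt_mnm_of n (addcol n nu)) ?excess_pt ?is_partn_addcol ?size_addcol.
have md : mdeg (mone n) = n.
  rewrite mdegE (eq_bigr (fun _ => 1%N)) ?sum_nat_const ?card_ord ?muln1 // => i _.
  by rewrite mnmE.
split=> [|k].
  by rewrite sumn_pt sumn_mnm mdegD md sumn_addcol // -sz sumn_pt sumn_mnm addnC.
rewrite excess_pt eE; have := ex k.-1.
have eN l : excess l nu = excess l (mnm_of n nu) by rewrite -{1}(pt_mnm_of pn sn) excess_pt.
rewrite excess_pt eN !excessE => le.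
case: k le => [|k] le.
  rewrite (eq_bigr (fun i => (1 + (m i - 0))%N)) => [|i _]; last by rewrite mnmDE mnmE !subn0.
  rewrite [X in (_ <= X)%N](eq_bigr (fun i => (1 + (mnm_of n nu i - 0))%N)) => [|i _].
    by rewrite !big_split leq_add2l.
  by rewrite mnmDE mnmE !subn0.
rewrite (eq_bigr (fun i => m i - k)%N) => [|i _]; last by rewrite mnmDE mnmE subSS.
rewrite [X in (_ <= X)%N](eq_bigr (fun i => mnm_of n nu i - k)%N) // => i _.
by rewrite mnmDE mnmE subSS.
Qed.

Lemma eigen2_addcol n nu : (size nu <= n)%N ->
  eigen2 (addcol n nu) = eigen2 nu + al *+ 2 * (sumn nu)%:R - (n * n.-1)%:R.
Proof.
move=> sn; rewrite /eigen2 size_addcol.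
rewrite -(@sum_nth_size (fun _ a => a * a.-1)%N nu n) //.
have -> : (\sum_(i < n) nth 0 (addcol n nu) i * (nth 0 (addcol n nu) i).-1 =
    \sum_(i < n) nth 0 nu i * (nth 0 nu i).-1 + sumn nu * 2)%N.
  rewrite (sumn_nth sn) big_distrl -big_split; apply: eq_bigr => i _ /=.
  by rewrite nth_addcol ltn_ord; case: (nth 0%N nu i) => //= a; lia.
have e2 : (2 * nstat (addcol n nu) = 2 * nstat nu + n * n.-1)%N.
  rewrite /nstat size_addcol -(@sum_nth_size (fun i a => i * a)%N nu n) => [|i|] //; last by rewrite muln0.
  have -> : (n * n.-1 = 2 * (\sum_(i < n) i))%N.
    elim: (n) => [|k IH]; first by rewrite big_ord0.
    by rewrite big_ord_recr mulnDr -IH; case: k {IH} => //= k; lia.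
  rewrite -mulnDr -big_split; congr muln; apply: eq_bigr => i _ /=.
  by rewrite nth_addcol ltn_ord mulnS addnC.
rewrite -natrM e2 !natrD !natrM -mulr_natl; ring.
Qed.

(** By [lap_en] and [eigen2_addcol], e_n J_nu is an eigenfunction in n variables with the eigenvalue
    of la. Its Jack components therefore share this eigenvalue; they also lie below la in dominance,
    where [eigen2_inj] leaves la alone. *)
Lemma column_removal n nu : is_partn nu -> (size nu <= n)%N -> (sumn nu + n <= M)%N ->
  exists2 h, h != 0 & J (addcol n nu) n = h *: (en F n * J nu n).
Proof.
move=> pn sn dM; set la := addcol n nu; set d := (sumn nu + n)%N in dM *.
have pl : is_partn la := is_partn_addcol n pn.
have sla : sumn la = d by rewrite sumn_addcol.
have nM : (n <= M)%N by rewrite (leq_trans _ dM) // leq_addl.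
have nuM : (sumn nu <= M)%N by rewrite (leq_trans _ dM) // leq_addr.
have h1 : Jh (nseq n 1%N) \is n.-homog for mnmwgt.
  by rewrite -[X in X.-homog for _](sumn_nseq1 n) lift_homog ?is_partn_nseq1 ?sumn_nseq1.
have hnu := lift_homog Jh pn nuM.
(* In n variables J_(1^n) is n! e_n, so this is a power-sum lift of n! e_n J_nu. *)
pose g := Jh nu * Jh (nseq n 1%N).
have hg : g \is d.-homog for mnmwgt by rewrite dhomogM.
pose fn := (n`!)%:R *: Jh nu.
have hfn : fn \is (sumn nu).-homog for mnmwgt by rewrite rpredZ.
have fE : Phi n g = en F n * Phi n fn.
  by rewrite /g PhiM PhiZ !lift_Phi ?is_partn_nseq1 ?sumn_nseq1 // jack_ones mulrC -scalerAr scalerAl.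
have gE := jcoord_expand Jh dM hg.
set co := jcoord Jh g in gE.
have PgE : Phi n g = \sum_(ka <- partns d d) co ka *: J ka n.
  rewrite {1}gE Phi_sum; apply: eq_big_seq => ka; rewrite partns_diag => /andP[pk /eqP sk].
  by rewrite PhiZ lift_Phi ?sk.
have lap1 : lap al (Phi n g) (ps_quot g) =
    \sum_(ka <- partns d d) (co ka * (eigen2 ka + 2%:R * (n%:R - 1) * d%:R)) *: J ka n.
  rewrite (lap_Phi _ _ hg dM) PgE scaler_sumr {1}gE linear_sum Phi_sum -big_split.
  apply: eq_big_seq => ka; rewrite partns_diag => /andP[pk /eqP sk] /=.
  by rewrite linearZ /= D2_Jh ?sk // !PhiZ lift_Phi ?sk // !scalerA -scalerDl; congr (_ *: _); ring.
have lap2 : lap al (Phi n g) (ps_quot g) = (eigen2 la + 2%:R * (n%:R - 1) * d%:R) *: Phi n g.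
  have q1 : lap_quot (Phi n g) (fun i j => en F n * (ps_quot fn i j + Phi n fn)).
    by rewrite fE; apply/lap_quot_en/ps_quotP.
  rewrite (lap_uniq al (ps_quotP g) q1) fE lap_en (lap_Phi _ _ hfn nuM).
  have -> : D2 al fn = eigen2 nu *: fn by rewrite /fn linearZ /= D2_Jh // !scalerA mulrC.
  rewrite (euler_homog (Phi_homog n hfn)) PhiZ !scalerA -!scalerDl -scalerAr; congr (_ *: _).
  rewrite eigen2_addcol // /d natrD; case: (n) => [|k]; first by ring.
  by rewrite natrM -natr1 /=; ring.
(* Components with more than n rows are invisible in n variables and stay undetermined. *)
have co0 ka : ka \in partns d d -> (size ka <= n)%N -> ka != la -> co ka = 0.
  move=> kL sk nk; apply/eqP; apply: contraT => nz.
  have pk : is_partn ka by move: kL; rewrite partns_diag => /andP[].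
  have : co ka * (eigen2 ka - eigen2 la) = 0.
    apply: (jack_indep Jh (x := fun ka => co ka * (eigen2 ka - eigen2 la)) dM _ kL sk).
    transitivity (lap al (Phi n g) (ps_quot g) - lap al (Phi n g) (ps_quot g)); last exact: subrr.
    rewrite {1}lap1 lap2 PgE scaler_sumr -sumrB; apply: eq_bigr => mu _.
    by rewrite scalerA -scalerBl; congr (_ *: _); ring.
  move/eqP; rewrite mulf_eq0 (negbTE nz) subr_eq0 => /eqP e.
  case/eqP: nk; apply: (eigen2_inj pk pl _ e).
  (* The monomial x^mu occurs in e_n J_nu, hence ka <= mu <= la: the comparability required by
     [eigen2_inj]. *)
  have [mu [pm sm dm]] := jack_top_coef Jh dM kL sk nz.
  rewrite -PgE fE PhiZ lift_Phi // -scalerAr mcoeffZ mulf_eq0 negb_or => /andP[_ nz'].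
  apply: (dominated_trans _ dm).
  have le1 : (mone n <= mnm_of n mu)%MM.
    move: nz'; rewrite mulrC -mcoeff_msupp (perm_mem (msuppMX _ _)) => /mapP[m' _ ->].
    exact: lem_addr.
  move: nz'; rewrite -(submK le1) addmC mulrC mcoeffMX (jack_coefE J_jack) // => nz'.
  rewrite -(pt_mnm_of pm sm) -(submK le1) addmC; apply: dominated_addcol => //.
  exact: (jc_dominated J_jack pn (is_partn_pt _) nz').
have fJ : Phi n g = co la *: J la n.
  rewrite PgE (bigD1_seq la) ?partns_uniq ?partns_diag ?pl ?sla //=.
  rewrite big_seq_cond big1 ?addr0 // => ka /andP[kL nk].
  case: (leqP (size ka) n) => sk; first by rewrite co0 // scale0r.
  by rewrite (jack_eq0 J_jack) ?scaler0 //; move: kL; rewrite partns_diag => /andP[].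
have fn0 : (n`!)%:R != 0 :> F.
  by have := fact_gt0 n; case: (_`!).
have Jn0 : J nu n != 0.
  apply/eqP => J0; have := jc_diag_neq0 Jh pn nuM.
  by rewrite -{2}(pt_mnm_of pn sn) -(jack_coefE J_jack) // J0 mcoeff0 eqxx.
have cn0 : co la != 0.
  apply/eqP => c0; move: fJ; rewrite c0 scale0r fE PhiZ lift_Phi // => /eqP.
  rewrite mulf_eq0 scaler_eq0 (negbTE fn0) (negbTE Jn0) !orbF => /eqP e0.
  by have := mcoeffX F (mone n) (mone n); rewrite -/(en F n) e0 mcoeff0 eqxx => /eqP; rewrite eq_sym oner_eq0.
exists ((co la)^-1 * (n`!)%:R); first by rewrite mulf_neq0 ?invr_neq0.
by rewrite -[LHS](scalerK cn0) -fJ fE PhiZ lift_Phi // -scalerAr scalerA.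
Qed.

End ColumnRemoval.

Lemma mcoeff_en (F : fieldType) n (f : {mpoly F[n]}) m :
  (en F n * f)@_m = if (mone n <= m)%MM then f@_(m - mone n) else 0.
Proof.
rewrite mulrC; case: ifP => h; first by rewrite -{1}(submK h) addmC mcoeffMX.
apply: memN_msupp_eq0; rewrite (perm_mem (msuppMX _ _)); apply/negP => /mapP[m' _ e].
by rewrite e lem_addr in h.
Qed.

(** By the chain rule d/dx_i is sum_k k x_i^(k-1) d/dp_k, and on monomials free of x_i only k = 1
    survives. Hence d/dp_1 extracts the coefficient of the first power of one variable. *)
Lemma mcoeff_Phi_Dv0 (F : fieldType) M N (g : {mpoly F[M]}) (i : 'I_N) (m : 'X_{1..N}) :
  m i = 0%N -> (Phi N (Dv 0 g))@_m = (Phi N g)@_(m + U_(i)).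
Proof.
move=> mi; have := mcoeff_mderiv i (Phi N g) m; rewrite mi mulr1n mderiv_Phi mcoeff_bigsum => <-.
case: (posnP M) => M0.
  rewrite Dv_ge ?M0 // Phi0 mcoeff0 big1 // => k _; by have := ltn_ord k; rewrite {2}M0.
rewrite (bigD1 (Ordinal M0)) //= scale1r expr0 mulr1 big1 ?addr0 // => k.
rewrite -val_eqE /=; case: (val k) => // k' _.
by rewrite -scalerAr mcoeffZ exprS mulrCA mcoeff_Xl0 // mulr0.
Qed.

Lemma pt_mnmwiden n (m : 'X_{1..n}) : pt (mnmwiden m) = pt m.
Proof.
have -> : mnmwiden m = rcons m 0%N :> seq nat by [].
by rewrite /pt filter_rcons.
Qed.

Lemma ord_max_widen k (i : 'I_k) : (ord_max == widen_ord (leqnSn k) i) = false.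
Proof. by rewrite -val_eqE /= gtn_eqF // ltn_ord. Qed.

(** * Coefficients of p_1 and d/dp_1 on Jack functions *)

Section Pieri.

Variables (F : fieldType) (al : F) (J : seq nat -> symfun F) (M : nat).
Variable Jh : jack_lift al J M.

Local Notation jc := (jc J).
Local Notation nrm := (nrm Jh).

Let J_jack := lift_family Jh.
Let Hpos := lift_positive Jh.
Let natF := pos_nat_neq0 Hpos.

Definition pieri_up (ka mu : seq nat) : F := jcoord Jh (Pv F M 0 * Jh ka) mu.

Definition pieri_down (mu ka : seq nat) : F := jcoord Jh (Dv 0 (Jh mu)) ka.

Lemma pieri_adjoint ka mu : is_partn ka -> is_partn mu -> sumn mu = (sumn ka).+1 ->
  (sumn mu <= M)%N -> al * pieri_down mu ka * nrm ka = pieri_up ka mu * nrm mu.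
Proof.
move=> pk pm s sM; rewrite /pieri_down /pieri_up /jcoord -mulrA !divfK ?nrm_neq0 //; last by lia.
by rewrite bp_adj mulr1 bpC.
Qed.

Lemma p1_Jh_homog ka : is_partn ka -> (sumn ka < M)%N ->
  Pv F M 0 * Jh ka \is (sumn ka).+1.-homog for mnmwgt.
Proof. by move=> pk kM; rewrite -[(sumn ka).+1]add1n Pv_homog // lift_homog // ltnW. Qed.

Lemma p1_expand ka : is_partn ka -> (sumn ka < M)%N ->
  Pv F M 0 * Jh ka = \sum_(mu <- partns (sumn ka).+1 (sumn ka).+1) pieri_up ka mu *: Jh mu.
Proof. by move=> pk kM; apply: jcoord_expand => //; exact: p1_Jh_homog. Qed.

Lemma Phi_expand d (x : seq nat -> F) N : (d <= M)%N ->
  Phi N (\sum_(mu <- partns d d) x mu *: Jh mu) = \sum_(mu <- partns d d) x mu *: J mu N.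
Proof.
move=> dM; rewrite Phi_sum; apply: eq_big_seq => mu; rewrite partns_diag => /andP[pm /eqP sm].
by rewrite PhiZ lift_Phi ?sm.
Qed.

Lemma p1_jack ka N : is_partn ka -> (sumn ka < M)%N ->
  psum F N 1 * J ka N = \sum_(mu <- partns (sumn ka).+1 (sumn ka).+1) pieri_up ka mu *: J mu N.
Proof.
move=> pk kM; have M0 : (0 < M)%N by exact: leq_ltn_trans kM.
by rewrite -Phi_expand // -p1_expand // PhiM (Phi_Pv _ _ M0) lift_Phi // ltnW.
Qed.

Lemma d1_Jh_homog d mu : is_partn mu -> sumn mu = d.+1 -> (d < M)%N ->
  Dv 0 (Jh mu) \is d.-homog for mnmwgt.
Proof. by move=> pm sm dM; apply: Dv_homog; rewrite add1n -sm lift_homog ?sm. Qed.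

Lemma d1_expand d mu : is_partn mu -> sumn mu = d.+1 -> (d < M)%N ->
  Dv 0 (Jh mu) = \sum_(ka <- partns d d) pieri_down mu ka *: Jh ka.
Proof. by move=> pm sm dM; apply: jcoord_expand; [exact: ltnW | exact: d1_Jh_homog]. Qed.

(** The scalar between J_la and e_n J_nu in n variables, as a quotient of leading coefficients;
    [colfacE] gives its closed form. *)
Definition colfac n nu : F := jc (addcol n nu) (addcol n nu) / jc nu nu.

Lemma colfac_neq0 n nu : is_partn nu -> (size nu <= n)%N -> (sumn nu + n <= M)%N -> colfac n nu != 0.
Proof.
move=> pn sn dM; rewrite mulf_neq0 ?invr_neq0 // (jc_diag_neq0 Jh) //.
- exact: is_partn_addcol.
- by rewrite sumn_addcol.
- by rewrite (leq_trans _ dM) // leq_addr.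
Qed.

Lemma jack_addcol n nu : is_partn nu -> (size nu <= n)%N -> (sumn nu + n <= M)%N ->
  J (addcol n nu) n = colfac n nu *: (en F n * J nu n).
Proof.
move=> pn sn dM; have [h _ e] := column_removal Jh pn sn dM; rewrite e; congr (_ *: _).
have := congr1 (mcoeff (mnm_of n (addcol n nu))) e.
rewrite /colfac mcoeffZ !(jack_coefE J_jack) ?is_partn_addcol //.
rewrite mnm_of_addcol mcoeff_en lem_addr addmC addmK (jack_coefE J_jack) // pt_mnm_of //.
rewrite addmC -mnm_of_addcol pt_mnm_of ?is_partn_addcol ?size_addcol // => ->.
by rewrite mulfK // (jc_diag_neq0 Jh) // (leq_trans _ dM) // leq_addr.
Qed.

Lemma en_expand n d (y : seq nat -> F) : (d + n <= M)%N ->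
  en F n * \sum_(nu <- partns d d) y nu *: J nu n =
  \sum_(mu <- partns (d + n) (d + n))
    (if size mu == n then y (rmcol mu) / colfac n (rmcol mu) else 0) *: J mu n.
Proof.
move=> dM; rewrite mulr_sumr [RHS](bigID (fun mu => size mu == n)) /= [X in _ = _ + X]big1 => [|mu /negbTE ->].
  rewrite addr0 -[RHS]big_filter -(perm_big _ (map_addcol_partns n d)) /= big_map big_filter.
  rewrite [LHS](bigID (fun nu => (size nu <= n)%N)) /= [X in _ + X]big_seq_cond [X in _ + X]big1 ?addr0.
    rewrite big_seq_cond [RHS]big_seq_cond; apply: eq_bigr => nu /andP[].
    rewrite partns_diag => /andP[pn /eqP sd] sn.
    rewrite size_addcol eqxx addcolK // jack_addcol ?sd // scalerA divfK ?colfac_neq0 ?sd //.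
    by rewrite -scalerAr.
  move=> nu /andP[]; rewrite partns_diag -ltnNge => /andP[pn _] sn.
  by rewrite (jack_eq0 J_jack) // scaler0 mulr0.
by rewrite scale0r.
Qed.

(** Multiplications by p_1 and by e_n commute, and e_n J_nu is J of nu with a column added, up to
    the column factor. *)
Lemma pieri_up_addcol n ka mu : is_partn ka -> is_partn mu -> (size ka <= n)%N -> (size mu <= n)%N ->
  sumn mu = (sumn ka).+1 -> (sumn mu + n <= M)%N ->
  pieri_up (addcol n ka) (addcol n mu) = colfac n ka * pieri_up ka mu / colfac n mu.
Proof.
move=> pk pm sk sm s dM; set d := (sumn ka).+1 in s.
have kM : (sumn (addcol n ka) < M)%N by rewrite sumn_addcol //; lia.
have dM' : (d + n <= M)%N by rewrite -s.
pose x nu := pieri_up (addcol n ka) nu -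
  (if size nu == n then colfac n ka * pieri_up ka (rmcol nu) / colfac n (rmcol nu) else 0).
suff : x (addcol n mu) = 0 by rewrite /x size_addcol eqxx addcolK // => /subr0_eq.
have sE : (sumn (addcol n ka)).+1 = (d + n)%N by rewrite sumn_addcol // addSn.
apply: (jack_indep Jh (n := n) (x := x) dM').
- rewrite -[RHS](subrr (psum F n 1 * J (addcol n ka) n)) {1}p1_jack ?is_partn_addcol // sE.
  have -> : psum F n 1 * J (addcol n ka) n =
      en F n * \sum_(nu <- partns d d) (colfac n ka * pieri_up ka nu) *: J nu n.
    rewrite jack_addcol //; last by lia.
    under eq_bigr => nu _ do rewrite -scalerA.
    rewrite -scaler_sumr -p1_jack //; last by lia.
    by rewrite -!scalerAr mulrCA.
  rewrite en_expand // -sumrB; apply: eq_bigr => nu _.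
  by rewrite /x scalerBl.
- by rewrite partns_diag is_partn_addcol // sumn_addcol // s eqxx.
- by rewrite size_addcol.
Qed.

Lemma pieri_down_eq0 ka mu : is_partn ka -> is_partn mu -> sumn mu = (sumn ka).+1 ->
  (sumn mu <= M)%N -> (pieri_down mu ka == 0) = (pieri_up ka mu == 0).
Proof.
move=> pk pm s sM; have e := pieri_adjoint pk pm s sM.
have kM : (sumn ka <= M)%N by lia.
have nk := nrm_neq0 Jh pk kM; have nm := nrm_neq0 Jh pm sM.
have a0 := pos_al_neq0 Hpos.
apply/idP/idP => /eqP h; apply: contraT => n0; move/eqP: e; rewrite h ?mulr0 ?mul0r.
  by rewrite eq_sym (negbTE (mulf_neq0 n0 nm)).
by rewrite (negbTE (mulf_neq0 (mulf_neq0 a0 n0) nk)).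
Qed.

(* The coefficient of x_n in J mu, divisible by x_1 ... x_n, involves x_1 ... x_(n-1). *)
Lemma pieri_down_short k mu ka : is_partn mu -> is_partn ka -> size mu = k.+1 -> (size ka <= k)%N ->
  sumn mu = (sumn ka).+1 -> (sumn mu <= M)%N -> pieri_down mu ka != 0 ->
  (size (rmcol mu) <= k)%N /\ ka = addcol k (rmcol mu).
Proof.
move=> pm pk sm sk s sM nz; set nu := rmcol mu; set d := sumn ka in s.
have pn : is_partn nu := is_partn_rmcol pm.
have smu : mu = addcol k.+1 nu by rewrite -sm rmcolK.
have sn : (size nu <= k.+1)%N by rewrite -sm size_rmcol.
have sumE : sumn mu = (sumn nu + k.+1)%N by rewrite {1}smu sumn_addcol.
have dM : (d < M)%N by rewrite -s.
have P : \sum_(xi <- partns d d) pieri_down mu xi *: J xi k = colfac k.+1 nu *: (en F k * J nu k).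
  rewrite -Phi_expand ?(ltnW dM) // -(d1_expand pm s dM).
  apply/mpolyP => m; rewrite mcoeffZ mcoeff_en.
  (* Stability: the polynomial in k variables is the one in k + 1 variables at x_(k+1) = 0. *)
  have -> : (Phi k (Dv 0 (Jh mu)))@_m = (Phi k.+1 (Dv 0 (Jh mu)))@_(mnmwiden m).
    rewrite (d1_expand pm s dM) !Phi_expand ?(ltnW dM) // !mcoeff_bigsum.
    apply: eq_big_seq => xi; rewrite partns_diag => /andP[px _].
    by rewrite !mcoeffZ !(jack_coefE J_jack) // pt_mnmwiden.
  rewrite (mcoeff_Phi_Dv0 _ (mnmwiden_ordmax m)) lift_Phi // {1}smu jack_addcol // -?sumE //.
  rewrite mcoeffZ mcoeff_en; congr (_ * _).
  have -> : (mone k.+1 <= mnmwiden m + U_(ord_max))%MM = (mone k <= m)%MM.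
    apply/mnm_lepP/mnm_lepP => h i.
      have := h (widen_ord (leqnSn k) i); rewrite mnmDE mnmwiden_widen !mnmE.
      by rewrite ord_max_widen addn0.
    rewrite mnmDE mnm1E mnmE; case: (unliftP ord_max i) => [j ->|->]; last by rewrite eqxx addn1.
    have -> : lift ord_max j = widen_ord (leqnSn k) j by apply/val_inj; exact: lift_max.
    by rewrite mnmwiden_widen; have := h j; rewrite mnmE; lia.
  case: ifP => // h; rewrite !(jack_coefE J_jack) //; congr (jc _ _).
  rewrite -(pt_mnmwiden (m - mone k)%MM); congr pt; congr (val (multinom_val _)).
  apply/mnmP => i; rewrite mnmBE mnmDE mnm1E !mnmE.
  case: (unliftP ord_max i) => [j ->|->]; last by rewrite eqxx !mnmwiden_ordmax.
  have -> : lift ord_max j = widen_ord (leqnSn k) j by apply/val_inj; exact: lift_max.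
  by rewrite !mnmwiden_widen mnmBE mnmE ord_max_widen addn0.
have dp : partns d d = partns (sumn ka) (sumn ka) by [].
have kL : ka \in partns d d by rewrite partns_diag pk eqxx.
case: (leqP (size nu) k) => sn'; last first.
  rewrite (jack_eq0 J_jack pn sn') mulr0 scaler0 in P.
  by rewrite (jack_indep Jh (ltnW dM) P kL sk) eqxx in nz.
split=> //; apply/eqP; apply: contraT => ne.
pose x xi := pieri_down mu xi - (if xi == addcol k nu then colfac k.+1 nu / colfac k nu else 0).
have snk : (sumn nu + k <= M)%N by move: sM; rewrite sumE; lia.
have aL : addcol k nu \in partns d d.
  rewrite partns_diag is_partn_addcol //= sumn_addcol //; apply/eqP.
  by move: s; rewrite sumE; lia.
have : x ka = 0.
  apply: (jack_indep Jh (n := k) (x := x) (ltnW dM)) => //.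
  rewrite (eq_bigr (fun xi => pieri_down mu xi *: J xi k -
     (if xi == addcol k nu then colfac k.+1 nu / colfac k nu else 0) *: J xi k)); last first.
    by move=> xi _; rewrite -scalerBl.
  rewrite sumrB P [X in _ - X](bigD1_seq (addcol k nu)) ?partns_uniq //= eqxx.
  rewrite big1 => [|xi /negbTE ->]; last by rewrite scale0r.
  by rewrite addr0 jack_addcol // scalerA divfK ?colfac_neq0 // subrr.
by rewrite /x (negbTE ne) subr0 => h; rewrite h eqxx in nz.
Qed.

(** The numbers of rows are compared. If ka has fewer rows, [pieri_down_short] leaves only the
    removal of a last row of length 1; if it has more, p_1 J_ka vanishes in as many variables as mu
    has rows; if the numbers agree, both first columns are removed and the induction applies. *)
Lemma pieri_support mu ka : is_partn mu -> is_partn ka -> sumn mu = (sumn ka).+1 ->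
  (sumn mu <= M)%N -> pieri_down mu ka != 0 -> exists i, boxadd i ka mu.
Proof.
have [e] := ubnP (sumn mu); elim: e mu ka => // e IH mu ka; rewrite ltnS => me pm pk s sM nz.
have dM : (sumn ka < M)%N by rewrite -s.
case sm : (size mu) => [|k]; first by move: s; move/size0nil: sm => ->.
have pn := is_partn_rmcol pm.
have smu : mu = addcol k.+1 (rmcol mu) by rewrite -sm rmcolK.
have sn : (size (rmcol mu) <= k.+1)%N by rewrite -sm size_rmcol.
have sumE : sumn mu = (sumn (rmcol mu) + k.+1)%N by rewrite {1}smu sumn_addcol.
case: (ltngtP (size ka) k.+1) => sk.
- have [sn' eka] := pieri_down_short pm pk sm sk s sM nz.
  by exists k; rewrite eka {2}smu; exact: boxadd_lastrow.
- exfalso; move: nz; rewrite pieri_down_eq0 //; apply/negP; rewrite negbK; apply/eqP.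
  apply: (jack_indep Jh (n := k.+1) (x := pieri_up ka) (d := (sumn ka).+1)) => //.
  + by rewrite -p1_jack // (jack_eq0 J_jack) // mulr0.
  + by rewrite partns_diag pm s eqxx.
  + by rewrite sm.
have pk' := is_partn_rmcol pk.
have ska : ka = addcol k.+1 (rmcol ka) by rewrite -sk rmcolK.
have skr : (size (rmcol ka) <= k.+1)%N by rewrite -sk size_rmcol.
have sumK : sumn ka = (sumn (rmcol ka) + k.+1)%N by rewrite {1}ska sumn_addcol.
have s' : sumn (rmcol mu) = (sumn (rmcol ka)).+1 by move: s; rewrite sumE sumK; lia.
have sM' : (sumn (rmcol mu) <= M)%N by move: sM; rewrite sumE; lia.
have nz' : pieri_down (rmcol mu) (rmcol ka) != 0.
  rewrite pieri_down_eq0 //; move: nz.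
  rewrite pieri_down_eq0 // {1}ska {1}smu pieri_up_addcol // -?sumE //.
  by apply: contra => /eqP ->; rewrite mulr0 mul0r.
have me' : (sumn (rmcol mu) < e)%N by move: me; rewrite sumE; lia.
have [i hi] := IH _ _ me' pn pk' s' sM' nz'.
by exists i; rewrite ska smu; exact: boxadd_addcol.
Qed.

End Pieri.

Lemma boxadd_size N i ka mu : boxadd i ka mu -> (size mu <= N)%N -> (i < N)%N.
Proof.
move=> h sN; apply: leq_trans sN; rewrite ltnNge; apply/negP => le.
by have := h i; rewrite eqxx nth_default // addn1.
Qed.

Lemma boxadd_size_le i ka mu : is_partn ka -> boxadd i ka mu -> (size ka <= size mu)%N.
Proof.
move=> pk h; rewrite leqNgt; apply/negP => lt.
have := h (size mu); rewrite [LHS]nth_default // => /esym/eqP; rewrite addn_eq0 => /andP[/eqP z _].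
by have := partn_nth_gt0 (size mu) pk; rewrite z lt.
Qed.

Lemma boxadd_sum N i ka mu (f : nat -> nat -> nat) : boxadd i ka mu -> (i < N)%N ->
  (\sum_(j < N) f j (nth 0 mu j) + f i (nth 0 ka i) =
   \sum_(j < N) f j (nth 0 ka j) + f i (nth 0 ka i).+1)%N.
Proof.
move=> h iN; rewrite (bigD1 (Ordinal iN)) //= [in RHS](bigD1 (Ordinal iN)) //=.
rewrite (h i) eqxx addn1; rewrite (eq_bigr (fun j : 'I_N => f j (nth 0 ka j))%N); first by lia.
move=> j; rewrite -val_eqE /= => /negbTE ji; by rewrite h ji addn0.
Qed.

Lemma boxadd_prod (R : comPzRingType) N i ka mu (f : nat -> nat -> R) : boxadd i ka mu -> (i < N)%N ->
  (\prod_(j < N) f j (nth 0%N mu j)) * f i (nth 0%N ka i) =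
  (\prod_(j < N) f j (nth 0%N ka j)) * f i (nth 0%N ka i).+1.
Proof.
move=> h iN; rewrite (bigD1 (Ordinal iN)) //= [in RHS](bigD1 (Ordinal iN)) //=.
rewrite (h i) eqxx addn1; rewrite (eq_bigr (fun j : 'I_N => f j (nth 0%N ka j))); first by ring.
move=> j; rewrite -val_eqE /= => /negbTE ji; by rewrite h ji addn0.
Qed.

(** * Contents, sum rules and the specialization p_r = z *)

Section Evaluation.

Variables (F : fieldType) (al : F) (J : seq nat -> symfun F) (M : nat).
Variable Jh : jack_lift al J M.

Local Notation eigen2 := (eigen2 al).
Local Notation pieri_up := (pieri_up Jh).
Local Notation pieri_down := (pieri_down Jh).
Local Notation colfac := (colfac J).

Let J_jack := lift_family Jh.
Let Hpos := lift_positive Jh.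
Let natF := pos_nat_neq0 Hpos.

(** alpha times the content of the first box to the right of row i, rows being counted from 0. *)
Definition content (la : seq nat) (i : nat) : F := al * (nth 0%N la i)%:R - i%:R.

Lemma eigen2_boxadd i ka mu : is_partn ka -> is_partn mu -> boxadd i ka mu ->
  eigen2 mu = eigen2 ka + 2%:R * content ka i.
Proof.
move=> pk pm h; set N := size mu.
have iN : (i < N)%N := boxadd_size h (leqnn _).
have sk : (size ka <= N)%N := boxadd_size_le pk h.
have e1 := boxadd_sum (fun _ a => a * a.-1)%N h iN.
have e2 := boxadd_sum (fun j a => j * a)%N h iN.
have s1 : (\sum_(j < size ka) nth 0 ka j * (nth 0 ka j).-1 = \sum_(j < N) nth 0 ka j * (nth 0 ka j).-1)%N.
  by symmetry; apply: (@sum_nth_size (fun _ a => a * a.-1)%N ka N).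
have s2 : (\sum_(j < size ka) j * nth 0 ka j = \sum_(j < N) j * nth 0 ka j)%N.
  by symmetry; apply: (@sum_nth_size (fun j a => j * a)%N ka N) => // j; rewrite muln0.
rewrite /eigen2 /content.
have -> : (\sum_(j < size mu) nth 0 mu j * (nth 0 mu j).-1 =
   \sum_(j < size ka) nth 0 ka j * (nth 0 ka j).-1 + 2 * nth 0 ka i)%N.
  by rewrite s1; move: e1; rewrite /= -/N; case: (nth 0%N ka i) => [|a] /=; lia.
have -> : nstat mu = (nstat ka + i)%N by rewrite /nstat s2; move: e2; rewrite mulnS /= -/N; lia.
by rewrite (natrD _ _ (2 * nth 0%N ka i)) natrM (natrD _ (nstat ka)); ring.
Qed.

Definition p1m (d : nat) : 'X_{1..M} := [multinom (if i == 0 :> nat then d else 0)%N | i < M].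

Lemma p1mS d (M0 : (0 < M)%N) : p1m d.+1 = (p1m d + U_(Ordinal M0))%MM.
Proof.
apply/mnmP => i; rewrite mnmDE mnm1E !mnmE -val_eqE /= eq_sym.
by case: eqP => _; rewrite ?addn1.
Qed.

Lemma wgt0_const (g : {mpoly F[M]}) : g \is 0.-homog for mnmwgt -> g = (g@_0%MM)%:MP.
Proof.
move=> h; apply/mpolyP => m; rewrite mcoeffC; case: (altP (m =P 0%MM)) => [->|ne]; first by rewrite mulr1.
rewrite mulr0 (dhomog_nemf_coeff h) //= -leqn0 -ltnNge.
by apply: leq_trans (leq_mdeg_mnmwgt m); rewrite lt0n mdeg_eq0.
Qed.

(** Each d/dp_1 strips one variable off x_1 ... x_d ([mcoeff_Phi_Dv0]) and multiplies the
    coefficient of the power of p_1 by its exponent, whence d!. *)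
Lemma Phi_ones_coeff d N (g : {mpoly F[M]}) : g \is d.-homog for mnmwgt -> (d <= N)%N -> (d <= M)%N ->
  (Phi N g)@_(mnm_of N (nseq d 1%N)) = (d`!)%:R * g@_(p1m d).
Proof.
elim: d g => [|d IH] g hg dN dM.
  rewrite {1}(wgt0_const hg) -alg_mpolyC PhiZ Phi1 mcoeffZ mcoeff1.
  have -> : mnm_of N (nseq 0 1%N) = 0%MM by apply/mnmP => i; rewrite !mnmE nth_nil.
  have -> : p1m 0 = 0%MM by apply/mnmP => i; rewrite !mnmE if_same.
  by rewrite eqxx mulr1 mul1r.
have M0 : (0 < M)%N by apply: leq_ltn_trans dM.
have e : mnm_of N (nseq d.+1 1%N) = (mnm_of N (nseq d 1%N) + U_(Ordinal dN))%MM.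
  apply/mnmP => i; rewrite mnmDE mnm1E !mnmE !nth_nseq ltnS leq_eqVlt -val_eqE /= eq_sym.
  by case: ltngtP.
rewrite e -mcoeff_Phi_Dv0; last by rewrite mnmE nth_nseq /= ltnn.
rewrite IH ?(ltnW dN) ?(ltnW dM) //; last by apply: Dv_homog; rewrite add1n.
rewrite -[0%N]/(val (Ordinal M0)) Dv_ord mcoeff_mderiv -p1mS factS natrM.
have -> : p1m d (Ordinal M0) = d by rewrite mnmE.
by rewrite -mulr_natr; ring.
Qed.

Lemma Jh_p1m ka : is_partn ka -> (sumn ka <= M)%N -> (Jh ka)@_(p1m (sumn ka)) = 1.
Proof.
move=> pk kM; have := @Phi_ones_coeff _ (sumn ka) _ (lift_homog Jh pk kM) (leqnn _) kM.
rewrite lift_Phi // (jack_coefE J_jack) // pt_mnm_of ?is_partn_nseq1 ?size_nseq //.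
rewrite (jc_ones J_jack) // => /esym e; apply: (mulfI (x := (sumn ka)`!%:R)).
  by have := fact_gt0 (sumn ka); case: (_`!).
by rewrite e mulr1.
Qed.

(** Coefficients of p_1^d are compared: each J_ka contributes 1, and differentiating p_1^(d+1) gives
    d + 1. *)
Lemma sum_pieri_down d mu : is_partn mu -> sumn mu = d.+1 -> (d < M)%N ->
  \sum_(ka <- partns d d) pieri_down mu ka = d.+1%:R.
Proof.
move=> pm sm dM; have M0 : (0 < M)%N by apply: leq_ltn_trans dM.
have := congr1 (mcoeff (p1m d)) (d1_expand Jh pm sm dM).
rewrite -[0%N]/(val (Ordinal M0)) Dv_ord mcoeff_mderiv -p1mS -sm Jh_p1m ?sm //.
have -> : p1m d (Ordinal M0) = d by rewrite mnmE.
move=> ->; rewrite mcoeff_bigsum; apply: eq_big_seq => ka; rewrite partns_diag => /andP[pk /eqP sk].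
by rewrite mcoeffZ -sk Jh_p1m ?mulr1 // sk ltnW.
Qed.

Lemma sum_pieri_up ka : is_partn ka -> (sumn ka < M)%N ->
  \sum_(mu <- partns (sumn ka).+1 (sumn ka).+1) pieri_up ka mu = 1.
Proof.
move=> pk kM; have M0 : (0 < M)%N by apply: leq_ltn_trans kM.
have := congr1 (mcoeff (p1m (sumn ka).+1)) (p1_expand Jh pk kM).
rewrite {1}p1mS -[0%N]/(val (Ordinal M0)) Pv_ord mcoeff_Xl Jh_p1m ?(ltnW kM) // => ->.
rewrite mcoeff_bigsum; apply: eq_big_seq => mu; rewrite partns_diag => /andP[pm /eqP sm].
by rewrite mcoeffZ -sm Jh_p1m ?mulr1 // sm.
Qed.

Lemma D2_p1_expand ka : is_partn ka -> (sumn ka < M)%N ->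
  (al *+ 2) *: raise2 (Jh ka) = \sum_(mu <- partns (sumn ka).+1 (sumn ka).+1)
    (pieri_up ka mu * (eigen2 mu - eigen2 ka)) *: Jh mu.
Proof.
move=> pk kM; have := D2_comm_p1 al (Jh ka).
rewrite (D2_Jh Jh pk (ltnW kM)) -scalerAr (p1_expand Jh pk kM) linear_sum /=.
rewrite addrC => /(canLR (addrK _)) <-; rewrite scaler_sumr -sumrB; apply: eq_big_seq => mu.
rewrite partns_diag => /andP[pm /eqP sm].
by rewrite linearZ /= (D2_Jh Jh) ?sm // !scalerA -scalerBl; congr (_ *: _); ring.
Qed.

(** Every term of [raise2] contains some p_k with k >= 2, so p_1^(d+1) does not occur in it. *)
Lemma sum_pieri_up_eigen2 ka : is_partn ka -> (sumn ka < M)%N ->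
  \sum_(mu <- partns (sumn ka).+1 (sumn ka).+1) pieri_up ka mu * (eigen2 mu - eigen2 ka) = 0.
Proof.
move=> pk kM; have := congr1 (mcoeff (p1m (sumn ka).+1)) (D2_p1_expand pk kM).
rewrite mcoeff_bigsum => e; transitivity (((al *+ 2) *: raise2 (Jh ka))@_(p1m (sumn ka).+1)).
  rewrite e; apply: eq_big_seq => mu; rewrite partns_diag => /andP[pm /eqP sm].
  by rewrite mcoeffZ -sm Jh_p1m ?mulr1 // sm.
rewrite mcoeffZ /raise2 mcoeff_bigsum big1 ?mulr0 // => k _.
rewrite mcoeffZ Pv_ord; case: (posnP k) => [->|k0]; first by rewrite mul0r.
by rewrite mcoeff_Xl0 ?mulr0 // mnmE eqn0Ngt k0.
Qed.

(** [lower2] is half of the commutator [d/dp_1, D2], so it multiplies the components of d/dp_1 by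
    half the eigenvalue differences. *)
Lemma lower_expand d z mu : is_partn mu -> sumn mu = d.+1 -> (d < M)%N ->
  z *: Dv 0 (Jh mu) + lower2 (Jh mu) =
  \sum_(ka <- partns d d) (pieri_down mu ka * (z + (eigen2 mu - eigen2 ka) / 2%:R)) *: Jh ka.
Proof.
move=> pm sm dM; have := p1_comm_D2 (pos_al_neq0 Hpos) natF (Jh mu).
rewrite (D2_Jh Jh pm) ?sm // linearZ /= addrC => /(canLR (addrK _)) e.
have -> : lower2 (Jh mu) = (2%:R)^-1 *: (eigen2 mu *: Dv 0 (Jh mu) - D2 al (Dv 0 (Jh mu))).
  by rewrite e scalerK ?natF.
rewrite (d1_expand Jh pm sm dM) [D2 al _]linear_sum !scaler_sumr -sumrB scaler_sumr -big_split /=.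
apply: eq_big_seq => ka; rewrite partns_diag => /andP[pk /eqP sk].
rewrite [D2 al _]linearZ /= (D2_Jh Jh) ?sk ?(ltnW dM) // !scalerA -scalerBl scalerA -scalerDl.
by congr (_ *: _); field; exact: natF.
Qed.

Definition ev_prod (z : F) (la : seq nat) : F :=
  \prod_(i < size la) \prod_(j < nth 0 la i) (z + al * j%:R - i%:R).

Lemma ev_prodE N z la : (size la <= N)%N ->
  ev_prod z la = \prod_(i < N) \prod_(j < nth 0 la i) (z + al * j%:R - i%:R).
Proof.
move=> sN; rewrite /ev_prod.
rewrite (big_ord_widen N (fun i => \prod_(j < nth 0 la i) (z + al * j%:R - i%:R))) // big_mkcond.
by apply: eq_bigr => i _; case: ltnP => // h; rewrite nth_default // big_ord0.
Qed.

Lemma ev_prod_boxadd z i ka mu : is_partn ka -> boxadd i ka mu ->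
  ev_prod z mu = ev_prod z ka * (z + content ka i).
Proof.
move=> pk h; have iN := boxadd_size h (leqnn _).
rewrite /ev_prod -/(ev_prod z ka) (ev_prodE _ (boxadd_size_le pk h)).
rewrite (bigD1 (Ordinal iN)) //= [in RHS](bigD1 (Ordinal iN)) //= (h i) eqxx addn1.
rewrite big_ord_recr /= /content addrA.
rewrite (eq_bigr (fun l : 'I_(size mu) => \prod_(j < nth 0 ka l) (z + al * j%:R - l%:R))); first by ring.
by move=> j; rewrite -val_eqE /= => /negbTE ji; rewrite h ji addn0.
Qed.

(* Every box added to ka contributes the factor z + content, whatever the order of addition. *)
Lemma ev_Jh z mu : is_partn mu -> (sumn mu <= M)%N -> ev z (Jh mu) = ev_prod z mu.
Proof.
move e : (sumn mu) => d; elim: d mu e => [|d IH] mu sm pm dM.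
  have mu0 : mu = [::] by apply/size0nil/eqP; rewrite -leqn0 -sm size_partn.
  have hom := lift_homog Jh pm; rewrite sm in hom; have g0 := wgt0_const (hom isT).
  have := Jh_p1m pm; rewrite sm => /(_ isT).
  have -> : p1m 0 = 0%MM by apply/mnmP => i; rewrite !mnmE if_same.
  by move=> c1; rewrite g0 c1 /ev mevalC /ev_prod mu0 big_ord0.
have hom := lift_homog Jh pm; rewrite sm in hom.
apply: (mulfI (natF d)); rewrite -(ev_lower z (hom dM)) (lower_expand z pm sm dM).
rewrite -(sum_pieri_down pm sm dM) mulr_suml /ev raddf_sum /=; apply: eq_big_seq => ka.
rewrite partns_diag => /andP[pk /eqP sk].
rewrite mevalZ -/(ev z (Jh ka)) IH ?(ltnW dM) // -mulrA.
case: (eqVneq (pieri_down mu ka) 0) => [->|nz]; first by rewrite !mul0r.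
have smk : sumn mu = (sumn ka).+1 by rewrite sm sk.
have muM : (sumn mu <= M)%N by rewrite sm.
have [i hi] := pieri_support pm pk smk muM nz.
rewrite (ev_prod_boxadd z pk hi) (eigen2_boxadd pk pm hi); congr (_ * _).
rewrite mulrC; congr (_ * _); congr (_ + _).
by rewrite addrAC subrr add0r mulrC mulKf // natF.
Qed.

Lemma ev_prod_neq0 n nu : (size nu <= n)%N -> ev_prod n%:R nu != 0.
Proof.
move=> sn; rewrite /ev_prod; apply/prodf_neq0 => i _; apply/prodf_neq0 => j _.
have lt := leq_trans (ltn_ord i) sn.
rewrite addrAC -natrB ?(ltnW lt) // addrC pos_lin_neq0 //; lia.
Qed.

(** At x = (1, ..., 1) every p_r is n and e_n is 1, so the column factor is a quotient of two
    evaluations. In each row the boxes of nu cancel and the last box of la remains. *)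
Lemma colfacE n nu : is_partn nu -> (size nu <= n)%N -> (sumn nu + n <= M)%N ->
  colfac n nu = \prod_(i < n) (al * (nth 0%N nu i)%:R + (n - i)%:R).
Proof.
move=> pn sn dM; have nM : (sumn nu <= M)%N by rewrite (leq_trans _ dM) // leq_addr.
have aM : (sumn (addcol n nu) <= M)%N by rewrite sumn_addcol.
have pa := is_partn_addcol n pn.
have e : forall la, is_partn la -> (sumn la <= M)%N -> meval (fun _ => 1) (J la n) = ev_prod n%:R la.
  by move=> la pl lM; rewrite -(lift_Phi Jh) // meval_Phi ev_Jh.
have := e _ pa aM; rewrite (jack_addcol Jh) // mevalZ mevalM e //.
rewrite /en mevalX big1 ?mul1r; last by move=> i _; rewrite expr1n.
have sa : (size (addcol n nu) <= n)%N by rewrite size_addcol.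
rewrite (ev_prodE _ sa) (ev_prodE _ sn) => h.
apply: (mulIf (ev_prod_neq0 sn)); rewrite (ev_prodE _ sn) h -big_split; apply: eq_bigr => i _ /=.
rewrite nth_addcol ltn_ord big_ord_recr /= mulrC; congr (_ * _).
by rewrite addrAC -natrB ?(ltnW (ltn_ord i)) // addrC.
Qed.

End Evaluation.

(** * The norm formula *)

Section Norm.

Variables (F : fieldType) (al : F) (J : seq nat -> symfun F) (M : nat).
Variable Jh : jack_lift al J M.

Local Notation eigen2 := (eigen2 al).
Local Notation nrm := (nrm Jh).
Local Notation pieri_up := (pieri_up Jh).
Local Notation pieri_down := (pieri_down Jh).
Local Notation colfac := (colfac J).

Let J_jack := lift_family Jh.
Let Hpos := lift_positive Jh.
Let natF := pos_nat_neq0 Hpos.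

Lemma lap_expand n D (g : seq nat -> F) (x := \sum_(ka <- partns D D) g ka *: Jh ka) : (D <= M)%N ->
  lap al (Phi n x) (ps_quot x) =
  \sum_(ka <- partns D D) (g ka * (eigen2 ka + 2%:R * (n%:R - 1) * D%:R)) *: J ka n.
Proof.
move=> DM; have hx : x \is D.-homog for mnmwgt.
  rewrite /x big_seq rpred_sum // => ka; rewrite partns_diag => /andP[pk /eqP sk].
  by rewrite rpredZ // -sk lift_homog // sk.
rewrite (lap_Phi _ _ hx DM) {1}/x [D2 al _]linear_sum !Phi_sum scaler_sumr -big_split.
apply: eq_big_seq => ka /=; rewrite partns_diag => /andP[pk /eqP sk].
rewrite [D2 al _]linearZ /= (D2_Jh Jh) ?sk // !PhiZ lift_Phi ?sk // !scalerA -scalerDl.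
by congr (_ *: _); ring.
Qed.

Lemma sum_mderiv_jack n d mu : is_partn mu -> sumn mu = d.+1 -> (d < M)%N ->
  \sum_(i < n) (J mu n)^`M(i) =
  \sum_(ka <- partns d d) (pieri_down mu ka * (n%:R + (eigen2 mu - eigen2 ka) / 2%:R)) *: J ka n.
Proof.
move=> pm sm dM; rewrite -(lift_Phi Jh) ?sm // Phi_lower2 (lower_expand Jh _ pm sm dM).
by rewrite Phi_expand // ltnW.
Qed.

(** The link is e_(n-1): sum_i d_i maps e_n J_nu to e_(n-1) J_nu + e_n sum_i d_i J_nu, and the
    Laplacian of e_(n-1) J_nu involves e_n sum_i d_i J_nu again. Comparing the coefficients of J_ka,
    where ka is nu0 with a column added, determines the lowering coefficient. *)
Lemma pieri_down_addcol n i nu0 nu : is_partn nu0 -> is_partn nu -> (size nu <= n)%N ->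
  boxadd i nu0 nu -> (sumn nu + n <= M)%N ->
  pieri_down (addcol n nu) (addcol n nu0) * (al * (nth 0%N nu i)%:R + (n.-1 - i)%:R) =
  pieri_down nu nu0 * (al * (nth 0%N nu i).+1%:R + (n.-1 - i)%:R).
Proof.
move=> p0 pn sn h dM; have iN := boxadd_size h sn.
have s0 : (size nu0 <= n)%N := leq_trans (boxadd_size_le p0 h) sn.
set d := sumn nu0; have sd : sumn nu = d.+1.
  rewrite (sumn_nth sn) /d (sumn_nth s0); have := boxadd_sum (fun _ a => a) h iN.
  by move: (nth 0%N nu0 i) => a /=; lia.
have pl := is_partn_addcol n pn; have pk := is_partn_addcol n p0.
set la := addcol n nu in pl *; set ka := addcol n nu0 in pk *.
have sla : sumn la = (d + n).+1 by rewrite sumn_addcol // sd.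
have ska : sumn ka = (d + n)%N by rewrite sumn_addcol.
set D := (d + n)%N in sla ska; have DM : (D < M)%N by rewrite /D -addSn -sd.
have dM' : (d < M)%N by apply: leq_trans dM; rewrite sd addSn ltnS leq_addr.
set hf := colfac n nu; have h0 : hf != 0 by apply: (colfac_neq0 Jh).
(* [A] and [B] are the coefficients of J_xi in sum_i d_i J_la and in e_n sum_i d_i J_nu; hence [g]
   holds those of e_(n-1) J_nu. *)
pose A xi := pieri_down la xi * (n%:R + (eigen2 la - eigen2 xi) / 2%:R).
pose B xi := if size xi == n then
  pieri_down nu (rmcol xi) * (n%:R + (eigen2 nu - eigen2 (rmcol xi)) / 2%:R) / colfac n (rmcol xi) else 0.
pose g xi := A xi / hf - B xi; set f := J nu n.
have eB : en F n * \sum_i f^`M(i) = \sum_(xi <- partns D D) B xi *: J xi n.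
  by rewrite (sum_mderiv_jack n pn sd dM') (en_expand Jh) // ltnW.
have eG : Phi n (\sum_(xi <- partns D D) g xi *: Jh xi) = en1 F n * f.
  have := mderiv_sum_en f; rewrite eB => /esym /(canRL (addrK _)) ->.
  have -> : \sum_i (en F n * f)^`M(i) = hf^-1 *: \sum_i (J la n)^`M(i).
    rewrite scaler_sumr; apply: eq_bigr => i' _.
    by rewrite (jack_addcol Jh) // -mderivZ scalerK.
  rewrite (sum_mderiv_jack n pl sla DM) scaler_sumr -sumrB (Phi_expand Jh) ?(ltnW DM) //.
  by apply: eq_bigr => xi _; rewrite scalerA -scalerBl /g /A mulrC.
have nuM : (sumn nu <= M)%N by rewrite sd.
have e1 := lap_expand n g (ltnW DM); have q1 := ps_quotP (N := n) (\sum_(xi <- partns D D) g xi *: Jh xi).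
have q0 := ps_quotP (N := n) (Jh nu); have l0 := lap_Phi al n (lift_homog Jh pn nuM) nuM.
rewrite eG in e1 q1; rewrite (lift_Phi Jh) // -/f in q0 l0.
have e2 := lap_en1 al f (ps_quot (Jh nu)).
rewrite (lap_uniq al (lap_quot_en1 q0) q1) e1 l0 (D2_Jh Jh pn nuM) PhiZ (lift_Phi Jh) // -/f in e2.
rewrite (euler_homog (jack_homog J_jack n pn)) eB -/f sd in e2.
have n1 : n.-1%:R = n%:R - 1 :> F by rewrite -{2}(ltn_predK iN) -natr1 addrK.
(* Two computations of the Laplacian of e_(n-1) J_nu are equated: from its Jack expansion and from
   [lap_en1]. *)
have e3 : \sum_(xi <- partns D D) (g xi * (eigen2 xi - eigen2 la - 2%:R * n.-1%:R) + al *+ 2 * B xi) *: J xi n = 0.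
  have : \sum_(xi <- partns D D) (g xi * (eigen2 xi + 2%:R * (n%:R - 1) * D%:R)) *: J xi n =
     (eigen2 la + 2%:R * n.-1%:R * D.+1%:R) *: \sum_(xi <- partns D D) g xi *: J xi n
     - (al *+ 2) *: \sum_(xi <- partns D D) B xi *: J xi n.
    rewrite e2 -(Phi_expand Jh g n (ltnW DM)) eG; congr (_ - _).
    rewrite scalerAr scalerA -!scalerDl; congr (_ * (_ *: _)).
    by rewrite eigen2_addcol // sd n1 /D -addSn natrD natrM n1; ring.
  move/eqP; rewrite -subr_eq0 => /eqP e4; rewrite -[RHS]e4 !scaler_sumr -!sumrB.
  apply: eq_bigr => xi _; rewrite !scalerA -!scalerBl; congr (_ *: _).
  by rewrite n1 -natr1; ring.
have := jack_indep Jh (ltnW DM) e3 (ka := ka); rewrite partns_diag pk ska eqxx size_addcol => /(_ isT (leqnn _)).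
rewrite /g /A /B size_addcol eqxx addcolK //.
have bK : boxadd i ka la by apply: boxadd_addcol.
rewrite (eigen2_boxadd al pk pl bK) (eigen2_boxadd al p0 pn h) /content nth_addcol iN (h i) eqxx addn1.
set P := pieri_down la ka; set p := pieri_down nu nu0; set a := nth 0%N nu0 i.
have := boxadd_prod (fun j b => al * b%:R + (n - j)%:R) h iN.
rewrite -!(colfacE Jh) //; last by rewrite -/d; lia.
rewrite -/hf; set h1 := colfac n nu0 => eh.
have h1n : h1 != 0 by apply: (colfac_neq0 Jh) => //; rewrite -/d; lia.
have X0 : al * a%:R + (n - i)%:R != 0 by rewrite (pos_lin_neq0 Hpos) //; lia.
move: eh X0; rewrite -/a.
have -> : (n.-1 - i)%:R = n%:R - 1 - i%:R :> F by rewrite natrB ?n1 //; lia.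
have -> : (n - i)%:R = n%:R - i%:R :> F by rewrite natrB // ltnW.
rewrite n1; move: (n%:R : F) (i%:R : F) (eigen2 ka) (eigen2 nu0) => N I E E0.
rewrite -(natr1 a.+1) -!(natr1 a); move: (a%:R : F) => a' eh X0 key.
have key' : (P * (N + al * (a' + 1) - I) / hf - p * (N + al * a' - I) / h1) * (al * (a'+1) - I + N - 1)
   = al * p * (N + al * a' - I) / h1.
  apply: (mulfI (natF 1)); apply/eqP; rewrite -subr_eq0 -oppr_eq0; apply/eqP; rewrite -[RHS]key.
  by field; rewrite h0 h1n natF.
have hfE : hf = h1 * (al * (a' + 1) + (N - I)) / (al * a' + (N - I)).
  by rewrite -eh mulfK.
have Y0 : al * (a' + 1) + (N - I) != 0.
  by apply: contraNneq h0 => y; rewrite hfE y mulr0 mul0r.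
apply: (mulIf X0); apply: (mulIf (invr_neq0 h1n)).
move: key'; rewrite hfE => key'.
apply/eqP; rewrite -subr_eq0; move/eqP: key'; rewrite -subr_eq0 => /eqP key'; apply/eqP; rewrite -[RHS]key'.
by field; rewrite Y0 X0 h1n.
Qed.

(** The second kind of hook factor of j_la, along the first column; [colfacE] is the first kind (see
    [jack_j_addcol]). *)
Definition tcol n (nu : seq nat) : F := \prod_(i < n) (al * (nth 0%N nu i).+1%:R + (n.-1 - i)%:R).

Lemma addcol_nil n : addcol n [::] = nseq n 1%N.
Proof.
apply: (@eq_from_nth _ 0%N) => [|i]; rewrite size_addcol ?size_nseq // => h.
by rewrite nth_addcol h nth_nil nth_nseq h.
Qed.

Lemma lift_nil : Jh [::] = 1.
Proof.
rewrite (wgt0_const (lift_homog Jh (la := [::]) isT isT)).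
have := Jh_p1m Jh (ka := [::]) isT isT.
have -> : p1m M 0 = 0%MM by apply/mnmP => i; rewrite !mnmE if_same.
by move=> ->.
Qed.

Lemma nrm_nil : nrm [::] = 1.
Proof.
rewrite /nrm lift_nil -{1}mpolyX0 bpX mcoeff1 eqxx mul1r /zw big1 // => i _.
by rewrite mnm0E !expr0 fact0 !mulr1.
Qed.

Lemma boxadd_ones_max n i ka : is_partn ka -> boxadd i ka (nseq n.+1 1%N) -> ka = nseq n 1%N.
Proof.
move=> pk h; have i_n : i = n.
  apply/eqP; rewrite eqn_leq -ltnS; have := h i; rewrite eqxx nth_nseq.
  case: ltnP => //= iN e; last by move: e; rewrite addn1.
  rewrite leqNgt; apply/negP => lt; have := partn_nth_anti pk (ltnW lt).
  have := h n; rewrite nth_nseq ltnSn (gtn_eqF lt); move: e; lia.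
apply: partn_nth_eq => // [|j]; first exact: is_partn_nseq1.
have := h j; rewrite i_n !nth_nseq ltnS; case: ltngtP => // _; lia.
Qed.

Lemma boxadd_ones n i mu : is_partn mu -> boxadd i (nseq n 1%N) mu -> mu != nseq n.+1 1%N ->
  content al (nseq n 1%N) i = al.
Proof.
move=> pm h ne; case: (posnP i) => [i0|ip].
  have := h 0%N; rewrite i0 eqxx /content nth_nseq; case: n h ne => [|n] h ne _; last by rewrite mulr1 subr0.
  case/eqP: ne; apply: partn_nth_eq => // j; rewrite h i0 !nth_nseq.
  by case: j.
exfalso; have hi := h i; rewrite eqxx nth_nseq in hi.
have h0 := h 0%N; rewrite eq_sym (gtn_eqF ip) nth_nseq in h0.
have a0 := partn_nth_anti pm (leq0n i).
case: (ltngtP i n) hi => [lt|gt|e] hi.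
- by move: h0 a0; rewrite (leq_ltn_trans _ lt) //; lia.
- have := h n; rewrite nth_nseq ltnn (ltn_eqF gt); have := partn_nth_anti pm (ltnW gt); lia.
case/eqP: ne; apply: partn_nth_eq => // [|j]; first exact: is_partn_nseq1.
by rewrite h e !nth_nseq ltnS; case: ltngtP.
Qed.

(** At most two partitions arise from (1^n) by adding a box, so the two sum rules, total 1 and
    content-weighted total 0, determine the coefficient u of (1^(n+1)): u (alpha + n) = alpha. The
    lowering coefficient is n + 1, as only one box can be removed. *)
Lemma nrm_onesS n : (n < M)%N -> nrm (nseq n.+1 1%N) = n.+1%:R * (al + n%:R) * nrm (nseq n 1%N).
Proof.
move=> nM; have pn := is_partn_nseq1 n; have pn1 := is_partn_nseq1 n.+1.
have s1 : sumn (nseq n.+1 1%N) = (sumn (nseq n 1%N)).+1 by rewrite !sumn_nseq1.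
have sM : (sumn (nseq n.+1 1%N) <= M)%N by rewrite sumn_nseq1.
have nL : nseq n 1%N \in partns n n by rewrite partns_diag pn sumn_nseq1 eqxx.
have nL1 : nseq n.+1 1%N \in partns n.+1 n.+1 by rewrite partns_diag pn1 sumn_nseq1 eqxx.
have down : pieri_down (nseq n.+1 1%N) (nseq n 1%N) = n.+1%:R.
  rewrite -(sum_pieri_down Jh pn1 (sumn_nseq1 _) nM) (bigD1_seq _ nL) ?partns_uniq //=.
  rewrite big_seq_cond big1 ?addr0 // => ka /andP[]; rewrite partns_diag => /andP[pk /eqP sk] ne.
  apply/eqP; apply: contraT => nz; have s' : sumn (nseq n.+1 1%N) = (sumn ka).+1 by rewrite sumn_nseq1 sk.
  by have [i /(boxadd_ones_max pk) e] := pieri_support pn1 pk s' sM nz; rewrite e eqxx in ne.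
have kM : (sumn (nseq n 1%N) < M)%N by rewrite sumn_nseq1.
set u := pieri_up (nseq n 1%N) (nseq n.+1 1%N).
have up : u * (al + n%:R) = al.
  have e1 := sum_pieri_up Jh pn kM; have e2 := sum_pieri_up_eigen2 Jh pn kM.
  rewrite sumn_nseq1 (bigD1_seq _ nL1) ?partns_uniq //= -/u in e1.
  rewrite sumn_nseq1 (bigD1_seq _ nL1) ?partns_uniq //= -/u in e2.
  move: e2; rewrite (@eigen2_boxadd _ al n (nseq n 1%N)) //; last first.
    by move=> j; rewrite -[1%N :: _]/(nseq n.+1 1%N) !nth_nseq ltnS; case: ltngtP.
  rewrite big_seq_cond (eq_bigr (fun mu => pieri_up (nseq n 1%N) mu * (2%:R * al))).
    rewrite -mulr_suml -big_seq_cond (canRL (addKr _) e1) /content nth_nseq ltnn mulr0 => e2.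
    apply: (mulfI (natF 1)); apply/eqP; rewrite -subr_eq0 -oppr_eq0; apply/eqP; rewrite -[RHS]e2; ring.
  move=> mu /andP[]; rewrite partns_diag => /andP[pm /eqP sm] ne.
  case: (eqVneq (pieri_up (nseq n 1%N) mu) 0) => [->|]; first by rewrite !mul0r.
  have s' : sumn mu = (sumn (nseq n 1%N)).+1 by rewrite sm sumn_nseq1.
  have mM : (sumn mu <= M)%N by rewrite sm.
  rewrite -(pieri_down_eq0 Jh) // => nz; have [i hi] := pieri_support pm pn s' mM nz.
  by rewrite (eigen2_boxadd al pn pm hi) (boxadd_ones pm hi ne); congr (_ * _); ring.
have adj := pieri_adjoint Jh pn pn1 s1 sM.
have u0 : u != 0 by rewrite -(pieri_down_eq0 Jh) // down natF.
by apply: (mulfI u0); rewrite /u -adj down -{1}up -/u; ring.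
Qed.

Lemma nrm_ones n : (n <= M)%N -> nrm (addcol n [::]) = colfac n [::] * tcol n [::].
Proof.
move=> nM; rewrite (colfacE Jh) // addcol_nil.
elim: n nM => [|n IH] nM; first by rewrite nrm_nil /tcol !big_ord0 mulr1.
rewrite nrm_onesS // IH ?(ltnW nM) // /tcol !big_ord_recl /= subn0 mulr0 add0r mulr1 subn0.
have -> : \prod_(i < n) (0 + (n.+1 - bump 0 i)%:R) = \prod_(i < n) (al * (nth 0%N [::] i)%:R + (n - i)%:R) :> F.
  by apply: eq_bigr => i _; rewrite nth_nil mulr0 /bump /= add1n subSS.
have -> : \prod_(i < n) (al + (n - bump 0 i)%:R) = \prod_(i < n) (al * (nth 0%N [::] i).+1%:R + (n.-1 - i)%:R).
  by apply: eq_bigr => i _; rewrite nth_nil mulr1 /bump /= add1n subnS -subn1 subnAC subn1.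
by ring.
Qed.

(** Adjointness, used before and after adding the column, expresses two ratios of norms by Pieri
    coefficients. Those going up are compared in [pieri_up_addcol], those going down in
    [pieri_down_addcol]. *)
Lemma nrm_addcol n nu : is_partn nu -> (size nu <= n)%N -> (sumn nu + n <= M)%N ->
  nrm (addcol n nu) = nrm nu * colfac n nu * tcol n nu.
Proof.
move e : (sumn nu) => d; elim: d nu e => [|d IH] nu sd pn sn dM.
  have -> : nu = [::] by apply/size0nil/eqP; rewrite -leqn0 -sd size_partn.
  by rewrite nrm_ones // nrm_nil mul1r.
have dM' : (d < M)%N by rewrite (leq_trans _ dM) // leq_addr.
have nuM : (sumn nu <= M)%N by rewrite sd.
(* Some lowering coefficient is nonzero because they add up to d + 1. *)
have [nu0 [p0 s0 nz]] : exists nu0, [/\ is_partn nu0, sumn nu0 = d & pieri_down nu nu0 != 0].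
  have := sum_pieri_down Jh pn sd dM'; case: (boolP (has (fun x => pieri_down nu x != 0) (partns d d))).
    by case/hasP => x; rewrite partns_diag => /andP[px /eqP sx] nz _; exists x.
  move/hasPn => z; rewrite big_seq big1 => [/esym/eqP|x /z]; first by rewrite (negbTE (natF d)).
  by rewrite negbK => /eqP.
have sS : sumn nu = (sumn nu0).+1 by rewrite sd s0.
have [i hi] := pieri_support pn p0 sS nuM nz.
have iN := boxadd_size hi sn.
have sn0 : (size nu0 <= n)%N := leq_trans (boxadd_size_le p0 hi) sn.
have dMn : (sumn nu + n <= M)%N by rewrite sd.
have dM0 : (sumn nu0 + n <= M)%N by rewrite s0; lia.
have h0 := colfac_neq0 Jh p0 sn0 dM0; have h1 := colfac_neq0 Jh pn sn dMn.
have u0 := nz; rewrite (pieri_down_eq0 Jh) // in u0.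
have adj := pieri_adjoint Jh p0 pn sS nuM.
have adj2 := pieri_adjoint Jh (is_partn_addcol n p0) (is_partn_addcol n pn).
rewrite !sumn_addcol // sS addSn in adj2; move: adj2; rewrite -addSn -sS => /(_ erefl dMn).
rewrite (pieri_up_addcol Jh p0 pn sn0 sn sS dMn) IH // ?s0 -?s0 // => adj2.
have rel := pieri_down_addcol p0 pn sn hi dMn.
have et := boxadd_prod (fun j b => al * b.+1%:R + (n.-1 - j)%:R) hi iN.
rewrite -/(tcol n nu) -/(tcol n nu0) in et.
have nui : nth 0%N nu i = (nth 0%N nu0 i).+1 by rewrite hi eqxx addn1.
rewrite -nui in et.
move: rel et; set x := _ + (n.-1 - i)%:R; set y := _ + (n.-1 - i)%:R => rel et.
have x0 : x != 0 by rewrite /x (pos_lin_neq0 Hpos) // nui.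
apply: (mulIf (mulf_neq0 (mulf_neq0 h0 u0) x0)).
transitivity (x * colfac n nu * (colfac n nu0 * pieri_up nu0 nu / colfac n nu * nrm (addcol n nu))).
  by field; exact: h1.
rewrite -adj2.
transitivity (pieri_down (addcol n nu) (addcol n nu0) * x * (al * nrm nu0 * colfac n nu0 * tcol n nu0 * colfac n nu)).
  by ring.
rewrite rel.
transitivity ((al * pieri_down nu nu0 * nrm nu0) * colfac n nu0 * colfac n nu * (tcol n nu0 * y)); first by ring.
rewrite adj -et; ring.
Qed.

End Norm.

Lemma box_prodE (F : fieldType) N la (w : nat -> nat -> F) : (size la <= N)%N ->
  box_prod la w = \prod_(i < N) \prod_(j < nth 0%N la i) w i.+1 j.+1.
Proof.
move=> sN; rewrite /box_prod big_add1 /= big_mkord.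
rewrite (big_ord_widen N (fun i => \prod_(1 <= j < (part la i.+1).+1) w i.+1 j)) // big_mkcond.
apply: eq_bigr => i _; case: ltnP => h; last by rewrite nth_default // big_ord0.
by rewrite big_add1 /= big_mkord.
Qed.

Lemma gen_poch_boxadd (F : fieldType) (al a : F) i ka mu : al != 0 -> is_partn ka -> boxadd i ka mu ->
  gen_poch al a mu = gen_poch al a ka * (a + content al ka i / al).
Proof.
move=> al0 pk h; have iN := boxadd_size h (leqnn _).
rewrite /gen_poch (box_prodE _ (leqnn _)) (box_prodE _ (boxadd_size_le pk h)).
rewrite (bigD1 (Ordinal iN)) //= [in RHS](bigD1 (Ordinal iN)) //= (h i) eqxx addn1.
rewrite big_ord_recr /= /content.
set X := \prod_(j < size mu | _) _; set Y := \prod_(j < size mu | _) _.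
have -> : X = Y.
  by apply: eq_bigr => j; rewrite -val_eqE /= => /negbTE ji; rewrite h ji addn0.
set Z := \prod_(j < _) _; rewrite -!natr1; field; exact: al0.
Qed.

(** * Identification of the norm with j_la *)

Section NormFormula.

Variables (F : fieldType) (al : F) (J : seq nat -> symfun F) (M : nat).
Variable Jh : jack_lift al J M.

Lemma conj_partE N s j : (size s <= N)%N -> conj_part s j.+1 = (\sum_(i < N) (j < nth 0 s i))%N.
Proof.
move=> sN; rewrite /conj_part -sum1_count big_mkcond (big_nth 0%N) big_mkord.
rewrite (big_ord_widen N (fun i => if (j < nth 0 s i)%N then 1 else 0)%N) // big_mkcond.
by apply: eq_bigr => i _; case: ltnP => h; [case: (_ < _)%N | rewrite nth_default].
Qed.

(** Boxes outside the first column keep arm and leg when shifted by one column. *)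
Lemma jack_j_addcol n nu : is_partn nu -> (size nu <= n)%N -> (sumn nu + n <= M)%N ->
  jack_j al (addcol n nu) = jack_j al nu * colfac J n nu * tcol al n nu.
Proof.
move=> pn sn dM; rewrite (colfacE Jh) // /tcol /jack_j (@box_prodE _ n) ?size_addcol //.
rewrite (box_prodE _ sn) -!big_split; apply: eq_bigr => i _ /=.
have iN := ltn_ord i.
rewrite nth_addcol iN big_ord_recl /= mulrC -mulrA; congr (_ * _).
  apply: eq_bigr => j _; rewrite /part /= nth_addcol iN /bump /= add1n.
  rewrite (@conj_partE n (addcol n nu)) ?size_addcol // (conj_partE _ sn).
  rewrite (eq_bigr (fun k : 'I_n => (j < nth 0 nu k)%N : nat)); last first.
    by move=> k _; rewrite nth_addcol ltn_ord.
  by rewrite -!natr1; congr (_ * _); ring.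
rewrite /part /= nth_addcol iN (@conj_partE n (addcol n nu)) ?size_addcol //.
rewrite (eq_bigr (fun _ => 1%N)) => [|k _]; last by rewrite nth_addcol ltn_ord.
rewrite sum_nat_const card_ord muln1.
have -> : (n - i)%:R = n%:R - i%:R :> F by rewrite natrB // ltnW.
have -> : (n.-1 - i)%:R = n%:R - i%:R - 1 :> F.
  by have -> : (n.-1 - i = n - i.+1)%N; [lia | rewrite natrB // -natr1 opprD addrA].
by rewrite -!natr1; congr (_ * _); ring.
Qed.

Lemma nrm_jack_j la : is_partn la -> (sumn la <= M)%N -> nrm Jh la = jack_j al la.
Proof.
have [e] := ubnP (sumn la); elim: e la => // e IH la; rewrite ltnS => le pl lM.
case: (posnP (size la)) => [/size0nil ->|s0]; first by rewrite nrm_nil /jack_j /box_prod big_geq.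
have pr := is_partn_rmcol pl; have sr := size_rmcol la.
have sE : sumn la = (sumn (rmcol la) + size la)%N by rewrite -{1}(rmcolK pl) sumn_addcol.
rewrite -(rmcolK pl) nrm_addcol -?sE // jack_j_addcol -?sE // IH //; lia.
Qed.

Lemma jack_j_neq0 la : is_partn la -> (sumn la <= M)%N -> jack_j al la != 0.
Proof. by move=> pl lM; rewrite -nrm_jack_j // nrm_neq0. Qed.

(** By adjointness u(la, mu) / j_la is alpha / j_mu times the lowering coefficient, which reduces
    the sum to [sum_pieri_down]. *)
Lemma sum_pieri_up_norm d mu : is_partn mu -> sumn mu = d.+1 -> (d < M)%N ->
  \sum_(la <- partns d d) pieri_up Jh la mu * (al ^+ d / jack_j al la) =
  d.+1%:R * (al ^+ d.+1 / jack_j al mu).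
Proof.
move=> pm sm dM; rewrite -(sum_pieri_down Jh pm sm dM) mulr_suml; apply: eq_big_seq => la.
rewrite partns_diag => /andP[pl /eqP sl].
have lM : (sumn la <= M)%N by rewrite sl ltnW.
have mM : (sumn mu <= M)%N by rewrite sm.
have s : sumn mu = (sumn la).+1 by rewrite sm sl.
have j0 := jack_j_neq0 pl lM; have j1 := jack_j_neq0 pm mM.
have := pieri_adjoint Jh pl pm s mM; rewrite !nrm_jack_j // => adj.
apply: (mulIf (mulf_neq0 j0 j1)).
transitivity (pieri_up Jh la mu * jack_j al mu * al ^+ d); first by field.
rewrite -adj exprS; field; exact: j1.
Qed.

End NormFormula.

(** * Power sum expansions as polynomials in M variables *)

Section PowerSumBasis.

Variables (F : fieldType).

Definition cnt M (nu : seq nat) : 'X_{1..M} := [multinom count_mem i.+1 nu | i < M].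

Lemma partn_entries nu : is_partn nu -> all (fun r => 0 < r <= sumn nu)%N nu.
Proof.
case/andP=> _ n0; apply/allP => r rn; rewrite lt0n; apply/andP; split.
  by apply: contraNneq n0 => <-.
by elim: nu rn {n0} => //= a s IH; rewrite in_cons => /orP[/eqP ->|/IH]; lia.
Qed.

Lemma prod_cnt (R : comPzRingType) M (nu : seq nat) (f : nat -> R) :
  all (fun r => 0 < r <= M)%N nu ->
  \prod_(r <- nu) f r = \prod_(i < M) f i.+1 ^+ cnt M nu i.
Proof.
elim: nu => [|a s IH] /=; first by rewrite big_nil big1 // => i _; rewrite mnmE expr0.
case/andP=> /andP[a0 aM] /IH h; rewrite big_cons h.
have lt : (a.-1 < M)%N by rewrite prednK.
rewrite [in RHS](bigD1 (Ordinal lt)) //= (bigD1 (Ordinal lt)) //= !mnmE /= prednK // eqxx exprS -mulrA.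
congr (_ * (_ * _)); apply: eq_bigr => i; rewrite -val_eqE /= => ne; rewrite !mnmE /=.
suff -> : (a == i.+1) = false by [].
by apply: contraNF ne => /eqP ->.
Qed.

Lemma mnmwgt_cnt M nu : all (fun r => 0 < r <= M)%N nu -> mnmwgt (cnt M nu) = sumn nu.
Proof.
rewrite /mnmwgt; elim: nu => [|a s IH] /=; first by rewrite big1 // => i _; rewrite mnmE mul0n.
case/andP=> /andP[a0 aM] /IH <-; have lt : (a.-1 < M)%N by rewrite prednK.
rewrite (bigD1 (Ordinal lt)) //= [in RHS](bigD1 (Ordinal lt)) //= !mnmE /= prednK // eqxx mulnDl mul1n -addnA.
congr (_ + (_ + _))%N; apply: eq_bigr => i; rewrite -val_eqE /= => ne; rewrite !mnmE /=.
suff -> : (a == i.+1) = false by [].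
by apply: contraNF ne => /eqP ->.
Qed.

Lemma cnt_inj M nu nu' : is_partn nu -> is_partn nu' -> (sumn nu <= M)%N -> (sumn nu' <= M)%N ->
  cnt M nu = cnt M nu' -> nu = nu'.
Proof.
move=> p1 p2 m1 m2 e; rewrite -(pt_partn p1) -(pt_partn p2); apply: eq_pt.
apply/allP => r; rewrite mem_cat => h /=.
have /andP[r0 rM] : (0 < r <= M)%N.
  case/orP: h => h; [have /allP/(_ _ h) := partn_entries p1 | have /allP/(_ _ h) := partn_entries p2]; lia.
have lt : (r.-1 < M)%N by rewrite prednK.
by have := congr1 (fun m : 'X_{1..M} => m (Ordinal lt)) e; rewrite !mnmE /= prednK // => ->.
Qed.

Lemma zw_cnt (al : F) M nu : is_partn nu -> (sumn nu <= M)%N ->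
  zw al (cnt M nu) = (zpart nu)%:R * al ^+ size nu.
Proof.
move=> pn nM; have ent : all (fun r => 0 < r <= M)%N nu.
  by apply: sub_all (partn_entries pn) => r; lia.
have -> : al ^+ size nu = \prod_(r <- nu) al by rewrite big_const_seq count_predT iter_mulr_1.
rewrite (prod_cnt _ ent) /zpart natr_prod.
have -> : \prod_(r <- undup nu) ((r ^ count_mem r nu * (count_mem r nu)`!)%N%:R : F) =
    \prod_(i < M) (i.+1 ^ cnt M nu i * (cnt M nu i)`!)%N%:R.
  rewrite (perm_big [seq r <- iota 1 M | r \in nu]) /=; last first.
    apply: uniq_perm; rewrite ?undup_uniq ?filter_uniq ?iota_uniq // => r.
    rewrite mem_undup mem_filter mem_iota add1n ltnS; case h : (r \in nu) => //=.
    by rewrite (allP ent _ h).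
  have -> : iota 1 M = index_iota 1 M.+1 by rewrite /index_iota subn1.
  rewrite big_filter big_mkcond big_add1 /= big_mkord.
  apply: eq_bigr => i _; rewrite mnmE; case: ifP => // /negbT /count_memPn ->.
  by rewrite expn0 fact0.
rewrite -big_split; apply: eq_bigr => i _ /=.
by rewrite exprMn natrM natrX mulrAC.
Qed.

Lemma Phi_cnt M N nu : is_partn nu -> (sumn nu <= M)%N ->
  Phi N ('X_[cnt M nu] : {mpoly F[M]}) = power_sum F nu N.
Proof.
move=> pn nM; rewrite Phi_X -(prod_cnt (psum F N)) //.
by apply: sub_all (partn_entries pn) => r; lia.
Qed.

Definition ps_lift M d (u : seq nat -> F) : {mpoly F[M]} :=
  \sum_(nu <- partns d d) u nu *: 'X_[cnt M nu].

Lemma ps_lift_homog M d u : (d <= M)%N -> ps_lift M d u \is d.-homog for mnmwgt.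
Proof.
move=> dM; rewrite /ps_lift big_seq rpred_sum // => nu; rewrite partns_diag => /andP[pn /eqP sn].
rewrite rpredZ // dhomogX /= mnmwgt_cnt ?sn //.
by apply: sub_all (partn_entries pn) => r; lia.
Qed.

Lemma Phi_ps_lift M N d u : (d <= M)%N ->
  Phi N (ps_lift M d u) = \sum_(nu <- partns d d) u nu *: power_sum F nu N.
Proof.
move=> dM; rewrite Phi_sum; apply: eq_big_seq => nu; rewrite partns_diag => /andP[pn /eqP sn].
by rewrite PhiZ Phi_cnt // sn.
Qed.

Lemma ps_lift_coeff M d u nu : (d <= M)%N -> nu \in partns d d -> (ps_lift M d u)@_(cnt M nu) = u nu.
Proof.
move=> dM nL; rewrite mcoeff_bigsum.
rewrite (eq_big_seq (fun mu => u mu * (nu == mu)%:R)); first by rewrite sum_delta_seq ?partns_uniq // nL.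
move: nL; rewrite partns_diag => /andP[pn /eqP sn] mu; rewrite partns_diag => /andP[pm /eqP sm].
rewrite mcoeffZ mcoeffX; congr (_ * _%:R); congr nat_of_bool.
by apply/eqP/eqP => [|->//] e; apply: (cnt_inj (M := M)); rewrite ?sn ?sm.
Qed.

Lemma bp_ps_lift (al : F) M d u v : (d <= M)%N -> bp al (ps_lift M d u) (ps_lift M d v) =
  \sum_(nu <- partns d d) u nu * v nu * (zpart nu)%:R * al ^+ size nu.
Proof.
move=> dM; rewrite {1}/ps_lift bp_suml; apply: eq_big_seq => nu nL.
rewrite bpZl bpX ps_lift_coeff //; move: nL; rewrite partns_diag => /andP[pn /eqP sn].
by rewrite zw_cnt ?sn // !mulrA.
Qed.

Lemma power_sum_homog nu N : power_sum F nu N \is (sumn nu).-homog.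
Proof.
elim: nu => [|a s IH]; first by rewrite /power_sum big_nil dhomog1.
by rewrite /power_sum big_cons /=; apply: dhomogM => //; exact: psum_homog.
Qed.

(** Expansions supplied by [jack_pairing] may a priori mix degrees; the projection isolates one of
    them. *)
Lemma expansion_homog f D u d N : power_sum_expansion f D u ->
  pihomog mdeg d (f N) = if (d < D)%N then \sum_(nu <- partns d d) u nu *: power_sum F nu N else 0.
Proof.
move=> h; rewrite h linear_sum /=.
rewrite (eq_bigr (fun e : 'I_D => if d == e :> nat then \sum_(nu <- partns e e) u nu *: power_sum F nu N else 0)).
  case: ltnP => dD.
    rewrite (bigD1 (Ordinal dD)) //= eqxx [X in _ + X]big1 ?addr0 // => e; rewrite -val_eqE /= eq_sym.
    by move=> /negbTE ->.
  rewrite big1 // => e _; case: eqP => // ed; by have := ltn_ord e; rewrite -ed ltnNge dD.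
move=> e _; have hom : \sum_(nu <- partns e e) u nu *: power_sum F nu N \is (e : nat).-homog.
  rewrite big_seq rpred_sum // => nu; rewrite partns_diag => /andP[_ /eqP sn].
  by rewrite rpredZ // -sn power_sum_homog.
case: eqP => [->|/eqP ne]; first by rewrite pihomog_dE.
by rewrite (pihomog_ne0 _ hom) // eq_sym.
Qed.

End PowerSumBasis.

(** * Existence of lifts for a given Jack family *)

Section LiftExistence.

Variables (F : fieldType) (al : F) (J : seq nat -> symfun F) (M : nat).
Hypotheses (J_jack : jack_family al J) (Hpos : positive_param al).

Let natF := pos_nat_neq0 Hpos.

Lemma bp_homog_neq d e (f g : {mpoly F[M]}) : f \is d.-homog for mnmwgt -> g \is e.-homog for mnmwgt ->
  d != e -> bp al f g = 0.
Proof.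
move=> hf hg ne; rewrite /bp big_seq big1 // => m /(dhomog_mf hf) md.
by rewrite (dhomog_nemf_coeff hg) ?mulr0 ?mul0r // md.
Qed.

(** An expansion is extracted from an orthogonality statement, so some partition other than la has
    to be supplied as partner. *)
Lemma jack_expand la : is_partn la -> exists D u, power_sum_expansion (J la) D u.
Proof.
move=> pl; have [_ orth] := J_jack; pose mu := if la == [::] then [:: 1%N] else [::].
have pm : is_partn mu by rewrite /mu; case: ifP.
have ne : la != mu by rewrite /mu; case: (altP (la =P [::])) => [->|].
by have [D [u [v [h _ _]]]] := orth la mu pl pm ne; exists D, u.
Qed.

Lemma jack_lift_poly la D u : is_partn la -> (sumn la <= M)%N -> power_sum_expansion (J la) D u ->
  forall N, Phi N (ps_lift M (sumn la) (if (sumn la < D)%N then u else fun _ => 0)) = J la N.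
Proof.
move=> pl lM h N; rewrite Phi_ps_lift // -[RHS](pihomog_dE (jack_homog J_jack N pl)) (expansion_homog _ _ h).
by case: ifP => // _; rewrite big1 // => nu _; rewrite scale0r.
Qed.

Lemma expansion_eq0 la D u d nu : is_partn la -> power_sum_expansion (J la) D u -> (d < D)%N ->
  d != sumn la -> nu \in partns d d -> u nu = 0.
Proof.
move=> pl h dD ne nL; rewrite -(ps_lift_coeff u (leqnn d) nL) (_ : ps_lift d d u = 0) ?mcoeff0 //.
apply: (Phi_inj natF); rewrite Phi_ps_lift //.
have := expansion_homog d d h; rewrite dD => <-.
by apply: (pihomog_ne0 _ (jack_homog J_jack d pl)); rewrite eq_sym.
Qed.

Lemma jack_lift_exists : exists Jh : jack_lift al J M, True.
Proof.
pose L := flatten [seq partns d d | d <- iota 0 M.+1].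
have memL la : is_partn la -> (sumn la <= M)%N -> la \in L.
  move=> pl lM; apply/flattenP; exists (partns (sumn la) (sumn la)); last by rewrite partns_diag pl /=.
  by apply/mapP; exists (sumn la); rewrite ?mem_iota ?add0n ?ltnS.
have Lmem la : la \in L -> is_partn la /\ (sumn la <= M)%N.
  case/flattenP=> s /mapP[d]; rewrite mem_iota add0n ltnS => /andP[_ dM] ->.
  by rewrite partns_diag => /andP[pl /eqP ->].
have [Jh hJ] : exists Jh : seq nat -> {mpoly F[M]}, forall la, la \in L ->
    Jh la \is (sumn la).-homog for mnmwgt /\ forall N, Phi N (Jh la) = J la N.
  apply: (finite_choice 0 (P := fun la g => g \is (sumn la).-homog for mnmwgt /\ forall N, Phi N g = J la N)).
  move=> la /Lmem[pl lM]; have [D [u h]] := jack_expand pl.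
  exists (ps_lift M (sumn la) (if (sumn la < D)%N then u else fun _ => 0)).
  by split; [exact: ps_lift_homog | exact: jack_lift_poly].
have homJ la : is_partn la -> (sumn la <= M)%N -> Jh la \is (sumn la).-homog for mnmwgt.
  by move=> pl lM; have [] := hJ la (memL _ pl lM).
have PhiJ la N : is_partn la -> (sumn la <= M)%N -> Phi N (Jh la) = J la N.
  by move=> pl lM; have [] := hJ la (memL _ pl lM).
have orthJ la mu : is_partn la -> is_partn mu -> (sumn la <= M)%N -> (sumn mu <= M)%N ->
    la != mu -> bp al (Jh la) (Jh mu) = 0.
  move=> pl pm lM mM ne.
  case: (eqVneq (sumn la) (sumn mu)) => [s|]; last exact: bp_homog_neq (homJ _ pl lM) (homJ _ pm mM).
  have [_ orth] := J_jack; have [D [u [v [hu hv e]]]] := orth la mu pl pm ne.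
  (* The expansions witnessing the pairing need not be those chosen for [Jh]; injectivity of [Phi M]
     identifies their parts of degree |x|. *)
  have lE x w : is_partn x -> (sumn x <= M)%N -> power_sum_expansion (J x) D w ->
      Jh x = ps_lift M (sumn x) (if (sumn x < D)%N then w else fun _ => 0).
    move=> px xM hw; apply/eqP; rewrite -subr_eq0; apply/eqP/(Phi_inj natF).
    by rewrite PhiB PhiJ // jack_lift_poly // subrr.
  rewrite (lE _ _ pl lM hu) (lE _ _ pm mM hv) -s bp_ps_lift //.
  case: ltnP => dD; last by rewrite big1 // => nu _; rewrite !mul0r.
  rewrite [RHS]e (bigD1 (Ordinal dD)) //= [X in _ = _ + X]big1 ?addr0 // => d; rewrite -val_eqE /= => nd.
  by rewrite big_seq big1 // => nu nL; rewrite (expansion_eq0 pl hu (ltn_ord d) nd nL) !mul0r.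
by exists (JackLift J_jack Hpos homJ PhiJ orthJ).
Qed.

End LiftExistence.

(** * The operator R and the series *)

Lemma frac_repr (R : idomainType) (x : {fraction R}) :
  exists a b : R, b != 0 /\ x * tofrac b = tofrac a.
Proof.
elim/quotW: x => x; exists (frac x).1, (frac x).2; split; first exact: denom_ratioP.
unlock FracField.tofrac; apply: etrans (esym (FracField.pi_mul _ _)) _.
apply/eqmodP; rewrite /= FracField.equivfE /FracField.mulf !numden_Ratio ?oner_eq0 ?mulf_neq0 ?denom_ratioP //.
by rewrite !mulr1 mulrC.
all: exact: oner_neq0.
Qed.

(* Evaluating the numerators at the positive integers makes every summand nonnegative. *)
Lemma alpha_positive : positive_param alpha.
Proof.
move=> T z e w z0 h t.
have [D [P [D0 hP]]] : exists (D : {poly rat}) (P : T -> {poly rat}),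
    D != 0 /\ forall s, w s * tofrac D = tofrac (P s).
  have /fin_all_exists2[q q0 hq] :
      forall s, exists2 q : {poly rat} * {poly rat}, q.2 != 0 & w s * tofrac q.2 = tofrac q.1.
    by move=> s; have [a [b [b0 hb]]] := frac_repr (w s); exists (a, b).
  pose a s := (q s).1; pose b s := (q s).2.
  exists (\prod_s b s), (fun s => a s * \prod_(r | r != s) b r); split.
    by apply/prodf_neq0 => s _; exact: q0.
  by move=> s; rewrite (bigD1 s) //= !rmorphM /= mulrA hq.
have hS : \sum_s (z s)%:R * 'X ^+ e s * P s ^+ 2 = 0 :> {poly rat}.
  apply/eqP; rewrite -tofrac_eq0 rmorph_sum /=; apply/eqP.
  transitivity ((\sum_s (z s)%:R * alpha ^+ e s * w s ^+ 2) * tofrac D ^+ 2); last by rewrite h mul0r.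
  rewrite mulr_suml; apply: eq_bigr => s _.
  rewrite !expr2 !tofracM tofracXn tofracMn tofrac1 -(hP s) -/alpha [in RHS]mulrACA.
  by rewrite -!mulrA; congr (_ * (_ * _)); rewrite mulrCA.
have Pk k : (P t).[k.+1%:R] = 0.
  have := congr1 (fun p : {poly rat} => p.[k.+1%:R]) hS; rewrite horner0 horner_sum => /eqP.
  have E s : ((z s)%:R * 'X ^+ e s * P s ^+ 2).[k.+1%:R] = (z s)%:R * k.+1%:R ^+ e s * (P s).[k.+1%:R] ^+ 2.
    by rewrite !hornerM !horner_exp hornerX -polyC_natr hornerC.
  rewrite (eq_bigr _ (fun s _ => E s)) Num.Theory.psumr_eq0; last first.
    move=> s _; apply: Num.Theory.mulr_ge0; last exact: Num.Theory.sqr_ge0.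
    by apply: Num.Theory.mulr_ge0; rewrite ?Num.Theory.exprn_ge0 ?Num.Theory.ler0n.
  move/allP/(_ t); rewrite mem_index_enum => /(_ isT) /=; rewrite !mulf_eq0.
  rewrite Num.Theory.pnatr_eq0 -leqn0 leqNgt z0 expf_eq0 Num.Theory.pnatr_eq0 andbF /=.
  by rewrite orbb => /eqP.
have P0 : P t = 0.
  apply/eqP; apply: contraT => Pn0.
  have := max_poly_roots (rs := [seq k.+1%:R | k <- iota 0 (size (P t))]) Pn0.
  rewrite size_map size_iota ltnn; apply.
    by apply/allP => x /mapP[k _ ->]; rewrite rootE Pk.
  rewrite map_inj_uniq ?iota_uniq // => i j /eqP.
  by rewrite Num.Theory.eqr_nat => /eqP[->].
have := hP t; rewrite P0 rmorph0 => /eqP; rewrite mulf_eq0 tofrac_eq0 (negbTE D0) orbF.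
by move/eqP.
Qed.

(** * The commutator of the Laplacian with A = sum_i x_i^2 d_i *)

Section RaiseOperator.

Variables (F : fieldType) (al : F) (N : nat).
Implicit Types (f g : {mpoly F[N]}).

Definition raise f : {mpoly F[N]} := \sum_i 'X_i ^+ 2 * f^`M(i).

Let del i f : {mpoly F[N]} := 'X_i ^+ 2 * f^`M(i).

Lemma mderivXi_neq i j : i != j -> ('X_j)^`M(i) = 0 :> {mpoly F[N]}.
Proof.
by move=> ij; rewrite mderivX mnm1E eq_sym (negbTE ij) scale0r.
Qed.

Lemma del_mul i f g : del i (f * g) = del i f * g + f * del i g.
Proof. by rewrite /del mderivM; ring. Qed.

Lemma del_comm i j f : del i (del j f) = del j (del i f).
Proof.
rewrite /del; case: (eqVneq i j) => [->//|ij].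
rewrite !expr2 !mderivM !mderivXi_neq // 1?eq_sym // (mderiv_comm i j); ring.
Qed.

Lemma raiseE f : raise f = \sum_i del i f. Proof. by []. Qed.

Lemma delB i f g : del i (f - g) = del i f - del i g.
Proof. by rewrite /del mderivB mulrBr. Qed.

Lemma del_sum i (I : Type) (r : seq I) (P : pred I) (h : I -> {mpoly F[N]}) :
  del i (\sum_(k <- r | P k) h k) = \sum_(k <- r | P k) del i (h k).
Proof. by rewrite /del raddf_sum mulr_sumr. Qed.

Lemma raise_mul f g : raise (f * g) = raise f * g + f * raise g.
Proof.
rewrite /raise mulr_suml mulr_sumr -big_split; apply: eq_bigr => i _; exact: del_mul.
Qed.

Lemma del_raise i f : del i (raise f) = raise (del i f).
Proof. by rewrite raiseE del_sum raiseE; apply: eq_bigr => j _; exact: del_comm. Qed.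

Lemma raiseB f g : raise (f - g) = raise f - raise g.
Proof. by rewrite !raiseE -sumrB; apply: eq_bigr => i _; exact: delB. Qed.

Lemma raise_X i : raise 'X_i = 'X_i ^+ 2.
Proof.
rewrite /raise (bigD1 i) //= mderivXi mulr1 big1 ?addr0 // => j ji.
by rewrite mderivXi_neq // mulr0.
Qed.

(** A commutes with each x_i^2 d_i, and A (x_i - x_j) = (x_i - x_j)(x_i + x_j); applying A to the
    relation for q gives this quotient for A f. *)
Definition raise_quot (f : {mpoly F[N]}) (q : 'I_N -> 'I_N -> {mpoly F[N]}) i j :=
  ('X_i + 'X_j) * q i j + raise (q i j).

Lemma lap_quot_raise f q : lap_quot f q -> lap_quot (raise f) (raise_quot f q).
Proof.
move=> h i j; rewrite -!/(del _ _) !del_raise -raiseB /raise_quot.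
have -> : del i f - del j f = ('X_i - 'X_j) * q i j by rewrite h.
by rewrite raise_mul raiseB !raise_X; ring.
Qed.

(** By [crossP] this is 2 x_i x_j (x_i d_i f - x_j d_j f) / (x_i - x_j), the interaction term of
    R(a, b) symmetrized in i and j. *)
Definition cross (f : {mpoly F[N]}) (q : 'I_N -> 'I_N -> {mpoly F[N]}) i j : {mpoly F[N]} :=
  ('X_i + 'X_j) * q i j - ('X_i ^+ 2 * f^`M(i) + 'X_j ^+ 2 * f^`M(j)).

Lemma crossP f q i j : lap_quot f q ->
  ('X_i - 'X_j) * cross f q i j = 2%:R *: ('X_i * 'X_j * ('X_i * f^`M(i) - 'X_j * f^`M(j))).
Proof.
move=> h; rewrite /cross mulrBr mulrCA h scaler_nat; ring.
Qed.

Definition cubic f : {mpoly F[N]} := \sum_i 'X_i ^+ 3 * f^`M(i)^`M(i).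

Lemma sum_pairs_del f : \sum_i \sum_(j | j != i) (del i f + del j f) = (raise f *+ N.-1) *+ 2.
Proof.
under eq_bigr => i _ do rewrite big_split /= sumr_const cardC1 card_ord.
rewrite big_split /= sumrMnl -/(raise f).
have -> : \sum_i \sum_(j | j != i) del j f = raise f *+ N.-1.
  rewrite (exchange_big_dep predT) //= /raise -sumrMnl; apply: eq_bigr => j _.
  rewrite (eq_bigl (fun i => i != j)) => [|i]; last by rewrite eq_sym.
  by rewrite sumr_const cardC1 card_ord.
by rewrite mulr2n.
Qed.

Lemma lap_raise f q : lap al (raise f) (raise_quot f q) =
  raise (lap al f q) + (al *+ 2) *: (raise f + cubic f)
  + \sum_i \sum_(j | j != i) cross f q i j + (raise f *+ N.-1) *+ 2.
Proof.
rewrite -sum_pairs_del /lap.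
have raiseD u v : raise (u + v) = raise u + raise v.
  by rewrite !raiseE -big_split; apply: eq_bigr => i _; rewrite /del mderivD mulrDr.
have raiseZ c u : raise (c *: u) = c *: raise u.
  by rewrite !raiseE scaler_sumr; apply: eq_bigr => i _; rewrite /del mderivZ scalerAr.
have raise_sum (I : Type) (r : seq I) (P : pred I) (h : I -> {mpoly F[N]}) :
  raise (\sum_(k <- r | P k) h k) = \sum_(k <- r | P k) raise (h k).
  by rewrite raiseE; under eq_bigr => i _ do rewrite del_sum; rewrite exchange_big.
rewrite raiseD raiseZ !raise_sum.
have E i : 'X_i ^+ 2 * (raise f)^`M(i)^`M(i) =
    raise ('X_i ^+ 2 * f^`M(i)^`M(i)) + (del i f + 'X_i ^+ 3 * f^`M(i)^`M(i)) *+ 2.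
  rewrite raiseE (bigD1 i) //= !mderivD mulrDr [in RHS]raiseE [in RHS](bigD1 i) //=.
  set S := \sum_(j | _) _; set S' := \sum_(j | _) _.
  have -> : 'X_i ^+ 2 * S^`M(i)^`M(i) = S'.
    have Dsum (h : 'I_N -> {mpoly F[N]}) : (\sum_(j | j != i) h j)^`M(i) = \sum_(j | j != i) (h j)^`M(i).
      exact: raddf_sum.
    rewrite /S !Dsum mulr_sumr; apply: eq_bigr => j ji.
    have dX k l (u : {mpoly F[N]}) : k != l -> ('X_l ^+ 2 * u)^`M(k) = 'X_l ^+ 2 * u^`M(k).
      by move=> kl; rewrite expr2 !mderivM mderivXi_neq //; ring.
    rewrite /del !dX // 1?eq_sym //; first by rewrite mulrCA (mderiv_comm j i) (mderiv_comm j i).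
  have dX2 (u : {mpoly F[N]}) : ('X_i ^+ 2 * u)^`M(i) = 'X_i * u *+ 2 + 'X_i ^+ 2 * u^`M(i).
    by rewrite expr2 !mderivM mderivXi; ring.
  by rewrite /del dX2 mderivD mderivMn mderivM mderivXi !dX2; ring.
have -> : \sum_i 'X_i ^+ 2 * (raise f)^`M(i)^`M(i) =
    \sum_i raise ('X_i ^+ 2 * f^`M(i)^`M(i)) + (raise f + cubic f) *+ 2.
  rewrite {2}raiseE /cubic -big_split -sumrMnl -big_split; apply: eq_bigr => i _ /=.
  exact: E.
have -> : \sum_i \sum_(j | j != i) raise_quot f q i j = \sum_i raise (\sum_(j | j != i) q i j)
   + (\sum_i \sum_(j | j != i) cross f q i j + \sum_i \sum_(j | j != i) (del i f + del j f)).
  rewrite -!big_split; apply: eq_bigr => i _ /=; rewrite raise_sum -!big_split; apply: eq_bigr => j _ /=.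
  by rewrite /raise_quot /cross -!/(del _ _); ring.
by rewrite scalerDr -scalerMnr -scalerMnl; ring.
Qed.

End RaiseOperator.

Section RaiseJack.

Variables (F : fieldType) (al : F) (J : seq nat -> symfun F) (M : nat).
Variable Jh : jack_lift al J M.

Local Notation eigen2 := (eigen2 al).
Local Notation pieri_up := (pieri_up Jh).

Let natF := pos_nat_neq0 (lift_positive Jh).
Let al0 := pos_al_neq0 (lift_positive Jh).

(** Dividing by 2 alpha turns a difference of [eigen2] into the content (j - 1) - (i - 1)/alpha of
    the added box. *)
Definition shift (la mu : seq nat) : F := (eigen2 mu - eigen2 la) / (2%:R * al).

Lemma raise2_expand la : is_partn la -> (sumn la < M)%N ->
  raise2 (Jh la) = \sum_(mu <- partns (sumn la).+1 (sumn la).+1) (pieri_up la mu * shift la mu) *: Jh mu.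
Proof.
move=> pl lM; have a2 : al *+ 2 != 0 by rewrite -mulr_natl mulf_neq0 ?natF.
apply: (scalerI a2); rewrite (D2_p1_expand Jh pl lM) scaler_sumr; apply: eq_bigr => mu _.
by rewrite scalerA /shift; congr (_ *: _); field; rewrite natF al0.
Qed.

Lemma raise_jack n la : is_partn la -> (sumn la < M)%N ->
  raise (J la n) = \sum_(mu <- partns (sumn la).+1 (sumn la).+1) (pieri_up la mu * shift la mu) *: J mu n.
Proof.
move=> pl lM; rewrite -(Phi_expand Jh) // -raise2_expand // (Phi_raise2 _ (lift_homog Jh pl (ltnW lM)) lM).
by rewrite lift_Phi // ltnW.
Qed.

(** A multiplies the Pieri components by s, and the commutator with D multiplies by s once more. The
    term 2 (n - 1) A of [lap_raise] cancels against the change of degree in [lap_Phi]. *)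
Lemma cubic_jack n la (f := J la n) (q := ps_quot (Jh la)) : is_partn la -> (sumn la < M)%N ->
  cubic f + raise f + (2%:R * al)^-1 *: \sum_i \sum_(j | j != i) cross f q i j =
  \sum_(mu <- partns (sumn la).+1 (sumn la).+1) (pieri_up la mu * shift la mu ^+ 2) *: J mu n.
Proof.
move=> pl lM; set d := sumn la in lM *; have lM' := ltnW lM.
have q0 : lap_quot f q by rewrite /f -(lift_Phi Jh) //; exact: ps_quotP.
have l0 : lap al f q = (eigen2 la + 2%:R * (n%:R - 1) * d%:R) *: f.
  rewrite /f -(lift_Phi Jh) // (lap_Phi _ _ (lift_homog Jh pl lM') lM') (D2_Jh Jh) // PhiZ.
  by rewrite -scalerDl.
pose g mu := pieri_up la mu * shift la mu.
have eR : Phi n (\sum_(mu <- partns d.+1 d.+1) g mu *: Jh mu) = raise f.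
  by rewrite (Phi_expand Jh) // /f raise_jack.
have e1 := lap_expand Jh n g lM.
have q1 := ps_quotP (N := n) (\sum_(mu <- partns d.+1 d.+1) g mu *: Jh mu).
rewrite eR in e1 q1; have e2 := lap_raise al f q.
rewrite (lap_uniq al (lap_quot_raise q0) q1) e1 l0 in e2.
have rZ c u : raise (c *: u : {mpoly F[n]}) = c *: raise u.
  by rewrite /raise scaler_sumr; apply: eq_bigr => i _; rewrite mderivZ scalerAr.
have n1 : raise f *+ n.-1 *+ 2 = (2%:R * (n%:R - 1)) *: raise f.
  case: (posnP n) => n0.
    have -> : raise f = 0 by rewrite /raise big1 // => i; have := ltn_ord i; rewrite {2}n0.
    by rewrite scaler0 !mul0rn.
  have nE : n%:R - 1 = n.-1%:R :> F by rewrite -{1}(prednK n0) -natr1 addrK.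
  by rewrite -mulrnA -scaler_nat mulnC natrM nE.
rewrite rZ n1 in e2.
have a2 : 2%:R * al != 0 by rewrite mulf_neq0 ?natF.
apply: (scalerI a2); rewrite scalerDr scalerA divff // scale1r.
have -> : (2%:R * al) *: (cubic f + raise f) = (al *+ 2) *: (raise f + cubic f).
  by rewrite addrC mulr_natl.
have e3 : raise f = \sum_(mu <- partns d.+1 d.+1) g mu *: J mu n by rewrite /f raise_jack.
move: e2; set S := \sum_i _; set B := (al *+ 2) *: _ => e2.
transitivity (\sum_(ka <- partns d.+1 d.+1) (g ka * (eigen2 ka + 2 * (n%:R - 1) * d.+1%:R)) *: J ka n
   - (eigen2 la + 2%:R * (n%:R - 1) * d.+1%:R) *: raise f).
  rewrite e2; have -> : eigen2 la + 2%:R * (n%:R - 1) * d.+1%:R =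
      eigen2 la + 2%:R * (n%:R - 1) * d%:R + 2%:R * (n%:R - 1) by rewrite -(natr1 d); ring.
  by move: (eigen2 la + 2%:R * (n%:R - 1) * d%:R) (2%:R * (n%:R - 1)) => c c'; rewrite -!mul_mpolyC mpolyCD; ring.
rewrite e3 !scaler_sumr -sumrB; apply: eq_bigr => mu _.
rewrite !scalerA -scalerBl; congr (_ *: _); rewrite /g /shift.
by field; rewrite natF al0.
Qed.

End RaiseJack.

(* Field identities, stated abstractly because [field] is slow in {fraction {mpoly K[n]}}. *)
Lemma divided_diff_frac (E : fieldType) (x p u v : E) : x != 0 ->
  p * (u - v) *+ 2 = x * (2%:R * (p / x * u - p / x * v)).
Proof. by move=> x0; field. Qed.

Lemma double_sub_opp (E : comPzRingType) (z w : E) : z = - w -> 2%:R * (z - w) = 4%:R * z.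
Proof. by move=> ->; ring. Qed.

(** * R(a, b) as a polynomial operator *)

Section RopQuotient.

Variables (n : nat) (K : fieldType) (al a b : K).
Implicit Types (f : {mpoly K[n]}).

Definition Rpoly f (q : 'I_n -> 'I_n -> {mpoly K[n]}) : {mpoly K[n]} :=
  cubic f + (a + b + 1) *: raise f + (a * b) *: (psum K n 1 * f)
  + (2%:R * al)^-1 *: \sum_i \sum_(j | j != i) cross f q i j.

(** Exchanging i and j negates x_i x_j / (x_i - x_j), so the interaction sum is half of its
    antisymmetrization; by [crossP] the cross terms add up to 4 times it, and 2/alpha = 4/(2
    alpha). *)
Lemma Rop_quot f q : lap_quot f q -> (2%:R : K) != 0 -> al != 0 -> Rop al a b f = tofrac (Rpoly f q).
Proof.
move=> h n2 al0; rewrite /Rop /Rpoly.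
have -> : \sum_(i < n) ('X_i ^+ 3 * mderiv i (mderiv i f) + (a + b + 1) *: ('X_i ^+ 2 * mderiv i f)
    + (a * b) *: ('X_i * f)) = cubic f + (a + b + 1) *: raise f + (a * b) *: (psum K n 1 * f).
  by rewrite !big_split -!scaler_sumr /psum mulr_suml.
rewrite [in RHS]tofracD; congr (_ + _).
pose t i j : {fraction {mpoly K[n]}} := tofrac ('X_i * 'X_j) / tofrac ('X_i - 'X_j).
have S : \sum_i \sum_(j | j != i) t i j * tofrac ('X_i * mderiv i f) =
    - \sum_i \sum_(j | j != i) t i j * tofrac ('X_j * mderiv j f).
  rewrite [in RHS](exchange_big_dep predT) //= -sumrN; apply: eq_bigr => i _.
  rewrite -sumrN; apply: eq_big => [j|j _]; first by rewrite eq_sym.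
  rewrite /t -['X_j - 'X_i]opprB tofracN invrN mulrN mulNr opprK.
  by congr (tofrac _ / _ * _); rewrite mulrC.
have T : tofrac (\sum_i \sum_(j | j != i) cross f q i j) =
    4%:R * \sum_i \sum_(j | j != i) t i j * tofrac ('X_i * mderiv i f).
  transitivity (2%:R * (\sum_i \sum_(j | j != i) t i j * tofrac ('X_i * mderiv i f)
      - \sum_i \sum_(j | j != i) t i j * tofrac ('X_j * mderiv j f))).
    rewrite -sumrB mulr_sumr rmorph_sum; apply: eq_bigr => i _ /=.
    rewrite -sumrB mulr_sumr rmorph_sum; apply: eq_bigr => j ji /=.
    have X0 : tofrac ('X_i - 'X_j) != 0 :> {fraction {mpoly K[n]}} by rewrite tofrac_eq0 X_sub_neq0.
    apply: (mulfI X0); rewrite -tofracM (crossP _ _ h) scaler_nat tofracMn tofracM tofracB /t.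
    exact: divided_diff_frac.
  exact: double_sub_opp.
rewrite -mul_mpolyC tofracM T; set Z := \sum_i _.
have C2 : tofrac (2%:R / al)%:MP = 4%:R * tofrac ((2%:R * al)^-1)%:MP :> {fraction {mpoly K[n]}}.
  have -> : 4%:R = tofrac (4%:R)%:MP :> {fraction {mpoly K[n]}}.
    by rewrite [4%:R%:MP]rmorph_nat rmorph_nat.
  rewrite -tofracM -mpolyCM; congr (tofrac _%:MP).
  by field; rewrite n2 al0.
by rewrite C2 [in RHS]mulrCA mulrA.
Qed.

End RopQuotient.

Section RopLinear.

Variables (n : nat) (K : fieldType) (al a b : K).
Implicit Types (f g : {mpoly K[n]}).

Lemma RopD f g : Rop al a b (f + g) = Rop al a b f + Rop al a b g.
Proof.
rewrite /Rop; set C := tofrac _%:MP.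
have -> : \sum_(i < n) \sum_(j < n | j != i)
    tofrac ('X_i * 'X_j) / tofrac ('X_i - 'X_j) * tofrac ('X_i * mderiv i (f + g)) =
  \sum_(i < n) \sum_(j < n | j != i) tofrac ('X_i * 'X_j) / tofrac ('X_i - 'X_j) * tofrac ('X_i * mderiv i f) +
  \sum_(i < n) \sum_(j < n | j != i) tofrac ('X_i * 'X_j) / tofrac ('X_i - 'X_j) * tofrac ('X_i * mderiv i g).
  rewrite -big_split; apply: eq_bigr => i _; rewrite -big_split; apply: eq_bigr => j _ /=.
  by rewrite mderivD mulrDr (tofracD ('X_i * f^`M(i))) [LHS]mulrDr.
rewrite mulrDr addrACA; congr (_ + _); rewrite -tofracD -big_split; congr tofrac.
by apply: eq_bigr => i _ /=; rewrite !mderivD !mulrDr !scalerDr; ring.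
Qed.

Lemma RopZ c f : Rop al a b (c *: f) = tofrac c%:MP * Rop al a b f.
Proof.
rewrite /Rop [in RHS]mulrDr [in RHS](mulrCA (tofrac c%:MP)) -tofracM mul_mpolyC scaler_sumr.
rewrite [X in _ = _ + _ * X]mulr_sumr; congr (tofrac _ + _ * _); apply: eq_bigr => i _.
  by rewrite !mderivZ -!mul_mpolyC; ring.
rewrite [RHS]mulr_sumr; apply: eq_bigr => j _.
by rewrite mderivZ -scalerAr -mul_mpolyC (tofracM c%:MP) mulrCA.
Qed.

Lemma Rop0 : Rop al a b (0 : {mpoly K[n]}) = 0.
Proof. by rewrite -(scale0r 0) RopZ mpolyC0 tofrac0 mul0r. Qed.

Lemma Rop_sum (T : eqType) (s : seq T) (c : T -> K) (f g : T -> {mpoly K[n]}) :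
  (forall t, t \in s -> Rop al a b (f t) = tofrac (g t)) ->
  Rop al a b (\sum_(t <- s) c t *: f t) = tofrac (\sum_(t <- s) c t *: g t).
Proof.
elim: s => [|t s IH] h; first by rewrite !big_nil Rop0 tofrac0.
rewrite !big_cons RopD IH => [|u us]; last by apply: h; rewrite in_cons us orbT.
rewrite RopZ h ?mem_head // [in RHS]tofracD; congr (_ + _).
by rewrite -tofracM mul_mpolyC.
Qed.

End RopLinear.

(** * Extension of scalars from Q(alpha) to K *)

Section Transfer.

Variables (n : nat) (F K : fieldType) (iota : {rmorphism F -> K}).
Implicit Types (f : {mpoly F[n]}).

Local Notation mp := (map_mpoly iota).

Lemma map_mderiv i f : (mp f)^`M(i) = mp f^`M(i).
Proof. by apply/mpolyP => m; rewrite mcoeff_mderiv !mcoeff_map_mpoly mcoeff_mderiv /= rmorphMn. Qed.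

Lemma map_X i : mp ('X_i : {mpoly F[n]}) = 'X_i.
Proof. exact: map_mpolyX. Qed.

Lemma map_lap_quot f q : lap_quot f q -> lap_quot (mp f) (fun i j => mp (q i j)).
Proof.
by move=> h i j; rewrite !map_mderiv -!map_X -!rmorphXn -!rmorphM -!rmorphB -rmorphM /= h.
Qed.

Lemma map_cubic f : cubic (mp f) = mp (cubic f).
Proof.
rewrite /cubic rmorph_sum; apply: eq_bigr => i _ /=.
by rewrite !map_mderiv rmorphM rmorphXn /= map_X.
Qed.

Lemma map_raise f : raise (mp f) = mp (raise f).
Proof.
rewrite /raise rmorph_sum; apply: eq_bigr => i _ /=.
by rewrite !map_mderiv rmorphM rmorphXn /= map_X.
Qed.

Lemma map_psum k : psum K n k = mp (psum F n k).
Proof. by rewrite /psum rmorph_sum; apply: eq_bigr => i _ /=; rewrite rmorphXn /= map_X. Qed.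

Lemma map_cross f q i j : cross (mp f) (fun i j => mp (q i j)) i j = mp (cross f q i j).
Proof.
by rewrite /cross !map_mderiv -!map_X -!rmorphXn -rmorphD -!rmorphM -rmorphD -rmorphB.
Qed.

Lemma map_lincomb (T : Type) (s : seq T) (c : T -> F) (f : T -> {mpoly F[n]}) :
  mp (\sum_(t <- s) c t *: f t) = \sum_(t <- s) iota (c t) *: mp (f t).
Proof. by rewrite rmorph_sum; apply: eq_bigr => t _; exact: map_mpolyZ. Qed.

Variables (al : F) (J : seq nat -> symfun F) (M : nat) (Jh : jack_lift al J M) (a b : K).

(** Collects s^2 + (a + b) s + ab = (a + s)(b + s). Of the coefficient a + b + 1, the 1 completes
    the cubic part to the operator of [cubic_jack], which acts by s^2. *)
Lemma Rop_jack la : is_partn la -> (sumn la < M)%N ->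
  Rop (iota al) a b (mp (J la n)) = tofrac (\sum_(mu <- partns (sumn la).+1 (sumn la).+1)
    (iota (pieri_up Jh la mu) * (a + iota (shift al la mu)) * (b + iota (shift al la mu))) *: mp (J mu n)).
Proof.
move=> pl lM; have al0 := pos_al_neq0 (lift_positive Jh); have natF := pos_nat_neq0 (lift_positive Jh).
have q0 : lap_quot (J la n) (ps_quot (Jh la)) by rewrite -(lift_Phi Jh) ?(ltnW lM) //; exact: ps_quotP.
rewrite (Rop_quot a b (map_lap_quot q0)) ?fmorph_eq0 //; last by rewrite -(rmorph_nat iota) fmorph_eq0 natF.
congr tofrac; rewrite /Rpoly map_cubic map_raise map_psum -rmorphM /=.
have -> : \sum_i \sum_(j | j != i) cross (mp (J la n)) (fun i j => mp (ps_quot (Jh la) i j)) i j =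
    mp (\sum_i \sum_(j | j != i) cross (J la n) (ps_quot (Jh la)) i j).
  rewrite rmorph_sum; apply: eq_bigr => i _ /=; rewrite rmorph_sum; apply: eq_bigr => j _ /=.
  exact: map_cross.
have -> : (2%:R * iota al)^-1 = iota (2%:R * al)^-1 by rewrite fmorphV rmorphM rmorph_nat.
rewrite -map_mpolyZ (p1_jack Jh n pl lM).
set S := _ *: \sum_i _; set P := \sum_(mu <- _) _.
have -> : mp (cubic (J la n)) + (a + b + 1) *: mp (raise (J la n)) + (a * b) *: mp P + mp S =
   mp (cubic (J la n) + raise (J la n) + S) + (a + b) *: mp (raise (J la n)) + (a * b) *: mp P.
  by rewrite !rmorphD /= (scalerDl _ (a + b)) scale1r; ring.
rewrite /S (cubic_jack Jh n pl lM) (raise_jack Jh n pl lM) /P !map_lincomb.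
rewrite !scaler_sumr -!big_split; apply: eq_bigr => mu _ /=.
by rewrite !scalerA -!scalerDl; congr (_ *: _); rewrite expr2 !rmorphM /=; ring.
Qed.

End Transfer.

(** * The recursion between homogeneous components *)

Section Recursion.

Variables (n : nat) (F K : fieldType) (iota : {rmorphism F -> K}) (al : F).
Variables (J : seq nat -> symfun F) (a b c : K).
Hypotheses (Hpos : positive_param al) (J_jack : jack_family al J).
Hypothesis (Hc : forall k, c + k%:R != 0).

Let natF := pos_nat_neq0 Hpos.
Let al0 := pos_al_neq0 Hpos.

Local Notation mp := (map_mpoly iota).
Local Notation jack_series := (@jack_series n F K iota al J).
Local Notation hat := (hatF21 n iota al J a b c).

Lemma natK k : k.+1%:R != 0 :> K.
Proof. by rewrite -(rmorph_nat iota) fmorph_eq0 natF. Qed.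

Lemma mcoeff_homog_comp d (G : mseries n K) m :
  (homog_comp d G)@_m = if mdeg m == d then G m else 0.
Proof.
rewrite /homog_comp mcoeff_bigsum; case: eqP => [dm|/eqP ne].
  have lt : (mdeg m < d.+1)%N by rewrite dm.
  rewrite (bigD1 (BMultinom lt)) /= ?dm // mcoeffZ mcoeffX eqxx mulr1 big1 ?addr0 // => m' /andP[_ ne].
  rewrite mcoeffZ mcoeffX; case: eqP => [e|_]; last by rewrite mulr0.
  by move: ne; rewrite -val_eqE /= e eqxx.
rewrite big1 // => m' /eqP dm; rewrite mcoeffZ mcoeffX; case: eqP => [e|_]; last by rewrite mulr0.
by rewrite -e dm eqxx in ne.
Qed.

Lemma homog_comp_homog d (G : mseries n K) : homog_comp d G \is d.-homog.
Proof.
apply/dhomogP => m; rewrite mcoeff_msupp mcoeff_homog_comp.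
by case: (mdeg m =P d) => // _; rewrite eqxx.
Qed.

Definition jack_coef (C : seq nat -> K) la : K := C la * iota (al ^+ sumn la / jack_j al la).

Lemma map_jack_homog la : is_partn la -> mp (J la n) \is (sumn la).-homog.
Proof.
move=> pl; apply/dhomogP => m; rewrite mcoeff_msupp mcoeff_map_mpoly fmorph_eq0 -mcoeff_msupp.
by move=> h; rewrite (dhomog_mf (jack_homog J_jack n pl) h).
Qed.

(** Partitions with more than n parts may be included because their J_la vanish in n variables;
    Pieri sums can then run over all partitions of a degree. *)
Lemma homog_comp_jack d C : homog_comp d (jack_series C) =
  \sum_(la <- partns d d) jack_coef C la *: mp (J la n).
Proof.
have pe : perm_eq (partns n d) [seq la <- partns d d | (size la <= n)%N].
  apply: uniq_perm; rewrite ?filter_uniq ?partns_uniq // => la.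
  by rewrite mem_filter partns_diag mem_partns andbCA.
transitivity (\sum_(la <- partns n d) jack_coef C la *: mp (J la n)).
  apply/mpolyP => m; rewrite mcoeff_homog_comp; case: eqP => [<-//|/eqP ne].
  rewrite mcoeff_bigsum big_seq big1 // => la /mem_partnsP[pl _ sl].
  by rewrite mcoeffZ (dhomog_nemf_coeff (map_jack_homog pl)) ?mulr0 // sl.
rewrite (perm_big _ pe) big_filter big_mkcond; apply: eq_big_seq => la.
rewrite partns_diag => /andP[pl _]; case: leqP => // lt.
by rewrite (jack_eq0 J_jack) // rmorph0 scaler0.
Qed.

Lemma Rop_homog_comp d C (Jh : jack_lift al J d.+1) :
  Rop (iota al) a b (homog_comp d (jack_series C)) =
  tofrac (\sum_(mu <- partns d.+1 d.+1) (\sum_(la <- partns d d) jack_coef C la *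
    (iota (pieri_up Jh la mu) * (a + iota (shift al la mu)) * (b + iota (shift al la mu)))) *: mp (J mu n)).
Proof.
rewrite homog_comp_jack; under [in RHS]eq_bigr => mu _ do rewrite scaler_suml.
rewrite exchange_big /=.
rewrite (@Rop_sum _ _ _ _ _ _ _ _ _ (fun la => \sum_(mu <- partns d.+1 d.+1)
    (iota (pieri_up Jh la mu) * (a + iota (shift al la mu)) * (b + iota (shift al la mu))) *: mp (J mu n))).
  congr tofrac; apply: eq_bigr => la _; rewrite scaler_sumr.
  by apply: eq_bigr => mu _; rewrite scalerA.
move=> la; rewrite partns_diag => /andP[pl /eqP sl].
by rewrite (Rop_jack n iota Jh) ?sl.
Qed.

Lemma poch_neq0 k : poch c k != 0.
Proof. by apply/prodf_neq0 => i _; exact: Hc. Qed.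

(** On the Pieri support (a)_la (a + s) = (a)_mu, and likewise for b, so these factors leave the sum
    over la and [sum_pieri_up_norm] evaluates the rest. *)
Lemma Rop_hat d : Rop (iota al) a b (homog_comp d hat) =
  tofrac ((d.+1%:R * (c + d%:R)) *: homog_comp d.+1 hat).
Proof.
have [Jh _] := jack_lift_exists d.+1 J_jack Hpos.
rewrite /hatF21 (Rop_homog_comp _ Jh) (homog_comp_jack d.+1) scaler_sumr; congr tofrac.
apply: eq_big_seq => mu; rewrite partns_diag => /andP[pm /eqP sm].
rewrite scalerA; congr (_ *: _).
rewrite /jack_coef sm.
transitivity (\sum_(la <- partns d d) gen_poch (iota al) a mu * gen_poch (iota al) b mu / poch c d *
    iota (pieri_up Jh la mu * (al ^+ d / jack_j al la))).
  apply: eq_big_seq => la; rewrite partns_diag => /andP[pl /eqP sl]; rewrite sl.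
  case: (eqVneq (pieri_up Jh la mu) 0) => [->|nz]; first by rewrite !mul0r rmorph0 !mul0r !mulr0.
  have s : sumn mu = (sumn la).+1 by rewrite sm sl.
  have mM : (sumn mu <= d.+1)%N by rewrite sm.
  rewrite -(pieri_down_eq0 Jh) // in nz; have [i hi] := pieri_support pm pl s mM nz.
  have ial : iota al != 0 by rewrite fmorph_eq0.
  have es : iota (shift al la mu) = content (iota al) la i / iota al.
    rewrite /shift (eigen2_boxadd al pl pm hi).
    have -> : content (iota al) la i = iota (content al la i).
      by rewrite /content rmorphB rmorphM !rmorph_nat.
    by rewrite -fmorph_div; congr (iota _); field; rewrite natF al0.
  rewrite es !(gen_poch_boxadd _ ial pl hi) rmorphM /=.
  ring.
rewrite -mulr_sumr -rmorph_sum (sum_pieri_up_norm Jh pm sm (ltnSn d)) rmorphM rmorph_nat.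
have -> : poch c d.+1 = poch c d * (c + d%:R) by rewrite /poch big_ord_recr.
have h1 := Hc d; have h2 := poch_neq0 d.
move: (iota (_ / _)) (gen_poch _ a mu * _) => x y.
by field; rewrite h1 h2.
Qed.

Lemma Nhat_homog d (f : {mpoly K[n]}) : f \is d.-homog -> Nhat c f = (d%:R * (c + d%:R - 1)) *: f.
Proof.
move=> hf; rewrite /Nhat.
have e g : g \is d.-homog -> euler_op g = d%:R *: g by exact: euler_homog.
by rewrite !e ?rpredZ // !scalerA -scalerDl; congr (_ *: _); ring.
Qed.

Local Notation op := (fun f => tofrac (Nhat c f) - Rop (iota al) a b f).

Lemma hat_termwise : termwise op hat (fun _ => 0).
Proof.
exists (fun d => (d%:R * (c + d%:R - 1)) *: homog_comp d hat
   - (d.+1%:R * (c + d%:R)) *: homog_comp d.+1 hat); split.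
  by move=> d; rewrite Rop_hat (Nhat_homog (homog_comp_homog _ _)) tofracB.
(* The sum telescopes, as R F_d = N F_(d+1); what remains has degree D > deg m. *)
move=> m; exists (mdeg m).+1 => D lt.
have -> : \sum_(d < D) ((d%:R * (c + d%:R - 1)) *: homog_comp d hat
   - (d.+1%:R * (c + d%:R)) *: homog_comp d.+1 hat) = - ((D%:R * (c + D%:R - 1)) *: homog_comp D hat).
  elim: {lt} D => [|D IH]; first by rewrite big_ord0 mul0r scale0r oppr0.
  by rewrite big_ord_recr /= IH addKr -(natr1 D) addrA addrK.
by rewrite mcoeffN mcoeffZ mcoeff_homog_comp ltn_eqF // mulr0 oppr0.
Qed.

(** The equation concerns the sum of all terms and is resolved by degree: in degree d + 1 only N
    F_(d+1) and R F_d contribute. *)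
Lemma termwise_recursion (G : mseries n K) d : jack_series_space iota al J G ->
  termwise op G (fun _ => 0) ->
  Rop (iota al) a b (homog_comp d G) = tofrac ((d.+1%:R * (c + d%:R)) *: homog_comp d.+1 G).
Proof.
case=> C GC [u [hu su]]; pose r e := Nhat c (homog_comp e G) - u e.
have hr e : Rop (iota al) a b (homog_comp e G) = tofrac (r e).
  by rewrite /r tofracB -hu opprB addrC subrK.
(* That R raises the degree by exactly one is read off the Jack expansion; here membership of G in
   the series space enters. *)
have homr e : r e \is e.+1.-homog.
  have [Jh _] := jack_lift_exists e.+1 J_jack Hpos.
  have := hr e; rewrite {1}GC (Rop_homog_comp _ Jh) => /eqP; rewrite tofrac_eq => /eqP <-.
  rewrite big_seq rpred_sum // => mu; rewrite partns_diag => /andP[pm /eqP sm].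
  by rewrite rpredZ // -sm map_jack_homog.
rewrite hr; congr tofrac; apply/mpolyP => m; rewrite mcoeffZ mcoeff_homog_comp.
case: eqP => [dm|/eqP ne]; last by rewrite mulr0 (dhomog_nemf_coeff (homr d)).
(* The bound d + 2 makes both indices d and d + 1 occur in the partial sum. *)
have [D0 /(_ (maxn D0 d.+2) (leq_maxl _ _))] := su m.
set D := maxn _ _; have lt : (d.+1 < D)%N by rewrite /D leq_maxr.
rewrite mcoeff_bigsum.
have uE (e : 'I_D) : (u e)@_m = (if d.+1 == e then (d.+1%:R * (c + d%:R)) * G m else 0)
    - (if d == e then (r d)@_m else 0).
  have -> : u e = Nhat c (homog_comp e G) - r e by rewrite /r subKr.
  rewrite mcoeffB (Nhat_homog (homog_comp_homog _ _)) mcoeffZ mcoeff_homog_comp dm; congr (_ - _).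
    by case: eqP => [<-|]; rewrite ?mulr0 // -(natr1 d) addrA addrK.
  by case: eqP => [<-//|/eqP ne]; rewrite (dhomog_nemf_coeff (homr e)) //= dm eqSS.
rewrite (eq_bigr _ (fun e _ => uE e)) sumrB -!big_mkcond /=.
rewrite (big_pred1 (Ordinal lt)) => [|e]; last by rewrite /= -val_eqE /= eq_sym.
rewrite (big_pred1 (Ordinal (ltnW lt))) => [|e]; last by rewrite /= -val_eqE /= eq_sym.
by move/eqP; rewrite subr_eq0 => /eqP ->.
Qed.

Lemma hat0 : hat 0%MM = 1.
Proof.
have [Jh _] := jack_lift_exists 0 J_jack Hpos.
have := mcoeff_homog_comp 0 hat 0%MM; rewrite mdeg0 eqxx => <-.
rewrite /hatF21 homog_comp_jack (perm_big [:: [::]]) ?big_seq1; last first.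
  apply: uniq_perm; rewrite ?partns_uniq // => la; rewrite partns_diag inE.
  apply/andP/eqP => [[pl /eqP s0]|->//]; apply/size0nil/eqP.
  by rewrite -leqn0 -s0 size_partn.
rewrite /jack_coef /gen_poch /jack_j /box_prod !big_geq //= /poch big_ord0 !mulr1 expr0 !divr1.
by rewrite -(lift_Phi Jh) // lift_nil Phi1 !rmorph1 mulr1 scale1r mcoeff1 eqxx.
Qed.

Lemma hat_unique : unique (fun G : mseries n K =>
  [/\ jack_series_space iota al J G, termwise op G (fun _ => 0) & G 0%MM = 1]) hat.
Proof.
split; first by split; [exists (fun la => gen_poch (iota al) a la * gen_poch (iota al) b la / poch c (sumn la))
  | exact: hat_termwise | exact: hat0].
move=> G [spG twG G0]; apply: FunctionalExtensionality.functional_extensionality => m.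
suff e d : homog_comp d hat = homog_comp d G.
  by have := congr1 (mcoeff m) (e (mdeg m)); rewrite !mcoeff_homog_comp eqxx.
elim: d => [|d IH].
  apply/mpolyP => m'; rewrite !mcoeff_homog_comp; case: eqP => // /eqP.
  by rewrite mdeg_eq0 => /eqP ->; rewrite hat0 G0.
have k0 : d.+1%:R * (c + d%:R) != 0 :> K by rewrite mulf_neq0 ?natK.
apply: (scalerI k0); have := Rop_hat d; rewrite IH (termwise_recursion d spG twG) => /eqP.
by rewrite tofrac_eq => /eqP.
Qed.

End Recursion.

Lemma c_nat_neq0 k : c_ + k%:R != 0.
Proof.
have -> : k%:R = tofrac (k%:R : {mpoly Qalpha[3]}) :> Kabc by rewrite rmorph_nat.
rewrite /c_ -tofracD tofrac_eq0; apply/eqP => /(congr1 (mcoeff U_(inord 2))).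
rewrite mcoeffD mcoeffXU eqxx mcoeff0 mcoeffMn mcoeff1 mnm1_eq0 mul0rn addr0 => /eqP.
by rewrite oner_eq0.
Qed.

Theorem mainTheorem5 (n : nat) (n_ge1 : (1 <= n)%N)
    (J : seq nat -> symfun Qalpha) (J_jack : jack_family alpha J) :
  unique
    (fun G : mseries n Kabc =>
       [/\ jack_series_space Kconst alpha J G,
           termwise (fun f => tofrac (Nhat c_ f) - Rop (Kconst alpha) a_ b_ f)
                    G (fun _ => 0) &
           G 0%MM = 1])
    (hatF21 n Kconst alpha J a_ b_ c_).
Proof.
exact: (hat_unique n Kconst a_ b_ alpha_positive J_jack c_nat_neq0).
Qed.
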